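(* Let $n\geq 5$. Then for every $f\in H^2(\mathbb{R}^n)$ the following equalities hold: \begin{align*} \|\Delta f\|_{L^2(\mathbb{R}^n)}^2 &=\left\|\partial_r^2 f+\frac{n-1}{|x|}\partial_r f\right\|_{L^2(\mathbb{R}^n)}^2+\left\|\sum_{j=1}^n L_j^2 f\right\|_{L^2(\mathbb{R}^n)}^2\\ &\quad+\frac{n(n-4)}{2}\sum_{j=1}^n\left\|\frac{1}{|x|}L_j f\right\|_{L^2(\mathbb{R}^n)}^2+2\sum_{j=1}^n\left\|\partial_r L_jf+\frac{n-2}{2|x|}L_j f\right\|_{L^2(\mathbb{R}^n)}^2\\ &=\left\||x|^{-n+1}\partial_r(|x|^{n-1}\partial_r f)\right\|_{L^2(\mathbb{R}^n)}^2+\left\|\sum_{j=1}^n L_j^2 f\right\|_{L^2(\mathbb{R}^n)}^2\\ &\quad+\frac{n(n-4)}{2}\sum_{j=1}^n\left\|\frac{1}{|x|}L_j f\right\|_{L^2(\mathbb{R}^n)}^2+2\sum_{j=1}^n\left\||x|^{-\frac{n}{2}+1}\partial_r(|x|^{\frac{n}{2}-1}L_j f)\right\|_{L^2(\mathbb{R}^n)}^2. \end{align*}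
   Context: Functions are complex-valued. $H^2(\mathbb{R}^n)=(1-\Delta)^{-1}L^2(\mathbb{R}^n)$ is the standard Sobolev space of order $2$, and $\Delta=\sum_{j=1}^n\partial_j^2$ is the Laplacian on $\mathbb{R}^n$. The operator $\partial_r=\frac{x}{|x|}\cdot\nabla=\sum_{j=1}^n\frac{x_j}{|x|}\partial_j$ is the radial derivative on $\mathbb{R}^n$. For $1\leq j\leq n$, $L_j$ denotes the spherical derivative $L_j=\partial_j-\frac{x_j}{|x|}\partial_r=\partial_j-\sum_{k=1}^n\frac{x_jx_k}{|x|^2}\partial_k$. *)

(* Defs.v *)
From HB Require Import structures.
From mathcomp Require Import all_boot all_order all_algebra.
From mathcomp Require Import all_classical all_reals all_analysis.
From mathcomp Require Import complex.

Set Implicit Arguments.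
Unset Strict Implicit.
Unset Printing Implicit Defensive.
Import Order.TTheory GRing.Theory Num.Theory.
Import numFieldNormedType.Exports.

Local Open Scope classical_set_scope.
Local Open Scope ring_scope.
Local Open Scope complex_scope.

Definition rV_display : measure_display -> measure_display.
Proof. exact. Qed.

Section rV_measurable.
Context (R : realType) (n : nat).

(* The product sigma-algebra, generated by the coordinates; it is also the
   Borel sigma-algebra of the topology of ['rV[R]_n]. *)
Definition rV_coord (i : 'I_n) (x : 'rV[R]_n) : measurableTypeR R := x ord0 i.

Let rV_set0 : g_sigma_preimage rV_coord set0.
Proof. exact: sigma_algebra0. Qed.

Let rV_setC A : g_sigma_preimage rV_coord A -> g_sigma_preimage rV_coord (~` A).
Proof. exact: sigma_algebraC. Qed.

Let rV_bigcup (F : _^nat) : (forall i, g_sigma_preimage rV_coord (F i)) ->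
  g_sigma_preimage rV_coord (\bigcup_i (F i)).
Proof. exact: sigma_algebra_bigcup. Qed.

HB.instance Definition _ :=
  @isMeasurable.Build (rV_display default_measure_display)
  'rV[R]_n (g_sigma_preimage rV_coord) rV_set0 rV_setC rV_bigcup.

Lemma measurable_rV_coord (i : 'I_n) : measurable_fun setT (@rV_coord i).
Proof.
move=> _ Y mY; rewrite setTI; apply: sub_sigma_algebra => /=.
rewrite -bigcup_seq/=; exists i => /=; first by rewrite mem_index_enum.
by exists Y => //; rewrite setTI.
Qed.

Lemma measurable_fun_rVP d (T : measurableType d) (f : T -> 'rV[R]_n) :
  (forall i, measurable_fun setT (@rV_coord i \o f)) -> measurable_fun setT f.
Proof.
move=> mf.
have key : g_sigma_preimage rV_coord `<=` [set A | measurable (f @^-1` A)].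
  apply: smallest_sub.
    split => //=.
    - by rewrite preimage_set0; exact: measurable0.
    - by move=> A mA; rewrite /= setTD preimage_setC; exact: measurableC.
    - move=> F mF; rewrite /= preimage_bigcup; exact: bigcupT_measurable.
  move=> A; rewrite -bigcup_seq => -[i _ [B mB <-]] /=.
  by rewrite setTI -[X in measurable X]setTI; exact: (mf i).
by move=> _ Y mY; rewrite setTI; exact: key.
Qed.

End rV_measurable.

Section lebesgue_rV.
Context (R : realType).

Definition rV_cons (n : nat) (p : measurableTypeR R * 'rV[R]_n) : 'rV[R]_n.+1 :=
  row_mx (p.1)%:M p.2 : 'rV[R]_(1 + n).

Definition rV_uncons (n : nat) (x : 'rV[R]_n.+1) : measurableTypeR R * 'rV[R]_n :=
  (x ord0 ord0, rsubmx (x : 'rV[R]_(1 + n))).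

Lemma rV_consK n : cancel (@rV_cons n) (@rV_uncons n).
Proof.
move=> [a x]; rewrite /rV_uncons /rV_cons row_mxKr; congr pair => /=.
have e0 : ord0 = lshift n (ord0 : 'I_1) :> 'I_(1 + n) by exact: val_inj.
rewrite [X in fun_of_matrix _ _ X]e0.
by apply: etrans (row_mxEl _ _ _ _) _; rewrite mxE eqxx.
Qed.

Lemma measurable_rV_cons n : measurable_fun setT (@rV_cons n).
Proof.
apply: measurable_fun_rVP => i.
case: (split_ordP (i : 'I_(1 + n))) => j ->.
  rewrite (_ : _ \o _ = fst); first exact: measurable_fst.
  apply/funext => p /=; apply: etrans (row_mxEl _ _ _ _) _.
  by rewrite mxE (ord1 j) eqxx.
rewrite (_ : _ \o _ = @rV_coord R n j \o snd).
  by apply: measurableT_comp; [exact: measurable_rV_coord|exact: measurable_snd].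
by apply/funext => p /=; exact: row_mxEr.
Qed.

Lemma measurable_rV_uncons n : measurable_fun setT (@rV_uncons n).
Proof.
apply/measurable_fun_pairP; split.
  exact: (@measurable_rV_coord R n.+1 ord0).
apply: measurable_fun_rVP => i.
rewrite (_ : _ \o _ = @rV_coord R n.+1 (rshift 1 i)).
  exact: measurable_rV_coord.
by apply/funext => x /=; rewrite /rV_coord mxE.
Qed.

Section step.
Context (n : nat) (m : {sigma_finite_measure set 'rV[R]_n -> \bar R}).

Definition lebesgue_cons : set 'rV[R]_n.+1 -> \bar R :=
  pushforward (@lebesgue_measure R \x m)%E (@rV_cons n).

Let lebesgue_cons_measure : {measure set 'rV[R]_n.+1 -> \bar R}.
Proof.
refine (pushforward (@lebesgue_measure R \x m)%E (@rV_cons n)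
  : {measure set _ -> \bar R}).
exact: measurable_rV_cons.
Defined.

HB.instance Definition _ := Measure.copy lebesgue_cons lebesgue_cons_measure.

Let lebesgue_cons_sigma_finite : sigma_finite setT lebesgue_cons.
Proof.
have /sigma_finiteP[F [TF ndF Foo]] := sigma_finiteT (@lebesgue_measure R).
have /sigma_finiteP[G [TG ndG Goo]] := sigma_finiteT m.
exists (fun i => @rV_uncons n @^-1` (F i `*` G i)).
  rewrite -preimage_bigcup (_ : \bigcup_i _ = setT) ?preimage_setT//.
  apply/seteqP; split => // -[x y] _.
  have [i _ Fix] : (\bigcup_i F i) x by rewrite -TF.
  have [j _ Gjy] : (\bigcup_i G i) y by rewrite -TG.
  exists (maxn i j) => //; split => /=.
    by move: x Fix; exact/subsetPset/ndF/leq_maxl.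
  by move: y Gjy; exact/subsetPset/ndG/leq_maxr.
move=> i; have [mF ?] := Foo i; have [mG ?] := Goo i; split.
  rewrite -[X in measurable X]setTI.
  by apply: measurable_rV_uncons => //; exact: measurableX.
rewrite /lebesgue_cons /pushforward -comp_preimage.
rewrite (_ : _ \o _ = id); last by apply/funext; exact: rV_consK.
by rewrite preimage_id product_measure1E// lte_mul_pinfty// ge0_fin_numE.
Qed.

HB.instance Definition _ :=
  @Measure_isSigmaFinite.Build _ _ _ lebesgue_cons lebesgue_cons_sigma_finite.
End step.

(* R^(n+1) is identified with R x R^n, first coordinate split off. *)
Fixpoint lebesgue_rV (n : nat) : {sigma_finite_measure set 'rV[R]_n -> \bar R} :=
  match n with
  | 0 => \d_ (0 : 'rV[R]_0)
  | n'.+1 => lebesgue_cons (lebesgue_rV n')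
  end.

End lebesgue_rV.

Section sobolev.
Context (R : realType) (n : nat).
Local Notation mu := (lebesgue_rV R n).
Local Notation normc := ComplexField.Normc.normc.
Implicit Types (f g : 'rV[R]_n -> R[i]) (phi : 'rV[R]_n -> R) (j : 'I_n).

Definition cmeasurable f : Prop :=
  measurable_fun setT (fun x => complex.Re (f x)) /\
  measurable_fun setT (fun x => complex.Im (f x)).

Definition cintegral f : R[i] :=
  (\int[mu]_x complex.Re (f x)) +i* (\int[mu]_x complex.Im (f x)).

Definition normL2 f : \bar R := ('N[mu]_2%:E[(fun x => (normc (f x))%:E)])%E.

Definition memL2 f : Prop := cmeasurable f /\ (normL2 f < +oo)%E.

Definition loc_integrable f : Prop :=
  cmeasurable f /\ forall K : set 'rV[R]_n, compact K ->
    (\int[mu]_(x in K) (normc (f x))%:E < +oo)%E.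

Definition partial j phi : 'rV[R]_n -> R := 'D_(delta_mx ord0 j) phi.

Definition smooth phi : Prop := forall s : seq 'I_n,
  continuous (foldr partial phi s) /\
  forall j x, derivable (foldr partial phi s) x (delta_mx ord0 j).

(* Real-valued test functions suffice, since the identities tested below are
   complex linear in the test function. *)
Definition test_function phi : Prop :=
  smooth phi /\ compact (closure [set x | phi x != 0]).

Definition is_weak_partial j f g : Prop :=
  [/\ loc_integrable f, loc_integrable g & forall phi, test_function phi ->
    cintegral (fun x => f x * (partial j phi x)%:C) =
    - cintegral (fun x => g x * (phi x)%:C)].

(* A representative of the distributional derivative of [f] (unique up to null
   sets), and 0 if that derivative is not a locally integrable function. *)
Definition weak_partial j f : 'rV[R]_n -> R[i] :=
  xget (fun=> 0) [set g | is_weak_partial j f g].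

(* H^2 = (1 - Delta)^-1 L^2: [f] is the solution in L^2 of f - Delta f = g, in
   the sense of distributions, for some g in L^2. *)
Definition memH2 f : Prop :=
  memL2 f /\ exists2 g, memL2 g & forall phi, test_function phi ->
    cintegral (fun x =>
      f x * (phi x - \sum_(j < n) partial j (partial j phi) x)%:C) =
    cintegral (fun x => g x * (phi x)%:C).

(* The library's norm on ['rV[R]_n] is the sup norm. *)
Definition enorm (x : 'rV[R]_n) : R := Num.sqrt (\sum_(j < n) x ord0 j ^+ 2).

Definition laplacian f : 'rV[R]_n -> R[i] :=
  fun x => \sum_(j < n) weak_partial j (weak_partial j f) x.

Definition radial f : 'rV[R]_n -> R[i] :=
  fun x => \sum_(j < n) (x ord0 j / enorm x)%:C * weak_partial j f x.

Definition spherical j f : 'rV[R]_n -> R[i] :=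
  fun x => weak_partial j f x - (x ord0 j / enorm x)%:C * radial f x.

End sobolev.

(* Main.v *)
Require Import Defs.
From mathcomp Require Import all_boot all_order all_algebra.
From mathcomp Require Import all_classical all_reals all_analysis.
From mathcomp Require Import complex measurable_realfun ring lra.
Set Implicit Arguments.
Unset Strict Implicit.
Unset Printing Implicit Defensive.
Import Order.TTheory GRing.Theory Num.Theory.
Import numFieldNormedType.Exports.
Local Open Scope classical_set_scope.
Local Open Scope ring_scope.

(** Why the identities hold. Real and imaginary parts separate, so let [f] be real,
    with gradient [u] and Hessian [H]. Put [w = x / |x|], [y = w . u / |x|],
    [h = H w], [p = w . h], [tau = trace H] and [M = u . h / |x|]. Away from the
    origin the five terms are algebraic in these quantities: the radial part of the
    Laplacian is [A = p + (n - 1) y], both for [d_r^2 f + (n - 1) / |x| d_r f] and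
    for the weighted form; [sum_j L_j^2 f = tau - A]; [L_j f / |x|] is
    [u_j / |x| - w_j y]; and [d_r L_j f = h_j - w_j p]. Hence the difference of the
    integrands of the two sides is a linear combination of
      [p tau - |h|^2 + (n - 2) y tau - M + 2 y p],
      [(n - 2) |u|^2 / |x|^2 + 2 M],
      [|u|^2 / |x|^2 - 2 y^2 + M + y tau],
      [(n - 2) y^2 + 2 y p]
    (lemma [decomposition]), and each of these four integrates to zero. This is
    integration by parts for [K (H_ab H_cc - H_ac H_bc)] and for the derivatives of
    [K u_a u_b], where [K] is a product of coordinates and powers of [1 / |x|]
    ([hessian_identity], [gradient_identity], [gradient_identity3]).

    Two passages to the limit make this rigorous. First, the identities are proved
    for test functions and for multipliers with [1 / |x|^2] replaced by
    [1 / (|x|^2 + e)]. They extend to [H^2] because test functions approximate [f]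
    together with its first and second derivatives in mean square. As [H^2] is
    defined through the distributional equation for [f - Laplacian f], this is a
    regularity theorem ([lap_regularity]): mollification and cutoffs approximate
    [f] and its Laplacian ([lap_density]), and the Laplacian of a test function
    controls all its second derivatives ([test_hessian_le]). Secondly, [e] tends
    to zero by dominated convergence, the dominating functions being provided by
    Hardy's inequality: [u_a / |x|] is square integrable ([hardy]).

    It remains to compute the operators of the statement, whose weak derivatives
    are chosen representatives. Weak derivatives are unique almost everywhere
    ([wd_unique], from [fundamental_lemma]), and the product rules [wd_wdir] and
    [wd_enorm_powR] for the factors [x_a / |x|] and [|x|^s] show that each operator
    agrees almost everywhere with the expected expression in [u] and [H] (lemmas
    [parts_laplacian] to [parts_weighted_spherical]). *)


(** * Calculus of smooth functions *)

Section smooth_calculus.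
Context (R : realType) (n : nat).
Implicit Types (f g : 'rV[R]_n -> R) (j : 'I_n).
Local Notation e_ j := (delta_mx ord0 j : 'rV[R]_n).

(** Restriction to a line transfers the one-variable calculus, chain rule included,
    to directional derivatives. *)
Lemma is_derive_of_line f (x v : 'rV[R]_n) (a : R) :
  is_derive (0 : R) 1 (fun h : R => f (h *: v + x)) a -> is_derive x v f a.
Proof.
move=> [D1 <-]; split; first exact/derivable1P.
rewrite /derive; set g1 := fun h => _; set g2 := fun h => _.
suff -> : g1 = g2 by [].
by apply/funext => h; rewrite /g1 /g2 /= addr0 scale0r add0r [_%:A]mulr1.
Qed.

Lemma is_derive_line f (x v : 'rV[R]_n) (s a : R) :
  is_derive (s *: v + x) v f a -> is_derive s 1 (fun t : R => f (t *: v + x)) a.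
Proof.
have E : (fun h : R => h^-1 *: (f (h *: v + (s *: v + x)) - f (s *: v + x))) =
  (fun h : R => h^-1 *: (f ((h *: 1 + s) *: v + x) - f (s *: v + x))).
  by apply/funext => h; rewrite [h *: 1]mulr1 scalerDl addrA.
move=> [D1 D2]; split.
  by move: D1; rewrite /derivable E.
by move: D2; rewrite /derive E.
Qed.

Lemma is_derive_chain f (g : R -> R) (x v : 'rV[R]_n) (a b : R) :
  is_derive (f x) 1 g b -> is_derive x v f a -> is_derive x v (g \o f) (b * a).
Proof.
move=> dg df; apply: is_derive_of_line.
apply: (@is_derive1_comp _ g (fun h : R => f (h *: v + x))).
  by rewrite scale0r add0r.
by apply: is_derive_line; rewrite scale0r add0r.
Qed.

Lemma is_derive_coord (x : 'rV[R]_n) j k :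
  is_derive x (e_ j) (fun y : 'rV[R]_n => y ord0 k) (k == j)%:R.
Proof.
have H : (fun h : R => h^-1 *: ((h *: e_ j + x) ord0 k - x ord0 k)) @ 0^' -->
   ((k == j)%:R : R).
  apply: cvg_near_cst; near=> h.
  rewrite !mxE addrK /= scalerA mulVf ?mul1r; last by near: h; exact: nbhs_dnbhs_neq.
  by rewrite scale1r.
split; first by apply/cvg_ex; exists (k == j)%:R.
exact: cvg_lim.
Unshelve. all: by end_near. Qed.

(** Smoothness speaks of all iterated derivatives; it is established by exhibiting
    a class of functions that is stable under partial derivatives. *)
Lemma smooth_coind (P : ('rV[R]_n -> R) -> Prop) :
  (forall f, P f -> continuous f /\
     forall j, (forall x, derivable f x (e_ j)) /\ P (partial j f)) ->
  forall f, P f -> smooth f.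
Proof.
move=> PP f Pf s.
have Ps : P (foldr (@partial R n) f s).
  by elim: s => //= j s /PP[_ /(_ j)[]].
by have [? D] := PP _ Ps; split => // j x; have [] := D j.
Qed.

Lemma smooth_continuous f : smooth f -> continuous f.
Proof. by move=> /(_ [::])[]. Qed.

Lemma smooth_derivable f j x : smooth f -> derivable f x (e_ j).
Proof. by move=> /(_ [::])[]. Qed.

Lemma smooth_is_derive f j x : smooth f -> is_derive x (e_ j) f (partial j f x).
Proof. by move=> sf; apply/derivableP/smooth_derivable. Qed.

Lemma smooth_partial f j : smooth f -> smooth (partial j f).
Proof. by move=> sf s; rewrite -foldr_rcons; exact: sf. Qed.

Lemma partial_eq f g j : (forall x, is_derive x (e_ j) f (g x)) -> partial j f = g.
Proof. by move=> fg; apply/funext => x; rewrite /partial; have [_ ->] := fg x. Qed.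

(** Leibniz' rule takes products out of a class stable under derivatives, but not
    out of the algebra that the class generates with the smooth functions; so
    coinduction is run on generated algebras. *)
Inductive generated (B : ('rV[R]_n -> R) -> Prop) : ('rV[R]_n -> R) -> Prop :=
| generated_smooth f : smooth f -> generated B f
| generated_base f : B f -> generated B f
| generated_add f g : generated B f -> generated B g -> generated B (fun x => f x + g x)
| generated_mul f g : generated B f -> generated B g -> generated B (fun x => f x * g x).

Lemma is_derive_add f g x v a b : is_derive x v f a -> is_derive x v g b ->
  is_derive x v (fun y => f y + g y) (a + b).
Proof. by move=> df dg; exact: (is_deriveD df dg). Qed.

Lemma is_derive_mul f g x v a b : is_derive x v f a -> is_derive x v g b ->
  is_derive x v (fun y => f y * g y) (a * g x + f x * b).
Proof.
move=> df dg; have /is_derive_eq := is_deriveM df dg; apply.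
by rewrite /GRing.scale /= addrC mulrC.
Qed.

Lemma generated_is_smooth (B : ('rV[R]_n -> R) -> Prop) :
  (forall f, B f -> continuous f /\
     forall j, (forall x, derivable f x (e_ j)) /\ generated B (partial j f)) ->
  forall f, generated B f -> smooth f.
Proof.
move=> HB; apply: smooth_coind => f; elim => {f}.
- move=> f sf; split; first exact: smooth_continuous.
  move=> j; split; first by move=> x; exact: smooth_derivable.
  exact/generated_smooth/smooth_partial.
- by move=> f /HB.
- move=> f g _ [cf df] _ [cg dg]; split.
    by move=> x; exact: (cvgD (cf x) (cg x)).
  move=> j; have [df1 df2] := df j; have [dg1 dg2] := dg j.
  have D x := is_derive_add (derivableP (df1 x)) (derivableP (dg1 x)).
  split; first by move=> x; have [] := D x.
  by rewrite (partial_eq D); exact: generated_add.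
- move=> f g gf [cf df] gg [cg dg]; split.
    by move=> x; exact: (cvgM (cf x) (cg x)).
  move=> j; have [df1 df2] := df j; have [dg1 dg2] := dg j.
  have D x := is_derive_mul (derivableP (df1 x)) (derivableP (dg1 x)).
  split; first by move=> x; have [] := D x.
  by rewrite (partial_eq D); apply: generated_add; exact: generated_mul.
Qed.

Lemma smoothD f g : smooth f -> smooth g -> smooth (fun x => f x + g x).
Proof.
move=> sf sg; apply: (@generated_is_smooth (fun=> False)) => //.
by apply: generated_add; exact: generated_smooth.
Qed.

Lemma smoothM f g : smooth f -> smooth g -> smooth (fun x => f x * g x).
Proof.
move=> sf sg; apply: (@generated_is_smooth (fun=> False)) => //.
by apply: generated_mul; exact: generated_smooth.
Qed.

Lemma smooth_cst (c : R) : smooth (fun _ : 'rV[R]_n => c).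
Proof.
apply: (@smooth_coind (fun f => exists c, f = fun=> c)); last by exists c.
move=> _ [d ->]; split; first exact: cst_continuous.
move=> j; split; first by move=> x; exact: derivable_cst.
by exists 0; apply: partial_eq => x; exact: is_derive_cst.
Qed.

Lemma smoothZ (c : R) f : smooth f -> smooth (fun x => c * f x).
Proof. by move=> sf; apply: smoothM; last exact: sf; exact: smooth_cst. Qed.

Lemma smoothB f g : smooth f -> smooth g -> smooth (fun x => f x - g x).
Proof.
move=> sf sg; rewrite (_ : (fun x => _) = (fun x => f x + (-1) * g x)).
  by apply: smoothD sf _; exact: smoothZ.
by apply/funext => x; rewrite mulN1r.
Qed.

Lemma smooth_sum (I : Type) (s : seq I) (F : I -> 'rV[R]_n -> R) :
  (forall i, smooth (F i)) -> smooth (fun x => \sum_(i <- s) F i x).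
Proof.
move=> sF; elim: s => [|i s IH].
  rewrite (_ : (fun x => _) = (fun=> 0)); first exact: smooth_cst.
  by apply/funext => x; rewrite big_nil.
rewrite (_ : (fun x => _) = (fun x => F i x + \sum_(i <- s) F i x)).
  exact: smoothD.
by apply/funext => x; rewrite big_cons.
Qed.

Lemma smooth_prod (I : Type) (s : seq I) (F : I -> 'rV[R]_n -> R) :
  (forall i, smooth (F i)) -> smooth (fun x => \prod_(i <- s) F i x).
Proof.
move=> sF; elim: s => [|i s IH].
  rewrite (_ : (fun x => _) = (fun=> 1)); first exact: smooth_cst.
  by apply/funext => x; rewrite big_nil.
rewrite (_ : (fun x => _) = (fun x => F i x * \prod_(i <- s) F i x)).
  exact: smoothM.
by apply/funext => x; rewrite big_cons.
Qed.

Lemma partial_coord j k :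
  partial j (fun y : 'rV[R]_n => y ord0 k) = fun=> (k == j)%:R.
Proof. by apply: partial_eq => x; exact: is_derive_coord. Qed.

Lemma smooth_coord k : smooth (fun y : 'rV[R]_n => y ord0 k).
Proof.
apply: (@generated_is_smooth (fun f => f = fun y : 'rV[R]_n => y ord0 k)); last first.
  exact: generated_base.
move=> _ ->; split; first exact: coord_continuous.
move=> j; split.
  by move=> x; have [] := is_derive_coord x j k.
by rewrite partial_coord; exact/generated_smooth/smooth_cst.
Qed.

Lemma partialD f g j : smooth f -> smooth g ->
  partial j (fun x => f x + g x) = fun x => partial j f x + partial j g x.
Proof. by move=> ? ?; apply: partial_eq => x; apply: is_derive_add; exact: smooth_is_derive. Qed.

Lemma partialM f g j : smooth f -> smooth g ->
  partial j (fun x => f x * g x) = fun x => partial j f x * g x + f x * partial j g x.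
Proof. by move=> ? ?; apply: partial_eq => x; apply: is_derive_mul; exact: smooth_is_derive. Qed.

Lemma partial_cst (c : R) j : partial j (fun _ : 'rV[R]_n => c) = fun=> 0.
Proof. by apply: partial_eq => x; exact: is_derive_cst. Qed.

Lemma partialZ (c : R) f j : smooth f ->
  partial j (fun x => c * f x) = fun x => c * partial j f x.
Proof.
move=> sf; rewrite (partialM _ (smooth_cst c) sf).
by apply/funext => x; rewrite partial_cst mul0r add0r.
Qed.

Lemma partialB f g j : smooth f -> smooth g ->
  partial j (fun x => f x - g x) = fun x => partial j f x - partial j g x.
Proof.
move=> sf sg; rewrite (_ : (fun x => _ - _) = (fun x => f x + (-1) * g x)); last first.
  by apply/funext => x; rewrite mulN1r.
rewrite (partialD _ sf (smoothZ _ sg)).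
by rewrite (partialZ _ _ sg); apply/funext => x; rewrite mulN1r.
Qed.

Lemma partial_sum (I : Type) (s : seq I) (F : I -> 'rV[R]_n -> R) j :
  (forall i, smooth (F i)) ->
  partial j (fun x => \sum_(i <- s) F i x) = fun x => \sum_(i <- s) partial j (F i) x.
Proof.
move=> sF; elim: s => [|i s IH].
  rewrite (_ : (fun x => _) = (fun=> 0)).
    by rewrite partial_cst; apply/funext => x; rewrite big_nil.
  by apply/funext => x; rewrite big_nil.
rewrite (_ : (fun x => _) = (fun x => F i x + \sum_(i <- s) F i x)); last first.
  by apply/funext => x; rewrite big_cons.
rewrite partialD//; last exact: smooth_sum.
by rewrite IH; apply/funext => x; rewrite big_cons.
Qed.

Definition sqn (x : 'rV[R]_n) : R := \sum_(j < n) x ord0 j ^+ 2.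

Lemma sqn_ge0 x : 0 <= sqn x.
Proof. by apply: sumr_ge0 => i _; exact: sqr_ge0. Qed.

(** [|x|^2 + e] stays away from [0], so that every real power of it is smooth; these
    functions regularise the powers of [|x|] at the origin. *)
Definition rho (e : R) (s : R) (x : 'rV[R]_n) : R := (sqn x + e) `^ s.

Lemma smooth_sqn : smooth sqn.
Proof.
apply: smooth_sum => j; rewrite (_ : (fun x => _) =
  (fun x : 'rV[R]_n => x ord0 j * x ord0 j)).
  by apply: smoothM; exact: smooth_coord.
by apply/funext => x; rewrite expr2.
Qed.

Lemma partial_sqn j : partial j sqn = fun x => 2 * x ord0 j.
Proof.
rewrite (_ : sqn = fun x => \sum_(i < n) x ord0 i * x ord0 i); last first.
  by apply/funext => x; apply: eq_bigr => i _; rewrite expr2.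
rewrite (@partial_sum _ _ (fun i (x : 'rV[R]_n) => x ord0 i * x ord0 i)); last first.
  by move=> i; apply: smoothM; exact: smooth_coord.
apply/funext => x; rewrite (bigD1 j)//= partialM; [|exact: smooth_coord..].
rewrite !partial_coord eqxx mul1r mulr1 big1 ?addr0; first by rewrite mulr_natl mulr2n.
move=> i ij; rewrite partialM; [|exact: smooth_coord..].
by rewrite partial_coord (negbTE ij) mul0r mulr0 addr0.
Qed.

Lemma is_derive_rho e s x j : 0 < e ->
  is_derive x (e_ j) (rho e s) (2 * s * x ord0 j * rho e (s - 1) x).
Proof.
move=> e0; have xe : 0 < sqn x + e by rewrite ltr_wpDl// sqn_ge0.
have D : is_derive x (e_ j) (fun y => sqn y + e) (2 * x ord0 j + 0).
  have D2 : is_derive x (e_ j) (fun=> e) 0 by exact: is_derive_cst.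
  apply: (is_derive_add _ D2).
  by rewrite -[2 * _](congr1 (@^~ x) (partial_sqn j)); exact/smooth_is_derive/smooth_sqn.
have := is_derive_chain (is_derive1_powR s xe) D.
move=> /is_derive_eq; apply; rewrite /rho addr0; ring.
Qed.

Lemma partial_rho e s j : 0 < e ->
  partial j (rho e s) = fun x => 2 * s * x ord0 j * rho e (s - 1) x.
Proof. by move=> e0; apply: partial_eq => x; exact: is_derive_rho. Qed.

Lemma smooth_rho e s : 0 < e -> smooth (rho e s).
Proof.
move=> e0; apply: (@generated_is_smooth (fun f => exists s, f = rho e s)); last first.
  by apply: generated_base; exists s.
move=> _ [t ->]; split.
  move=> x; have xe : 0 < sqn x + e by rewrite ltr_wpDl// sqn_ge0.
  have c1 : {for sqn x + e, continuous ((@powR R) ^~ t)}.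
    apply/differentiable_continuous/derivable1_diffP.
    by have [] := is_derive1_powR t xe.
  apply: (@continuous_comp _ _ _ (fun y => sqn y + e) ((@powR R) ^~ t)) c1.
  exact: (cvgD (smooth_continuous smooth_sqn (x:=x)) (cvg_cst _)).
move=> j; split; first by move=> x; have [] := is_derive_rho t x j e0.
rewrite partial_rho//; apply: generated_mul; last by apply: generated_base; exists (t - 1).
by apply/generated_smooth/smoothZ/smooth_coord.
Qed.

End smooth_calculus.

(** * Test functions *)

Section test_functions.
Context (R : realType) (n : nat).
Implicit Types (f g phi : 'rV[R]_n -> R) (j : 'I_n).
Local Notation e_ j := (delta_mx ord0 j : 'rV[R]_n).

(** A bound on the norm is easier to propagate than compactness of the closed support. *)
Definition supp_in (M : R) phi := forall x, M < `|x| -> phi x = 0.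

Lemma ball_compact (M : R) : compact [set x : 'rV[R]_n | `|x| <= M].
Proof.
apply: bounded_closed_compact.
  by exists M; split; [exact: num_real|move=> N MN x /= /le_trans; apply; exact: ltW].
rewrite (_ : mkset _ = (fun x : 'rV[R]_n => `|x|) @^-1` [set y : R | y <= M])//.
apply: closed_comp; last exact: closed_le.
by move=> x _; exact: norm_continuous.
Qed.

Lemma test_functionP phi :
  test_function phi <-> smooth phi /\ exists M, supp_in M phi.
Proof.
split=> -[sp].
  move=> /compact_bounded[M [Mr MP]]; split => //.
  exists (M + 1) => x Mx; apply/eqP/negPn/negP => px0.
  have M1 : M < M + 1 by rewrite ltrDl.
  have /(_ x) := MP (M + 1) M1.
  have xcl : closure [set x | phi x != 0] x by exact: subset_closure.
  by move=> /(_ xcl) /=; rewrite leNgt Mx.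
move=> [M sM]; split => //.
apply: (subclosed_compact _ (@ball_compact M)); first exact: closed_closure.
rewrite [X in _ `<=` X](closure_id _).1; last first.
  by apply: compact_closed; [exact: norm_hausdorff|exact: ball_compact].
apply: closureS => x /= px0; rewrite leNgt; apply/negP => /sM p0.
by rewrite p0 eqxx in px0.
Qed.

Lemma test_smooth phi : test_function phi -> smooth phi.
Proof. by case. Qed.

Lemma supp_in_partial M phi j : supp_in M phi -> supp_in M (partial j phi).
Proof.
move=> sM x Mx; rewrite /partial -(@derive_cst _ _ R^o (0 : R) x (e_ j)).
apply: near_eq_derive.
have /cvgr_gt/(_ _ Mx) := @norm_continuous _ _ x.
by apply: filterS => y /sM ->.
Qed.

Lemma test_partial phi j : test_function phi -> test_function (partial j phi).
Proof.
move=> /test_functionP[sp [M sM]]; apply/test_functionP; split.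
  exact: smooth_partial.
by exists M; exact: supp_in_partial.
Qed.

Lemma testMl f phi : smooth f -> test_function phi -> test_function (fun x => f x * phi x).
Proof.
move=> sf /test_functionP[sp [M sM]]; apply/test_functionP; split; first exact: smoothM.
by exists M => x /sM ->; rewrite mulr0.
Qed.

Lemma testD f g : test_function f -> test_function g -> test_function (fun x => f x + g x).
Proof.
move=> /test_functionP[sf [M sM]] /test_functionP[sg [N sN]].
apply/test_functionP; split; first exact: smoothD.
exists (Num.max M N) => x; rewrite gt_max => /andP[/sM -> /sN ->].
by rewrite addr0.
Qed.

Lemma testZ (c : R) f : test_function f -> test_function (fun x => c * f x).
Proof. by apply: testMl; exact: smooth_cst. Qed.

Lemma testB f g : test_function f -> test_function g -> test_function (fun x => f x - g x).
Proof.
move=> tf tg; rewrite (_ : (fun x => _) = (fun x => f x + (-1) * g x)).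
  by apply: testD tf _; exact: testZ.
by apply/funext => x; rewrite mulN1r.
Qed.

Lemma test0 : test_function (fun _ : 'rV[R]_n => 0 : R).
Proof. by apply/test_functionP; split; [exact: smooth_cst|exists 0]. Qed.

Lemma continuous_ball_bounded M f : continuous f ->
  exists2 C, 0 <= C & forall x, `|x| <= M -> `|f x| <= C.
Proof.
move=> cf.
have /compact_bounded[C [Cr CP]] : compact (f @` [set x : 'rV[R]_n | `|x| <= M]).
  apply: continuous_compact; last exact: ball_compact.
  exact: continuous_subspaceT.
exists (`|C| + 1); first by rewrite addr_ge0.
move=> x xM; apply: (CP (`|C| + 1)); first by rewrite ltr_pwDr// ler_norm.
by exists x.
Qed.

Lemma test_bounded phi : test_function phi -> exists2 C, 0 <= C & forall x, `|phi x| <= C.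
Proof.
move=> /test_functionP[sp [M sM]].
have [C C0 HC] := continuous_ball_bounded M (smooth_continuous sp).
by exists C => // x; have [/HC//|/sM->] := leP `|x| M; rewrite normr0.
Qed.

Lemma test_gradient_bounded phi : test_function phi ->
  exists2 C, 0 <= C & forall j x, `|partial j phi x| <= C.
Proof.
move=> tp; pose c j := sval (cid2 (test_bounded (test_partial j tp))).
have cP j : 0 <= c j /\ forall z, `|partial j phi z| <= c j.
  by rewrite /c; case: (cid2 _).
exists (\sum_(j < n) c j); first by apply: sumr_ge0 => j _; have [] := cP j.
move=> j z; rewrite (bigD1 j)//=; have [c0 Hc] := cP j.
apply: le_trans (Hc z) _; rewrite lerDl; apply: sumr_ge0 => i _.
by have [] := cP i.
Qed.

Lemma is_derive_affine f (c : R) (v y w : 'rV[R]_n) (a : R) :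
  is_derive (c *: y + v) w f a -> is_derive y w (fun z => f (c *: z + v)) (c * a).
Proof.
move=> df; apply: is_derive_of_line.
have -> : (fun h : R => f (c *: (h *: w + y) + v)) =
    (fun s : R => f (s *: w + (c *: y + v))) \o (fun h : R => c * h).
  by apply/funext => h /=; rewrite scalerDr scalerA addrA.
rewrite mulrC; apply: is_derive1_comp.
  by rewrite mulr0; apply: is_derive_line; rewrite scale0r add0r.
have /is_derive_eq := is_deriveZ c (is_derive_id (0 : R) (1 : R)); apply.
exact: mulr1.
Qed.

Lemma partial_affine f (c : R) (v : 'rV[R]_n) j : smooth f ->
  partial j (fun z => f (c *: z + v)) = fun z => c * partial j f (c *: z + v).
Proof.
by move=> sf; apply: partial_eq => y; apply: is_derive_affine; exact: smooth_is_derive.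
Qed.

Lemma smooth_affine f (c : R) (v : 'rV[R]_n) : smooth f -> smooth (fun z => f (c *: z + v)).
Proof.
move=> sf; apply: (@generated_is_smooth _ _
  (fun G => exists2 g, smooth g & G = fun z => g (c *: z + v))); last first.
  by apply: generated_base; exists f.
move=> _ [g sg ->]; split.
  have ca : continuous (fun y : 'rV[R]_n => c *: y + v).
    by move=> y; exact: (cvgD (@scaler_continuous _ _ c y) (cvg_cst _)).
  by move=> y; exact: (continuous_comp (ca y) (smooth_continuous sg (x := c *: y + v))).
move=> j; split.
  move=> y; have [] // := is_derive_affine (smooth_is_derive j (c *: y + v) sg).
rewrite (partial_affine _ _ _ sg); apply: generated_mul.
  exact/generated_smooth/smooth_cst.
by apply: generated_base; exists (partial j g); [exact: smooth_partial|].
Qed.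

Lemma smooth_MVT f j x (t : R) : smooth f -> 0 <= t ->
  exists2 s, 0 <= s <= t & f (t *: e_ j + x) - f x = t * partial j f (s *: e_ j + x).
Proof.
move=> sf t0; have D s := is_derive_line (smooth_is_derive j (s *: e_ j + x) sf).
have [s|] := MVT_segment t0 (fun s _ => D s).
  apply: continuous_subspaceT => {}s.
  by apply/differentiable_continuous/derivable1_diffP; have [] := D s.
move=> s; rewrite in_itv /= => st.
rewrite scale0r add0r subr0 => ->; exists s => //; exact: mulrC.
Qed.

Lemma smooth_axis_lipschitz f j (C : R) : smooth f -> (forall x, `|partial j f x| <= C) ->
  forall x t, `|f (t *: e_ j + x) - f x| <= C * `|t|.
Proof.
move=> sf fC x t; wlog t0 : t x / 0 <= t => [H|].
  have [t0|t0] := leP 0 t; first exact: H.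
  have := H (- t) (t *: e_ j + x); rewrite oppr_ge0 ltW// => /(_ isT).
  by rewrite addrA -scalerDl addNr scale0r add0r distrC normrN.
have [s _ ->] := smooth_MVT j x sf t0.
by rewrite normrM mulrC ler_wpM2r.
Qed.

Lemma smooth_lipschitz f (C : R) : smooth f -> (forall j x, `|partial j f x| <= C) ->
  forall x y, `|f y - f x| <= C * \sum_(j < n) `|(y - x) ord0 j|.
Proof.
move=> sf fC x y.
have -> : y = \sum_(j < n) (y - x) ord0 j *: e_ j + x.
  by rewrite -row_sum_delta subrK.
(* Move one coordinate at a time. *)
rewrite addrK; set h := y - x.
have -> : (\sum_(j < n) h ord0 j *: e_ j) = h by rewrite -row_sum_delta.
rewrite {1}(row_sum_delta h).
elim: (index_enum _) => [|j s IH]; first by rewrite !big_nil add0r subrr normr0 mulr0.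
rewrite !big_cons mulrDr -addrA.
rewrite -(subrKA (f (\sum_(j <- s) h ord0 j *: e_ j + x))).
apply: le_trans (ler_normD _ _) _; apply: lerD => //.
exact: smooth_axis_lipschitz.
Qed.

Lemma norm_delta_le1 j : `|e_ j| <= 1.
Proof.
rewrite /Num.norm /= mx_normrE; apply: bigmax_le => // -[i1 i2] _ /=.
by rewrite mxE; case: (_ && _); rewrite ?normr1 ?normr0.
Qed.

(** Two applications of the mean value theorem to the second difference of [f], in
    either order, produce values of both mixed derivatives near [x]. *)
Lemma smooth_schwarz f i j : smooth f ->
  partial i (partial j f) = partial j (partial i f).
Proof.
move=> sf; apply/funext => x.
pose a := partial i (partial j f); pose b := partial j (partial i f).
suff H : forall e, 0 < e -> `|a x - b x| <= e + e.
  apply/eqP; rewrite -subr_eq0 -normr_le0; apply/ler_addgt0Pl => e e0; rewrite addr0.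
  by rewrite [leRHS](splitr e); apply: H; rewrite divr_gt0.
move=> e e0.
have ca : continuous a by exact/smooth_continuous/smooth_partial/smooth_partial.
have cb : continuous b by exact/smooth_continuous/smooth_partial/smooth_partial.
have /cvgrPdist_lt/(_ _ e0) Na := ca x.
have /cvgrPdist_lt/(_ _ e0) Nb := cb x.
have [d /= d0 dP] := (nbhs_ballP _ _).1 (filterI Na Nb).
pose t := d / 4.
have t0 : 0 < t by rewrite divr_gt0.
have key (s s' : R) : 0 <= s <= t -> 0 <= s' <= t -> forall k l,
    ball x d (s *: e_ k + (s' *: e_ l + x)).
  move=> /andP[s0 st] /andP[s'0 s't] k l.
  rewrite -ball_normE /= addrA opprD addrCA subrr addr0 normrN.
  apply: le_lt_trans (ler_normD _ _) _.
  rewrite !normrZ (ger0_norm s0) (ger0_norm s'0).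
  apply: (@le_lt_trans _ _ (t * 1 + t * 1)).
    by apply: lerD; apply: ler_pM => //; exact: norm_delta_le1.
  by rewrite mulr1 /t; lra.
pose D := f (t *: e_ i + (t *: e_ j + x)) - f (t *: e_ i + x) - (f (t *: e_ j + x) - f x).
pose f1 y := f (t *: e_ j + y) - f y.
pose f2 y := f (t *: e_ i + y) - f y.
have shift k : smooth (fun y => f (t *: e_ k + y)) /\
    forall l, partial l (fun y => f (t *: e_ k + y)) = fun y => partial l f (t *: e_ k + y).
  rewrite (_ : (fun y => f (t *: e_ k + y)) = fun y => f (1 *: y + t *: e_ k)); last first.
    by apply/funext => y; rewrite scale1r addrC.
  split=> [|l]; first exact: smooth_affine.
  by rewrite partial_affine//; apply/funext => y; rewrite mul1r scale1r addrC.
have D1 : exists2 y, ball x d y & D = t * (t * b y).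
  have [s st] := smooth_MVT i x (smoothB (shift j).1 sf) (ltW t0).
  rewrite (partialB _ (shift j).1 sf) (shift j).2.
  have [s' s't ->] := smooth_MVT j (s *: e_ i + x) (smooth_partial i sf) (ltW t0).
  move=> E; exists (s' *: e_ j + (s *: e_ i + x)); first exact: key.
  rewrite -E /D; rewrite [t *: e_ j + (t *: e_ i + x)]addrCA; lra.
have D2 : exists2 y, ball x d y & D = t * (t * a y).
  have [s st] := smooth_MVT j x (smoothB (shift i).1 sf) (ltW t0).
  rewrite (partialB _ (shift i).1 sf) (shift i).2.
  have [s' s't ->] := smooth_MVT i (s *: e_ j + x) (smooth_partial j sf) (ltW t0).
  move=> E; exists (s' *: e_ i + (s *: e_ j + x)); first exact: key.
  rewrite -E /D; lra.
have [y yB Dy] := D1; have [z zB Dz] := D2.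
have ab : a z = b y.
  have : t * (t * a z) = t * (t * b y) by exact: etrans (esym Dz) Dy.
  by move/(mulfI (lt0r_neq0 t0))/(mulfI (lt0r_neq0 t0)).
have [_ H1] := dP _ yB; have [H2 _] := dP _ zB.
have fin (p q r s : R) : r = s -> `|p - r| < e -> `|q - s| < e -> `|p - q| <= e + e.
  move=> -> pr qs; rewrite -(subrKA s); apply: le_trans (ler_normD _ _) _.
  apply: lerD; first exact: ltW pr.
  by rewrite distrC; exact: ltW qs.
exact: fin ab H2 H1.
Qed.

End test_functions.

(** * Bump functions *)

Section flat.
Context (R : realType).

(** The functions [p(1/t) exp(-1/t)] on [t > 0], extended by [0]: this family,
    indexed by the polynomial [p], is stable under differentiation. *)
Definition flat (p : {poly R}) (t : R) : R :=
  if 0 < t then p.[t^-1] * expR (- t^-1) else 0.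

Definition flat_diff (p : {poly R}) : {poly R} := (p - p^`()) * 'X^2.

Lemma poly_expR_bound (p : {poly R}) k :
  exists2 C, 0 <= C & forall t, 0 <= t -> `|p.[t]| * t ^+ k <= C * expR t.
Proof.
have mono i : exists2 C : R, 0 <= C & forall t, 0 <= t -> t ^+ i <= C * expR t.
  case: i => [|i].
    exists 1 => // t t0; rewrite expr0 mul1r.
    by apply: le_trans (expR_ge1Dx t); rewrite lerDl.
  exists (i.+1`!%:R) => [|t t0]; first exact: ler0n.
  have := expR_ge1Dxn i t0; rewrite -ler_pdivrMl ?ltr0n ?fact_gt0//.
  by apply: le_trans; rewrite [leRHS]addrC mulrC lerDl.
elim/poly_ind: p k => [k|p c IH k].
  by exists 0 => // t _; rewrite horner0 normr0 !mul0r.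
have [C C0 HC] := IH k.+1; have [D D0 HD] := mono k.
exists (C + `|c| * D) => [|t t0]; first by rewrite addr_ge0// mulr_ge0.
rewrite hornerMXaddC; apply: (@le_trans _ _ (`|p.[t]| * t ^+ k.+1 + `|c| * t ^+ k)).
  rewrite exprS mulrA -mulrDl ler_wpM2r ?exprn_ge0//.
  by apply: le_trans (ler_normD _ _) _; rewrite normrM (ger0_norm t0).
by rewrite mulrDl -mulrA lerD ?HC// ler_wpM2l// HD.
Qed.

(** The exponential dominates every polynomial, so that [flat p] is [O(t^2)] at [0];
    hence its derivative there is zero. *)
Lemma flat_bound (p : {poly R}) : exists2 C, 0 <= C & forall t, `|flat p t| <= C * t ^+ 2.
Proof.
have [C C0 HC] := poly_expR_bound p 2; exists C => // t.
rewrite /flat; case: ifPn => t0; last by rewrite normr0 mulr_ge0// sqr_ge0.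
have ti : 0 <= t^-1 by rewrite invr_ge0 ltW.
have := HC _ ti; rewrite exprVn ler_pdivrMr ?exprn_gt0// => H.
rewrite normrM (ger0_norm (expR_ge0 _)) expRN ler_pdivrMr ?expR_gt0//.
by rewrite mulrAC.
Qed.

Lemma flat_derive0 (p : {poly R}) : is_derive (0 : R) 1 (flat p) 0.
Proof.
have [C C0 HC] := flat_bound p.
have H : (fun h : R => h^-1 *: (flat p (h *: 1 + 0) - flat p 0)) @ 0^' --> (0 : R).
  apply/cvgr0Pnorm_le => e e0; near=> h.
  have h0 : h != 0 by near: h; exact: nbhs_dnbhs_neq.
  rewrite addr0 [h *: 1]mulr1 {2}/flat ltxx subr0 /GRing.scale /= normrM normfV.
  rewrite mulrC ler_pdivrMr ?normr_gt0//; apply: le_trans (HC h) _.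
  rewrite -[h ^+ 2]ger0_norm ?sqr_ge0// normrX expr2 mulrA ler_wpM2r//.
  have hb : `|h| < e / (C + 1).
    near: h; apply: dnbhs0_lt; rewrite divr_gt0// ltr_pwDr//.
  apply: (@le_trans _ _ ((C + 1) * `|h|)); first by rewrite ler_wpM2r// lerDl.
  by rewrite mulrC -ler_pdivlMr ?ltr_pwDr// ltW.
split; first by apply/cvg_ex; exists 0.
exact: cvg_lim.
Unshelve. all: by end_near. Qed.

Lemma flat_derive (p : {poly R}) (t : R) : is_derive t 1 (flat p) (flat (flat_diff p) t).
Proof.
have [t0|t0|->] := ltgtP t 0; last first.
  by rewrite [flat (flat_diff p) 0]/flat ltxx; exact: flat_derive0.
- have D1 : is_derive t 1 (@GRing.inv R) (- t^-2).
    have Did : derivable (fun s : R => s) t 1 by exact: derivable_id.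
    have := derivableP (@derivableV _ _ (fun s : R => s) t 1 (lt0r_neq0 t0) Did).
    move=> /is_derive_eq; apply; rewrite (@deriveV _ _ (fun s : R => s) t 1 (lt0r_neq0 t0) Did).
    by rewrite (@derive_id _ _ t (1 : R)) [_ *: _]mulr1.
  have D2 : is_derive t 1 (fun s : R => p.[s^-1]) (p^`().[t^-1] * - t^-2).
    exact: (@is_derive1_comp _ (horner p) (@GRing.inv R)).
  have D3 : is_derive t 1 (fun s : R => expR (- s^-1)) (expR (- t^-1) * (t^-2)).
    apply: (@is_derive1_comp _ expR (fun s : R => - s^-1)).
    by have /is_derive_eq := is_deriveN D1; apply; rewrite opprK.
  have /is_derive_eq D4 := is_deriveM D2 D3.
  apply: (@near_eq_is_derive _ _ _ (fun s : R => p.[s^-1] * expR (- s^-1))).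
    have := near_in_itvoy (a := 0 : R) (x := t); rewrite in_itv /= t0 => /(_ isT).
    by apply: filterS => s; rewrite in_itv /= andbT /flat => ->.
  apply: D4; rewrite /flat t0 /flat_diff hornerM hornerXn hornerD hornerN /GRing.scale /=.
  by rewrite exprVn; ring.
- apply: (@near_eq_is_derive _ _ _ (fun s : R => 0)).
    have := near_in_itvNyo (b := 0 : R) (x := t); rewrite in_itv /= t0 => /(_ isT).
    by apply: filterS => s; rewrite in_itv /= /flat => s0; rewrite ltNge ltW.
  rewrite /flat ltNge ltW//=; exact: is_derive_cst.
Qed.

Lemma flat_continuous (p : {poly R}) : continuous (flat p).
Proof.
move=> t; apply/differentiable_continuous/derivable1_diffP.
by have [] := flat_derive p t.
Qed.

Definition hat (t : R) : R := flat 1 t.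

Lemma hatE t : 0 < t -> hat t = expR (- t^-1).
Proof. by move=> t0; rewrite /hat /flat t0 hornerC mul1r. Qed.

Lemma hat_le0 t : t <= 0 -> hat t = 0.
Proof. by move=> t0; rewrite /hat /flat ltNge t0. Qed.

Lemma hat_ge0 t : 0 <= hat t.
Proof.
by have [t0|t0] := leP t 0; [rewrite hat_le0|rewrite hatE// expR_ge0].
Qed.

Lemma hat_le1 t : hat t <= 1.
Proof.
have [t0|t0] := leP t 0; first by rewrite hat_le0.
by rewrite hatE// -expR0 ler_expR oppr_le0 invr_ge0 ltW.
Qed.

Lemma hat_gt0 t : (0 < hat t) = (0 < t).
Proof.
by have [t0|t0] := leP t 0; [rewrite hat_le0// ltxx|rewrite hatE// expR_gt0].
Qed.

Lemma hat_cvg1 t : 0 < t -> (fun m : nat => hat (m.+1%:R * t)) @ \oo --> (1 : R).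
Proof.
move=> t0; have -> : (fun m : nat => hat (m.+1%:R * t)) =
    (fun m : nat => expR (- (t^-1 * m.+1%:R^-1))).
  by apply/funext => m; rewrite hatE ?mulr_gt0// invfM mulrC.
have H : (fun m : nat => - (t^-1 * m.+1%:R^-1)) @ \oo --> (- (t^-1 * 0) : R).
  by apply: cvgN; apply: cvgM; [exact: cvg_cst|exact: cvg_harmonic].
rewrite mulr0 oppr0 in H; rewrite -[X in _ --> X](@expR0 R).
by apply: (continuous_cvg _ _ H); exact: continuous_expR.
Qed.

End flat.

Section box_bump.
Context (R : realType) (n : nat).
Implicit Types (a b : 'I_n -> R) (x : 'rV[R]_n) (j : 'I_n).
Local Notation e_ j := (delta_mx ord0 j : 'rV[R]_n).

Lemma smooth_flat (p : {poly R}) (c d : R) i :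
  smooth (fun x : 'rV[R]_n => flat p (c * x ord0 i + d)).
Proof.
apply: (@generated_is_smooth _ _
  (fun f => exists p, f = fun x : 'rV[R]_n => flat p (c * x ord0 i + d))); last first.
  by apply: generated_base; exists p.
move=> _ [q ->].
have D j x : is_derive x (e_ j) (fun x : 'rV[R]_n => flat q (c * x ord0 i + d))
    (c * (i == j)%:R * flat (flat_diff q) (c * x ord0 i + d)).
  rewrite mulrC; apply: (@is_derive_chain _ _ (fun x : 'rV[R]_n => c * x ord0 i + d) (flat q)).
    exact: flat_derive.
  have D0 : is_derive x (e_ j) (fun=> d : R) 0 by exact: is_derive_cst.
  have Dc : is_derive x (e_ j) (fun=> c : R) 0 by exact: is_derive_cst.
  have /is_derive_eq := is_derive_add (is_derive_mul Dc (is_derive_coord x j i)) D0; apply.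
  by rewrite mul0r add0r addr0.
split.
  have cl : continuous (fun x : 'rV[R]_n => c * x ord0 i + d).
    apply: smooth_continuous; apply: smoothD; last exact: smooth_cst.
    by apply: smoothZ; exact: smooth_coord.
  by move=> x; exact: (continuous_comp (cl x) (@flat_continuous _ q _)).
move=> j; split; first by move=> x; have [] := D j x.
rewrite (partial_eq (D j)); apply: generated_mul.
  exact/generated_smooth/smooth_cst.
by apply: generated_base; exists (flat_diff q).
Qed.

(** As [m] grows, these test functions increase to the indicator of the open
    box with corners [a] and [b]. *)
Definition box_bump (m : R) a b x : R :=
  \prod_(i < n) (hat (m * (x ord0 i - a i)) * hat (m * (b i - x ord0 i))).

Definition in_box a b : set 'rV[R]_n := [set x | forall i, a i < x ord0 i < b i].

Lemma smooth_box_bump m a b : smooth (box_bump m a b).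
Proof.
apply: smooth_prod => i; apply: smoothM.
  rewrite (_ : (fun x => _) = fun x : 'rV[R]_n => flat 1 (m * x ord0 i + - (m * a i))).
    exact: smooth_flat.
  by apply/funext => x; rewrite /hat mulrBr.
rewrite (_ : (fun x => _) = fun x : 'rV[R]_n => flat 1 (- m * x ord0 i + m * b i)).
  exact: smooth_flat.
by apply/funext => x; rewrite /hat mulrBr addrC mulNr.
Qed.

Lemma box_bump_ge0 m a b x : 0 <= box_bump m a b x.
Proof. by apply: prodr_ge0 => i _; rewrite mulr_ge0// hat_ge0. Qed.

Lemma box_bump_le1 m a b x : box_bump m a b x <= 1.
Proof.
apply: prodr_ile1 => i; rewrite mulr_ge0 ?hat_ge0//=.
by rewrite mulr_ile1 ?hat_ge0 ?hat_le1.
Qed.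

Lemma box_bump_gt0 m a b x : 0 < m -> in_box a b x -> 0 < box_bump m a b x.
Proof.
move=> m0 xab; apply: prodr_gt0 => i _; have /andP[ax xb] := xab i.
by rewrite mulr_gt0// hat_gt0 mulr_gt0// subr_gt0.
Qed.

Lemma box_bump_out m a b x : 0 < m -> ~ in_box a b x -> box_bump m a b x = 0.
Proof.
move=> m0 /existsNP[i /negP]; rewrite negb_and -!leNgt => H.
rewrite /box_bump (bigD1 i)//=; case/orP: H => H.
  by rewrite hat_le0 ?mul0r// pmulr_rle0// subr_le0.
by rewrite [X in _ * X * _]hat_le0 ?mulr0 ?mul0r// pmulr_rle0// subr_le0.
Qed.

Lemma box_bump_cvg a b x :
  (fun m : nat => box_bump m.+1%:R a b x) @ \oo --> (\1_(in_box a b) x : R).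
Proof.
rewrite indicE; have [/set_mem xab|/negP xab] := boolP (x \in in_box a b).
  rewrite /box_bump; elim: (index_enum _) => [|i s IH].
    by under eq_fun do rewrite big_nil; exact: cvg_cst.
  under eq_fun do rewrite big_cons.
  have /andP[ax xb] := xab i; rewrite -(mulr1 true%:R).
  apply: cvgM IH; rewrite -(mulr1 true%:R).
  by apply: cvgM; apply: hat_cvg1; rewrite subr_gt0.
rewrite (_ : (fun m : nat => _) = fun=> 0); first exact: cvg_cst.
apply/funext => m; apply: box_bump_out => // /mem_set; exact: xab.
Qed.

Lemma in_box_norm a b x : in_box a b x -> `|x| <= \sum_(i < n) (`|a i| + `|b i|).
Proof.
move=> xab; rewrite [leLHS]/Num.norm /= mx_normrE; apply: bigmax_le.
  by apply: sumr_ge0 => i _; rewrite addr_ge0.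
move=> -[k i] _ /=; rewrite (ord1 k) (bigD1 i)//=.
apply: (@le_trans _ _ (`|a i| + `|b i|)); last first.
  by rewrite lerDl sumr_ge0// => l _; rewrite addr_ge0.
have /andP[ax xb] := xab i; rewrite ler_norml.
have := ler_norm (b i); have := ler_norm (- a i); rewrite normrN => ha hb.
have ? := normr_ge0 (b i); have ? := normr_ge0 (a i).
by apply/andP; split; lra.
Qed.

Lemma test_box_bump m a b : 0 < m -> test_function (box_bump m a b).
Proof.
move=> m0; apply/test_functionP; split; first exact: smooth_box_bump.
exists (\sum_(i < n) (`|a i| + `|b i|)) => x Mx; apply: box_bump_out => // /in_box_norm.
by rewrite leNgt Mx.
Qed.

End box_bump.

(** * Lebesgue measure on row vectors *)

Section rV_measure.
Context (R : realType).

Lemma open_rV_measurable n (O : set 'rV[R]_n) : open O -> measurable O.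
Proof.
move=> oO.
pose c (q : 'rV[rat]_n) : 'rV[R]_n := map_mx ratr q.
pose B (p : 'rV[rat]_n * nat) : set 'rV[R]_n := ball (c p.1) (p.2.+1%:R^-1).
pose F p := if `[< B p `<=` O >] then B p else set0.
have -> : O = \bigcup_p F p.
  apply/seteqP; split => [x Ox|x [p _]]; last first.
    by rewrite /F; case: ifPn => // /asboolP; exact.
  have /nbhs_ballP[e /= e0 eO] : nbhs x O by exact: open_nbhs_nbhs.
  have [k ke] : exists k, k.+1%:R^-1 + k.+1%:R^-1 < e.
    have /cvgrPdist_lt/(_ (e / 2)) := @cvg_harmonic R.
    rewrite divr_gt0// => /(_ isT)[k _ /(_ k (leqnn k))] /=.
    rewrite sub0r normrN ger0_norm ?invr_ge0// => H; exists k.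
    by rewrite [ltRHS](splitr e) ltrD.
  have k0 : 0 < k.+1%:R^-1 :> R by rewrite invr_gt0.
  have /choice[q qP] i : exists q : rat, ball (ratr q : R) k.+1%:R^-1 (x ord0 i).
    move: k0; set d := _^-1 => d0.
    have /rat_in_itvoo[q] : x ord0 i - d < x ord0 i + d by lra.
    rewrite in_itv /= => /andP[q1 q2]; exists q.
    by rewrite /ball /= ltr_norml; apply/andP; split; lra.
  have Bx : ball (c (\row_i q i)) k.+1%:R^-1 x.
    by split => // i j; rewrite (ord1 i) !mxE; exact: qP.
  exists (\row_i q i, k) => //; rewrite /F asboolT// => y /= By.
  apply: eO; apply: le_ball (ltW ke) _ _.
  by apply: ball_triangle By; exact: ball_sym.
apply: countable_bigcupT_measurable; first exact: countableP.
move=> p; rewrite /F; case: ifPn => // _.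
rewrite (_ : B p = \bigcap_(i in [set: 'I_n])
    ((@rV_coord R n i) @^-1` (ball (c p.1 ord0 i) p.2.+1%:R^-1))).
  apply: fin_bigcap_measurable; first exact: finite_finset.
  move=> i _; rewrite -[X in measurable X]setTI.
  apply: measurable_rV_coord => //; exact: measurable_ball.
apply/seteqP; split => [x [_ H] i _|x H]; first exact: H.
by split => [|i j]; [rewrite invr_gt0|rewrite (ord1 i); exact: H].
Qed.

Lemma continuous_rV_measurable n (f : 'rV[R]_n -> R) : continuous f -> measurable_fun setT f.
Proof.
move=> /continuousP cf; apply: (measurability _ (RGenOInfty.measurableE R)) => //.
move=> _ [_ [a ->] <-]; rewrite setTI; apply: open_rV_measurable.
exact/cf/interval_open.
Qed.

Lemma rV_cons0 n (p : measurableTypeR R * 'rV[R]_n) : rV_cons p ord0 ord0 = p.1.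
Proof.
have e0 : ord0 = lshift n (ord0 : 'I_1) :> 'I_(1 + n) by exact: val_inj.
rewrite [X in fun_of_matrix _ _ X]e0.
by apply: etrans (row_mxEl _ _ _ _) _; rewrite mxE eqxx.
Qed.

Lemma rV_consS n (p : measurableTypeR R * 'rV[R]_n) i :
  rV_cons p ord0 (lift ord0 i) = p.2 ord0 i.
Proof.
have ei : lift ord0 i = rshift 1 i :> 'I_(1 + n) by exact: val_inj.
by rewrite [X in fun_of_matrix _ _ X]ei; exact: row_mxEr.
Qed.

Lemma rV_consP n (x : 'rV[R]_n.+1) a (y : 'rV[R]_n) : x ord0 ord0 = a ->
  (forall i, x ord0 (lift ord0 i) = y ord0 i) -> x = rV_cons (a, y).
Proof.
move=> xa xy; apply/rowP => i; case: (unliftP ord0 i) => [j|] ->.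
  by rewrite rV_consS xy.
by rewrite rV_cons0 xa.
Qed.

Lemma lebesgue_measure_reflect (c : R) (A : set (measurableTypeR R)) : measurable A ->
  pushforward lebesgue_measure (fun t : R => (c - t : measurableTypeR R)) A
  = lebesgue_measure A.
Proof.
have mc : measurable_fun setT (fun t : R => (c - t : measurableTypeR R)).
  by apply: measurable_funB => //; exact: measurable_cst.
move=> mA; apply/esym.
pose nu : {measure set (measurableTypeR R) -> \bar R} :=
  pushforward lebesgue_measure (fun t : R => (c - t : measurableTypeR R)).
apply: (@lebesgue_measure_unique R (nu mc) _ A mA) => _ [[a b]] _ <-.
rewrite /nu /= /pushforward (_ : _ @^-1` _ = `[c - b, c - a[%classic); last first.
  apply/seteqP; split => t /=; rewrite !in_itv /= => /andP[? ?]; apply/andP; split; lra.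
rewrite !lebesgue_measure_itv/= !lte_fin.
by rewrite (_ : (c - b < c - a) = (a < b)) ?ltrD2l ?ltrN2//; case: ifP => // _;
  rewrite -!EFinD; congr EFin; lra.
Qed.

Lemma ge0_integral_reflect1 (c : R) (G : measurableTypeR R -> \bar R) :
  measurable_fun setT G -> (forall t, 0 <= G t)%E ->
  (\int[lebesgue_measure]_t G (c - t)%R = \int[lebesgue_measure]_t G t)%E.
Proof.
move=> mG G0.
have mc : measurable_fun setT (fun t : measurableTypeR R => (c - t : measurableTypeR R)).
  by apply: measurable_funB => //; exact: measurable_cst.
transitivity (\int[pushforward lebesgue_measure
    (fun t : measurableTypeR R => (c - t)%R : measurableTypeR R)]_t G t)%E.
  by rewrite (ge0_integral_pushforward mc)// => t _; exact: G0.
by apply: eq_measure_integral => A mA _; exact: lebesgue_measure_reflect.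
Qed.

Lemma measurable_rV_reflect n (v : 'rV[R]_n) : measurable_fun setT (fun x : 'rV[R]_n => v - x).
Proof.
apply: measurable_fun_rVP => i.
rewrite (_ : _ \o _ = fun x : 'rV[R]_n => v ord0 i - rV_coord i x).
  apply: measurable_funB; first exact: measurable_cst.
  exact: measurable_rV_coord.
by apply/funext => x; rewrite /rV_coord /= !mxE.
Qed.

(** Point reflections are the maps that occur in convolutions, and translations
    are composites of two of them. One coordinate at a time, by Tonelli. *)
Lemma ge0_integral_reflect n (v : 'rV[R]_n) (F : 'rV[R]_n -> \bar R) :
  measurable_fun setT F -> (forall x, 0 <= F x)%E ->
  (\int[lebesgue_rV R n]_x F (v - x)%R = \int[lebesgue_rV R n]_x F x)%E.
Proof.
elim: n v F => [v F mF F0|n IH v F mF F0].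
  by apply: eq_integral => x _; congr F; apply/rowP => -[].
have mFv : measurable_fun setT (fun x : 'rV[R]_n.+1 => F (v - x)).
  by apply: measurableT_comp => //; exact: measurable_rV_reflect.
have consE (G : 'rV[R]_n.+1 -> \bar R) : measurable_fun setT G -> (forall x, 0 <= G x)%E ->
    (\int[lebesgue_rV R n.+1]_x G x =
     \int[lebesgue_measure]_t \int[lebesgue_rV R n]_y G (rV_cons (t, y)))%E.
  move=> mG G0; rewrite [LHS](@ge0_integral_pushforward _ _ _ _ _ _ (@measurable_rV_cons R n))//.
  rewrite preimage_setT fubini_tonelli1//; last by move=> x /=; exact: G0.
  by apply: measurableT_comp => //; exact: measurable_rV_cons.
rewrite (consE _ mFv (fun x => F0 _)) (consE _ mF F0).
pose G t := (\int[lebesgue_rV R n]_y F (rV_cons (t, y)))%E.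
have mG : measurable_fun setT (G : measurableTypeR R -> \bar R).
  apply: (@measurable_fun_fubini_tonelli_F _ _ _ _ _ _ (F \o (@rV_cons R n))).
    by apply: measurableT_comp => //; exact: measurable_rV_cons.
  by move=> x; exact: F0.
transitivity (\int[lebesgue_measure]_t G (v ord0 ord0 - t)%R)%E.
  apply: eq_integral => t _.
  pose v' : 'rV[R]_n := \row_i v ord0 (lift ord0 i).
  rewrite /G -(IH v' (fun y => F (rV_cons (v ord0 ord0 - t, y)))); last 2 first.
  - apply: measurableT_comp => //; apply: measurableT_comp; first exact: measurable_rV_cons.
    by apply/measurable_fun_pairP; split; [exact: measurable_cst|exact: measurable_id].
  - by move=> y; exact: F0.
  have subE k (a b : 'rV[R]_k) i : (a - b) ord0 i = a ord0 i - b ord0 i by rewrite !mxE.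
  apply: eq_integral => y _; congr F; apply: rV_consP.
    by rewrite subE rV_cons0.
  by move=> i; rewrite !subE rV_consS mxE.
by apply: ge0_integral_reflect1 => // t; apply: integral_ge0 => y _; exact: F0.
Qed.

Lemma lebesgue_box n (A : 'I_n -> set R) :
  (forall i, measurable (A i : set (measurableTypeR R))) ->
  (forall i, 0 < lebesgue_measure (A i : set (measurableTypeR R)) < +oo)%E ->
  measurable [set x : 'rV[R]_n | forall i, A i (x ord0 i)] /\
  (0 < lebesgue_rV R n [set x : 'rV[R]_n | forall i, A i (x ord0 i)] < +oo)%E.
Proof.
elim: n A => [A _ _|n IH A mA A0].
  rewrite (_ : mkset _ = setT); last by apply/seteqP; split => // x _ [].
  by split => //; rewrite /= diracT lte01 ltry.
have [mB B0] := IH (A \o lift ord0) (fun i => mA _) (fun i => A0 _).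
set B := mkset _ in mB B0; set C := mkset _.
have mC : measurable C.
  rewrite (_ : C = \bigcap_(i in [set: 'I_n.+1]) ((@rV_coord R n.+1 i) @^-1` A i)).
    apply: fin_bigcap_measurable; first exact: finite_finset.
    by move=> i _; rewrite -[X in measurable X]setTI; exact: measurable_rV_coord.
  by apply/seteqP; split => [x H i _|x H i]; exact: H.
split => //.
have -> : lebesgue_rV R n.+1 C = (lebesgue_measure (A ord0) * lebesgue_rV R n B)%E.
  rewrite /= /lebesgue_cons /pushforward.
  rewrite (_ : _ @^-1` _ = A ord0 `*` B); first exact: product_measure1E.
  apply/seteqP; split => [[t y] H|[t y] [/= At By] i].
    split; first by have := H ord0; rewrite rV_cons0.
    by move=> i; have := H (lift ord0 i); rewrite rV_consS.
  by case: (unliftP ord0 i) => [j|] ->; [rewrite rV_consS; exact: By|rewrite rV_cons0].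
have /andP[a0 ay] := A0 ord0; have /andP[b0 bY] := B0.
by rewrite mule_gt0// lte_mul_pinfty// ?ltW// ge0_fin_numE ?ltW.
Qed.

End rV_measure.

(** * Square-integrable functions *)

Section square_integrable.
Context d (T : measurableType d) (R : realType) (mu : {measure set T -> \bar R}).
Implicit Types (f g h : T -> R) (F G : nat -> T -> R).
Local Notation integ f := (mu.-integrable setT (EFin \o f)).
Local Notation mfun f := (measurable_fun setT f).
Local Notation I f := (\int[mu]_x f x).

Lemma integ_mfun f : integ f -> mfun f.
Proof. by move=> /measurable_int /measurable_EFinP. Qed.

Lemma integ_dom f g : mfun f -> (forall x, `|f x| <= g x) -> integ g -> integ f.
Proof.
move=> mf fg; apply: le_integrable => //; first exact/measurable_EFinP.
by move=> x _; rewrite lee_fin; apply: le_trans (fg x) (ler_norm _).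
Qed.

Lemma integ_norm f : integ f -> integ (fun x => `|f x|).
Proof.
move=> f_; have mf := integ_mfun f_.
apply: (le_integrable _ _ _ f_) => //.
  by apply/measurable_EFinP; exact: measurableT_comp.
by move=> x _; rewrite lee_fin normr_id.
Qed.

Lemma integD f g : integ f -> integ g -> integ (fun x => f x + g x).
Proof. by move=> f_ g_; have := integrableD measurableT f_ g_. Qed.

Lemma integB f g : integ f -> integ g -> integ (fun x => f x - g x).
Proof. by move=> f_ g_; have := integrableB measurableT f_ g_. Qed.

Lemma integZ (c : R) f : integ f -> integ (fun x => c * f x).
Proof. by move=> f_; have := integrableZl measurableT c f_. Qed.

Lemma integ0 : integ (fun=> 0 : R).
Proof. exact: integrable0. Qed.

Lemma integ_sum (J : Type) (s : seq J) (F : J -> T -> R) : (forall i, integ (F i)) ->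
  integ (fun x => \sum_(i <- s) F i x).
Proof.
move=> F_; elim: s => [|i s IH].
  rewrite (_ : (fun x => _) = fun=> 0); first exact: integ0.
  by apply/funext => x; rewrite big_nil.
rewrite (_ : (fun x => _) = fun x => F i x + \sum_(i <- s) F i x).
  exact: integD.
by apply/funext => x; rewrite big_cons.
Qed.

Lemma intD f g : integ f -> integ g -> I (fun x => f x + g x) = I f + I g.
Proof. by move=> f_ g_; rewrite RintegralD. Qed.

Lemma intB f g : integ f -> integ g -> I (fun x => f x - g x) = I f - I g.
Proof. by move=> f_ g_; rewrite RintegralB. Qed.

Lemma intZ (c : R) f : integ f -> I (fun x => c * f x) = c * I f.
Proof. by move=> f_; rewrite RintegralZl. Qed.

Lemma intN f : integ f -> I (fun x => - f x) = - I f.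
Proof.
move=> f_; rewrite -[RHS]mulN1r -intZ//; congr Rintegral.
by apply/funext => x; rewrite mulN1r.
Qed.

Lemma int_sum (J : Type) (s : seq J) (F : J -> T -> R) : (forall i, integ (F i)) ->
  I (fun x => \sum_(i <- s) F i x) = \sum_(i <- s) I (F i).
Proof.
move=> F_; elim: s => [|i s IH].
  rewrite big_nil (_ : (fun x => _) = fun=> 0) ?Rintegral_cst ?mul0r//.
  by apply/funext => x; rewrite big_nil.
rewrite big_cons -IH -intD//; last exact: integ_sum.
by congr Rintegral; apply/funext => x; rewrite big_cons.
Qed.

Lemma int_ge0 f : (forall x, 0 <= f x) -> 0 <= I f.
Proof. by move=> f0; exact: Rintegral_ge0. Qed.

Lemma int_le f g : integ f -> integ g -> (forall x, f x <= g x) -> I f <= I g.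
Proof. by move=> f_ g_ fg; exact: le_Rintegral. Qed.

Lemma int_norm_le f : integ f -> `|I f| <= I (fun x => `|f x|).
Proof. by move=> f_; exact: le_normr_Rintegral. Qed.

Lemma integE f : integ f -> (\int[mu]_x (f x)%:E)%E = (I f)%:E.
Proof. by move=> f_; rewrite /Rintegral fineK//; exact: integrable_fin_num. Qed.

Lemma integ_ge0P f : mfun f -> (forall x, 0 <= f x) ->
  (\int[mu]_x (f x)%:E < +oo)%E -> integ f.
Proof.
move=> mf f0 foo; apply/integrableP; split; first exact/measurable_EFinP.
by under eq_integral do rewrite /= ger0_norm//.
Qed.

Lemma int_ae_eq f g : mfun f -> mfun g -> {ae mu, forall x, f x = g x} -> I f = I g.
Proof.
move=> mf mg fg; congr fine; apply: ae_eq_integral => //; try exact/measurable_EFinP.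
by move: fg; apply: filterS => x /= -> _.
Qed.

Lemma integ_ae_eq f g : mfun g -> {ae mu, forall x, f x = g x} -> integ f -> integ g.
Proof.
move=> mg fg f_; have mf := integ_mfun f_.
apply/integrableP; split; first exact/measurable_EFinP.
have /integrableP[_] := f_; apply: le_lt_trans; rewrite le_eqVlt; apply/orP; left.
apply/eqP/ae_eq_integral => //; try by apply/measurableT_comp => //; exact/measurable_EFinP.
by move: fg; apply: filterS => x /= -> _.
Qed.

Lemma int_eq0_ae f : integ f -> (forall x, 0 <= f x) -> I f = 0 -> {ae mu, forall x, f x = 0}.
Proof.
move=> f_ f0 If0; have mf := integ_mfun f_.
have /(ae_eq_integral_abs mu measurableT) : measurable_fun setT (EFin \o f) by exact/measurable_EFinP.
case=> + _; case.
  under eq_integral do rewrite /= ger0_norm//.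
  by rewrite integE// If0.
move=> N [mN N0 sub]; exists N; split => // x /= fx0; apply: sub => /= /(_ Logic.I) [].
exact: fx0.
Qed.

Lemma int_dct F f g : (forall m, mfun (F m)) -> mfun f -> integ g ->
  {ae mu, forall x, F ^~ x @ \oo --> f x} -> {ae mu, forall x m, `|F m x| <= g x} ->
  integ f /\ (fun m => I (F m)) @ \oo --> I f.
Proof.
move=> mF mf g_ Ff Fg.
have [] := @dominated_convergence _ _ _ mu setT measurableT (fun m => EFin \o F m) (EFin \o f) (EFin \o g).
- by move=> m; exact/measurable_EFinP.
- exact/measurable_EFinP.
- by move: Ff; apply: filterS => x H _; apply: cvg_EFin; [near=> m|]; rewrite //=.
- by [].
- by move: Fg; apply: filterS => x H m _ /=; rewrite lee_fin.
move=> f_ _ /=; rewrite (integE f_) => H; split => //.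
have E m : integ (F m).
  have /integrableP[mg gy] := g_.
  apply/integrableP; split; first exact/measurable_EFinP.
  apply: le_lt_trans gy; apply: ae_ge0_le_integral => //.
  + by apply/measurableT_comp => //; exact/measurable_EFinP.
  + by apply/measurableT_comp.
  + move: Fg; apply: filterS => x Hx _; rewrite /= lee_fin.
    exact: le_trans (Hx m) (ler_norm _).
have HE : (fun m => (I (F m))%:E) @ \oo --> (I f)%:E.
  apply: cvg_trans H; apply: near_eq_cvg; near=> m.
  by rewrite -integE.
exact: (fine_cvg HE).
Unshelve. all: by end_near. Qed.

Definition L2 f := mfun f /\ integ (fun x => f x ^+ 2).

Lemma L2_mfun f : L2 f -> mfun f. Proof. by case. Qed.

Lemma L2_dom f g : mfun f -> (forall x, `|f x| <= `|g x|) -> L2 g -> L2 f.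
Proof.
move=> mf fg [mg g_]; split => //; apply: integ_dom g_; first exact: measurable_funX.
by move=> x; rewrite normrX -(real_normK (num_real (g x))) lerXn2r// nnegrE.
Qed.

Lemma L2D f g : L2 f -> L2 g -> L2 (fun x => f x + g x).
Proof.
move=> [mf f_] [mg g_]; split; first exact: measurable_funD.
have := integZ 2 (integD f_ g_); apply: integ_dom.
  by apply: measurable_funX; exact: measurable_funD.
move=> x; rewrite ger0_norm ?sqr_ge0//.
by have := sqr_ge0 (f x - g x); rewrite sqrrB sqrrD; lra.
Qed.

Lemma L2Z (c : R) f : L2 f -> L2 (fun x => c * f x).
Proof.
move=> [mf f_]; split; first exact: measurable_funM.
rewrite (_ : (fun x => _) = fun x => c ^+ 2 * f x ^+ 2); first exact: integZ.
by apply/funext => x; rewrite exprMn.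
Qed.

Lemma L2B f g : L2 f -> L2 g -> L2 (fun x => f x - g x).
Proof.
move=> f_ g_; rewrite (_ : (fun x => _) = fun x => f x + (-1) * g x).
  by apply: L2D => //; exact: L2Z.
by apply/funext => x; rewrite mulN1r.
Qed.

Lemma L20 : L2 (fun=> 0 : R).
Proof.
split; first exact: measurable_cst.
by rewrite expr0n; exact: integ0.
Qed.

Lemma L2_sum (J : Type) (s : seq J) (F : J -> T -> R) : (forall i, L2 (F i)) ->
  L2 (fun x => \sum_(i <- s) F i x).
Proof.
move=> F_; elim: s => [|i s IH].
  rewrite (_ : (fun x => _) = fun=> 0); first exact: L20.
  by apply/funext => x; rewrite big_nil.
rewrite (_ : (fun x => _) = fun x => F i x + \sum_(i <- s) F i x).
  exact: L2D.
by apply/funext => x; rewrite big_cons.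
Qed.

Lemma L2_mulb (C : R) h f : mfun h -> (forall x, `|h x| <= C) -> L2 f ->
  L2 (fun x => h x * f x).
Proof.
move=> mh hC f_; apply: (@L2_dom _ (fun x => C * f x)); last exact: L2Z.
  by apply: measurable_funM => //; exact: L2_mfun.
by move=> x; rewrite !normrM ler_wpM2r// (le_trans (hC x))// ler_norm.
Qed.

Lemma integM f g : L2 f -> L2 g -> integ (fun x => f x * g x).
Proof.
move=> [mf f_] [mg g_]; have := integD f_ g_; apply: integ_dom.
  exact: measurable_funM.
move=> x; rewrite normrM -(real_normK (num_real (f x))) -(real_normK (num_real (g x))).
have := sqr_ge0 (`|f x| - `|g x|); have := normr_ge0 (f x); have := normr_ge0 (g x).
by rewrite sqrrB; nra.
Qed.

Lemma integ_sq f : L2 f -> integ (fun x => f x ^+ 2). Proof. by case. Qed.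

Lemma cauchy_schwarz f g : L2 f -> L2 g ->
  (I (fun x => f x * g x)) ^+ 2 <= I (fun x => f x ^+ 2) * I (fun x => g x ^+ 2).
Proof.
move=> f_ g_; set a := I (fun x => f x ^+ 2); set b := I (fun x => f x * g x).
set c := I (fun x => g x ^+ 2).
have fg_ := integM f_ g_; have ff_ := integ_sq f_; have gg_ := integ_sq g_.
(* The quadratic [I ((f + t g)^2)] is nonnegative; it is affine when [c = 0]. *)
have key t : 0 <= a + 2 * t * b + t ^+ 2 * c.
  have := @int_ge0 (fun x => (f x + t * g x) ^+ 2) (fun x => sqr_ge0 _).
  rewrite (_ : (fun x => _) =
    (fun x => f x ^+ 2 + (2 * t * (f x * g x) + t ^+ 2 * g x ^+ 2))); last first.
    by apply/funext => x; ring.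
  rewrite intD//; last by apply: integD; exact: integZ.
  by rewrite intD ?intZ ?addrA//; exact: integZ.
have a0 : 0 <= a by apply: int_ge0 => x; exact: sqr_ge0.
have c0 : 0 <= c by apply: int_ge0 => x; exact: sqr_ge0.
have [c00|c_neq0] := eqVneq c 0.
  rewrite c00 mulr0; have [->|b0] := eqVneq b 0; first by rewrite expr0n.
  have := key (- (a + 1) / (2 * b)); rewrite c00 mulr0 addr0.
  have -> : 2 * (- (a + 1) / (2 * b)) * b = - (a + 1) by field.
  by rewrite opprD addrA subrr sub0r oppr_ge0 ler10.
have := key (- b / c).
have -> : a + 2 * (- b / c) * b + (- b / c) ^+ 2 * c = a - b ^+ 2 / c by field.
by rewrite subr_ge0 ler_pdivrMr// lt_neqAle eq_sym c_neq0.
Qed.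

Lemma sqrD_le (a b : R) : (a + b) ^+ 2 <= 2 * (a ^+ 2 + b ^+ 2).
Proof. by have := sqr_ge0 (a - b); rewrite sqrrB sqrrD; lra. Qed.

Definition cvg2 F f := [/\ forall m, L2 (F m), L2 f &
  (fun m => I (fun x => (F m x - f x) ^+ 2)) @ \oo --> (0 : R)].

Lemma cvg2_dom F f g (C : R) (G : nat -> T -> R) : cvg2 G g ->
  (forall m, L2 (F m)) -> L2 f ->
  (forall m x, (F m x - f x) ^+ 2 <= C * (G m x - g x) ^+ 2) -> cvg2 F f.
Proof.
move=> [G_ g_ Gg] F_ f_ H; split => //.
have : (fun m => C * I (fun x => (G m x - g x) ^+ 2)) @ \oo --> C * 0.
  by apply: cvgM => //; exact: cvg_cst.
rewrite mulr0; apply: squeeze_cvgr; last exact: cvg_cst.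
near=> m; apply/andP; split; first by apply: int_ge0 => x; exact: sqr_ge0.
rewrite -intZ; last exact/integ_sq/L2B.
by apply: int_le => //; [exact/integ_sq/L2B|exact/integZ/integ_sq/L2B].
Unshelve. all: by end_near. Qed.

Lemma cvg2D F f G g : cvg2 F f -> cvg2 G g ->
  cvg2 (fun m x => F m x + G m x) (fun x => f x + g x).
Proof.
move=> [F_ f_ Ff] [G_ g_ Gg]; split; [by move=> m; exact: L2D|exact: L2D|].
have : (fun m => 2 * (I (fun x => (F m x - f x) ^+ 2) + I (fun x => (G m x - g x) ^+ 2))) @ \oo -->
   2 * (0 + 0 : R).
  by apply: cvgM; [exact: cvg_cst|exact: cvgD].
rewrite addr0 mulr0; apply: squeeze_cvgr; last exact: cvg_cst.
near=> m; apply/andP; split; first by apply: int_ge0 => x; exact: sqr_ge0.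
have A := integ_sq (L2B (F_ m) f_); have B := integ_sq (L2B (G_ m) g_).
rewrite -intD// -intZ; last exact: integD.
apply: int_le; [by apply/integ_sq/L2B; exact: L2D|by apply/integZ/integD|].
move=> x; rewrite (_ : F m x + G m x - (f x + g x) = (F m x - f x) + (G m x - g x)); last by ring.
exact: sqrD_le.
Unshelve. all: by end_near. Qed.

Lemma cvg2_mulb (C : R) h F f : mfun h -> (forall x, `|h x| <= C) -> cvg2 F f ->
  cvg2 (fun m x => h x * F m x) (fun x => h x * f x).
Proof.
move=> mh hC Ff; have [F_ f_ _] := Ff.
apply: (@cvg2_dom _ _ f (C ^+ 2) F) => //; [by move=> m; exact: L2_mulb mh hC _|exact: L2_mulb mh hC _|].
move=> m x; rewrite -mulrBr exprMn ler_wpM2r ?sqr_ge0//.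
by rewrite -(real_normK (num_real (h x))) lerXn2r// nnegrE ?(le_trans _ (hC x)).
Qed.

Lemma cvg2Z (c : R) F f : cvg2 F f -> cvg2 (fun m x => c * F m x) (fun x => c * f x).
Proof. by apply: (@cvg2_mulb `|c|) => //; exact: measurable_cst. Qed.

Lemma cvg2_cst f : L2 f -> cvg2 (fun=> f) f.
Proof.
move=> f_; split => //; rewrite (_ : (fun m => _) = fun=> 0); first exact: cvg_cst.
apply/funext => m; rewrite (_ : (fun x => _) = fun=> 0) ?Rintegral_cst ?mul0r//.
by apply/funext => x; rewrite subrr expr0n.
Qed.

Lemma cvg2_sum (J : Type) (s : seq J) (F : J -> nat -> T -> R) (f : J -> T -> R) :
  (forall i, cvg2 (F i) (f i)) ->
  cvg2 (fun m x => \sum_(i <- s) F i m x) (fun x => \sum_(i <- s) f i x).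
Proof.
move=> Ff; elim: s => [|i s IH].
  rewrite (_ : (fun m x => _) = fun=> fun=> 0); last first.
    by apply/funext => m; apply/funext => x; rewrite big_nil.
  rewrite (_ : (fun x => _) = fun=> 0); last by apply/funext => x; rewrite big_nil.
  by apply: cvg2_cst; exact: L20.
rewrite (_ : (fun m x => _) = fun m x => F i m x + \sum_(i <- s) F i m x); last first.
  by apply/funext => m; apply/funext => x; rewrite big_cons.
rewrite (_ : (fun x => _) = fun x => f i x + \sum_(i <- s) f i x); last first.
  by apply/funext => x; rewrite big_cons.
exact: cvg2D.
Qed.

(** Joint continuity of the inner product is what carries integral identities
    from test functions to their limits. *)
Lemma cvg2_int F f G g : cvg2 F f -> cvg2 G g ->
  (fun m => I (fun x => F m x * G m x)) @ \oo --> I (fun x => f x * g x).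
Proof.
have half F' f' g' : cvg2 F' f' -> L2 g' ->
    (fun m => I (fun x => (F' m x - f' x) * g' x)) @ \oo --> (0 : R).
  move=> [F_ f_ Ff] g_.
  have : (fun m => Num.sqrt (I (fun x => (F' m x - f' x) ^+ 2) * I (fun x => g' x ^+ 2))) @ \oo
      --> Num.sqrt (0 * I (fun x => g' x ^+ 2)).
    apply: continuous_cvg; first exact: sqrt_continuous.
    by apply: cvgM => //; exact: cvg_cst.
  rewrite mul0r sqrtr0 => H; apply/cvgr0Pnorm_le => e e0.
  move/cvgr0Pnorm_le/(_ e e0) : H; apply: filterS => m; apply: le_trans.
  rewrite [leRHS]ger0_norm ?sqrtr_ge0// -sqrtr_sqr; apply: ler_wsqrtr.
  by apply: cauchy_schwarz => //; exact: L2B.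
move=> Ff Gg; have [F_ f_ _] := Ff; have [G_ g_ Gg0] := Gg.
have C : (fun m => I (fun x => (F m x - f x) * (G m x - g x))) @ \oo --> (0 : R).
  have : (fun m => Num.sqrt (I (fun x => (F m x - f x) ^+ 2) * I (fun x => (G m x - g x) ^+ 2))) @ \oo
      --> Num.sqrt (0 * 0 : R).
    apply: continuous_cvg; first exact: sqrt_continuous.
    by case: Ff => _ _ ?; exact: cvgM.
  rewrite mul0r sqrtr0 => H; apply/cvgr0Pnorm_le => e e0.
  move/cvgr0Pnorm_le/(_ e e0) : H; apply: filterS => m; apply: le_trans.
  rewrite [leRHS]ger0_norm ?sqrtr_ge0// -sqrtr_sqr; apply: ler_wsqrtr.
  by apply: cauchy_schwarz; exact: L2B.
have := cvgD (cvgD C (half _ _ _ Ff g_)) (half _ _ _ Gg f_).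
rewrite !addr0 => H.
have : (fun m => (I (fun x => (F m x - f x) * (G m x - g x)) + I (fun x => (F m x - f x) * g x)
    + I (fun x => (G m x - g x) * f x)) + I (fun x => f x * g x)) @ \oo --> 0 + I (fun x => f x * g x).
  by apply: cvgD; [exact: H|exact: cvg_cst].
rewrite add0r; apply: cvg_trans; apply: near_eq_cvg; near=> m.
have a1 := integM (L2B (F_ m) f_) (L2B (G_ m) g_).
have a2 := integM (L2B (F_ m) f_) g_.
have a3 := integM (L2B (G_ m) g_) f_; have a4 := integM f_ g_.
rewrite -intD// -intD//; last exact: integD.
rewrite -intD//; last by apply: integD => //; exact: integD.
by congr Rintegral; apply/funext => x; ring.
Unshelve. all: by end_near. Qed.

End square_integrable.

(** * Completeness *)

Section completeness.
Context d (T : measurableType d) (R : realType) (mu : {measure set T -> \bar R}).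
Implicit Types (f g h : T -> R) (F G : nat -> T -> R).
Local Notation integ f := (mu.-integrable setT (EFin \o f)).
Local Notation mfun f := (measurable_fun setT f).
Local Notation I f := (\int[mu]_x f x).

(** The rate depends on the sequence through [c] only, which is the square root of an
    integrable function of the point when the sequence consists of values of
    functions. *)
Lemma fast_cauchy (u : nat -> R) (c : R) : 0 <= c ->
  (forall m, `|u m.+1 - u m| <= 2 ^- m * c) ->
  cvgn u /\ forall m, `|limn u - u m| <= 2 * 2 ^- m * c.
Proof.
move=> c0 uc.
have pos m : 0 <= 2 ^- m :> R by rewrite invr_ge0 exprn_ge0.
have half m : 2 ^- m.+1 = 2 ^- m / 2 :> R by rewrite exprSr invfM.
have step m k : `|u (m + k)%N - u m| <= (2 * 2 ^- m - 2 * 2 ^- (m + k)) * c.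
  elim: k => [|k IH]; first by rewrite addn0 !subrr normr0 mul0r.
  rewrite addnS half; have := uc (m + k)%N.
  have := ler_normD (u (m + k).+1 - u (m + k)%N) (u (m + k)%N - u m).
  rewrite subrKA; move: IH; set x := `|_|; set y := `|_|; set z := `|_|.
  by move: (2 ^- (m + k)) (2 ^- m) => a b; lra.
have bnd m k : `|u (m + k)%N - u m| <= 2 * 2 ^- m * c.
  apply: le_trans (step m k) _; rewrite ler_wpM2r// lerBlDr lerDl.
  by rewrite mulr_ge0.
have z2 : (fun m => 2 * 2 ^- m * c) @ \oo --> (0 : R).
  rewrite [X in _ --> X](_ : _ = 2 * 0 * c); last by rewrite mulr0 mul0r.
  apply: cvgM; last exact: cvg_cst.
  apply: cvgM; first exact: cvg_cst.
  rewrite (_ : (fun m => _) = GRing.exp (2^-1 : R)).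
    by apply: cvg_expr; rewrite ger0_norm// invf_lt1// ltr1n.
  by apply/funext => m; rewrite exprVn.
have cu : cvgn u.
  have cv : cvgn (fun m => u m + 2 * 2 ^- m * c).
    apply: nonincreasing_is_cvgn.
      apply/nonincreasing_seqP => m; rewrite half.
      have := uc m; rewrite ler_norml => /andP[_].
      by move: (2 ^- m) => a; lra.
    exists (u 0%N - 2 * 2 ^- 0 * c) => _ [m _ <-].
    have := bnd 0%N m; rewrite add0n ler_norml => /andP[+ _].
    have : 0 <= 2 * 2 ^- m * c by rewrite !mulr_ge0.
    by move: (2 * 2 ^- m * c) => a; lra.
  have -> : u = fun m => (u m + 2 * 2 ^- m * c) - (2 * 2 ^- m * c).
    by apply/funext => m; rewrite addrK.
  by apply: is_cvgB => //; apply/cvg_ex; exists 0.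
split => // m.
have L : (fun k => `|u (m + k)%N - u m|) @ \oo --> `|limn u - u m|.
  apply: cvg_norm; apply: cvgB; last exact: cvg_cst.
  rewrite (_ : (fun k => u (m + k)%N) = (fun k => u (k + m)%N)).
    by rewrite cvg_shiftn.
  by apply/funext => k; rewrite addnC.
by apply: (ler_cvg_to L (cvg_cst _)); apply: nearW => k; exact: bnd.
Qed.

(** Riesz-Fischer: the weighted square function [S] is integrable, hence finite
    almost everywhere, and [sqrt S] controls all the increments at once. *)
Lemma cvg2_complete F : (forall m, L2 mu (F m)) ->
  (forall m, 4 ^+ m * I (fun x => (F m.+1 x - F m x) ^+ 2) <= (2 ^ m.+1)%:R^-1) ->
  exists f, cvg2 mu F f.
Proof.
move=> F_ HF.
pose dd m x : R := 4 ^+ m * (F m.+1 x - F m x) ^+ 2.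
have dd0 m x : 0 <= dd m x by rewrite mulr_ge0 ?sqr_ge0// exprn_ge0.
have dd_ m : integ (dd m) by apply/integZ/integ_sq/L2B.
pose S x : \bar R := (\sum_(m <oo) (dd m x)%:E)%E.
have S0 x : (0 <= S x)%E by apply: nneseries_ge0 => m _ _; rewrite lee_fin.
have mS : measurable_fun setT S.
  apply: ge0_emeasurable_sum => [m x _ _|m _]; first by rewrite lee_fin.
  exact/measurable_EFinP/(integ_mfun (dd_ m)).
have intS : (\int[mu]_x S x <= 1)%E.
  rewrite integral_nneseries//; last 2 first.
  - by move=> m; exact/measurable_EFinP/(integ_mfun (dd_ m)).
  - by move=> m x _; rewrite lee_fin.
  apply: le_trans (epsilon_trick0 xpredT ler01); apply: lee_nneseries.
    by move=> m _ _; apply: integral_ge0 => x _; rewrite lee_fin.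
  move=> m _; rewrite integE// lee_fin div1r intZ ?HF//.
  exact/integ_sq/L2B.
have iS : mu.-integrable setT S.
  apply/integrableP; split => //; under eq_integral do rewrite gee0_abs//.
  by apply: le_lt_trans intS _; rewrite ltry.
pose s x := fine (S x).
have s0 x : 0 <= s x by rewrite fine_ge0.
have ms : mfun s by apply: measurableT_comp => //; exact: fine_measurable.
have s_ : integ s.
  apply: (le_integrable _ _ _ iS) => //; first exact/measurable_EFinP.
  move=> x _ /=; rewrite ger0_norm// gee0_abs// /s.
  by case: (S x) (S0 x) => [r| |]//= _; rewrite leey.
pose E : set T := S @^-1` [set y | (y < +oo)%E].
have mE : measurable E.
  rewrite -[E]setTI; apply: mS => //.
  rewrite (_ : mkset _ = `]-oo, +oo%E[%classic); first exact: emeasurable_itv.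
  by apply/seteqP; split => y /=; rewrite in_itv /= ?andbT.
have muE : mu (~` E) = 0.
  have [N [mN N0 sN]] := integrable_ae measurableT iS.
  apply: (subset_measure0 _ mN _ N0); first exact: measurableC.
  move=> x Ex; apply: sN => /= H; apply: Ex; rewrite /E /=.
  by rewrite -ge0_fin_numE// H.
pose G m x : R := \1_E x * F m x.
have mG m : mfun (G m).
  by apply: measurable_funM; [exact: measurable_indic|exact: L2_mfun].
have Gs x m : `|G m.+1 x - G m x| <= 2 ^- m * Num.sqrt (s x).
  rewrite /G -mulrBr indicE; have [/set_mem Ex|_] := boolP (x \in E); last first.
    by rewrite mul0r normr0 mulr_ge0 ?sqrtr_ge0// invr_ge0 exprn_ge0.
  rewrite mul1r -sqrtr_sqr -[2 ^- m]ger0_norm ?invr_ge0 ?exprn_ge0//.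
  rewrite -sqrtr_sqr -sqrtrM ?sqr_ge0//; apply: ler_wsqrtr.
  rewrite exprVn -exprM mulnC exprM (_ : 2 ^+ 2 = 4 :> R); last by ring.
  rewrite ler_pdivlMl ?exprn_gt0// -lee_fin /s fineK; last by rewrite ge0_fin_numE.
  have H := @nneseries_lim_ge R (fun m => (dd m x)%:E) xpredT 0%N m.+1 (fun k _ _ => dd0 k x).
  apply: le_trans H; rewrite big_nat_recr//= -[leLHS]add0e; apply: leeD => //.
  by apply: sume_ge0 => i _; rewrite lee_fin.
have lim_ x := fast_cauchy (sqrtr_ge0 (s x)) (Gs x).
pose f x := limn (G ^~ x).
have Gf x : G ^~ x @ \oo --> f x by have [] := lim_ x.
have mf : mfun f by apply: (@measurable_fun_cvg _ _ _ _ G) => // x _; exact: Gf.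
have fG m x : (G m x - f x) ^+ 2 <= 4 * 4 ^- m * s x.
  have [_ /(_ m)] := lim_ x; rewrite -/(f x) distrC.
  rewrite -[4 * 4 ^- m](_ : (2 * 2 ^- m) ^+ 2 = _); last first.
    rewrite exprMn exprVn -exprM mulnC exprM.
    by congr (_ * _^-1); [|congr (_ ^+ _)]; ring.
  rewrite -{2}(sqr_sqrtr (s0 x)) -exprMn -(real_normK (num_real (G m x - f x))).
  by move=> H; rewrite lerXn2r// nnegrE// (le_trans _ H).
have aeE : {ae mu, forall x, E x}.
  by exists (~` E); split => //; exact: measurableC.
have GF m : {ae mu, forall x, G m x = F m x}.
  by move: aeE; apply: filterS => x Ex; rewrite /G indicE mem_set// mul1r.
have G_ m : L2 mu (G m).
  apply: (L2_dom _ _ (F_ m)) => // x; rewrite /G normrM ler_piMl// indicE.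
  by case: (_ \in _); rewrite ?normr1 ?normr0.
have f_ : L2 mu f.
  have H0 : L2 mu (fun x => G 0%N x - f x).
    split; first exact: measurable_funB.
    apply: integ_dom (integZ (4 * 4 ^- 0) s_).
      by apply: measurable_funX; exact: measurable_funB.
    by move=> x; rewrite ger0_norm ?sqr_ge0.
  have := L2B (G_ 0%N) H0; rewrite (_ : (fun x => _) = f)//.
  by apply/funext => x; rewrite opprB addrC subrK.
exists f; split => //.
have z4 : (fun m => 4 * 4 ^- m * I s) @ \oo --> (0 : R).
  rewrite [X in _ --> X](_ : _ = 4 * 0 * I s); last by rewrite mulr0 mul0r.
  apply: cvgM; last exact: cvg_cst.
  apply: cvgM; first exact: cvg_cst.
  rewrite (_ : (fun m => _) = GRing.exp (4^-1 : R)).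
    by apply: cvg_expr; rewrite ger0_norm// invf_lt1// ltr1n.
  by apply/funext => m; rewrite exprVn.
apply: squeeze_cvgr z4; last exact: cvg_cst.
apply: nearW => m; apply/andP; split; first by apply: int_ge0 => x; exact: sqr_ge0.
have -> : I (fun x => (F m x - f x) ^+ 2) = I (fun x => (G m x - f x) ^+ 2).
  apply: int_ae_eq.
  - by apply: measurable_funX; apply: measurable_funB => //; exact: L2_mfun.
  - by apply: measurable_funX; exact: measurable_funB.
  - by move: (GF m); apply: filterS => x ->.
by rewrite -intZ//; apply: int_le => //; [exact/integ_sq/L2B|exact: integZ].
Qed.

End completeness.

(** * Integration of test functions *)

Section test_integration.
Context (R : realType) (n : nat).
Implicit Types (f g phi psi : 'rV[R]_n -> R) (j : 'I_n).
Local Notation mu := (lebesgue_rV R n).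
Local Notation integ f := (mu.-integrable setT (EFin \o f)).
Local Notation mfun f := (measurable_fun setT (f : 'rV[R]_n -> R)).
Local Notation I f := (\int[mu]_x f x).
Local Notation e_ j := (delta_mx ord0 j : 'rV[R]_n).

Lemma mfun_smooth phi : smooth phi -> mfun phi.
Proof. by move=> /smooth_continuous; exact: continuous_rV_measurable. Qed.

Lemma in_box_measurable (a b : 'I_n -> R) : measurable (in_box a b).
Proof.
rewrite (_ : in_box a b = \bigcap_(i in [set: 'I_n]) ((@rV_coord R n i) @^-1` `]a i, b i[)).
  apply: fin_bigcap_measurable; first exact: finite_finset.
  by move=> i _; rewrite -[X in measurable X]setTI; exact: measurable_rV_coord.
by apply/seteqP; split => [x H i _|x H i]; have := H i; rewrite /= in_itv //=; exact.
Qed.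

Lemma in_box_finite (a b : 'I_n -> R) : (mu (in_box a b) < +oo)%E.
Proof.
pose b' i := Num.max (b i) (a i + 1).
have ab' i : a i < b' i by rewrite /b' lt_max ltrDl ltr01 orbT.
have [|mB /andP[_ H]] := @lebesgue_box R n (fun i => `]a i, b' i[%classic)
  (fun i => measurable_itv _).
  move=> i; rewrite lebesgue_measure_itv /= lte_fin ab' -EFinD lte_fin ltry.
  by rewrite subr_gt0 ab'.
apply: le_lt_trans _ H; apply: le_measure; rewrite ?inE; [exact: in_box_measurable|exact: mB|].
move=> x xab i; rewrite /= in_itv /=; have /andP[-> xb] := xab i.
by rewrite /b' lt_max xb.
Qed.

Lemma in_box_positive (a b : 'I_n -> R) : (forall i, a i < b i) -> (0 < mu (in_box a b))%E.
Proof.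
move=> ab; have [|mB /andP[H _]] := @lebesgue_box R n (fun i => `]a i, b i[%classic)
  (fun i => measurable_itv _).
  move=> i; rewrite lebesgue_measure_itv /= lte_fin ab -EFinD lte_fin ltry.
  by rewrite subr_gt0 ab.
rewrite (_ : in_box a b = [set x | forall i, `]a i, b i[%classic (x ord0 i)])//.
Qed.

Definition cube (M : R) : set 'rV[R]_n := in_box (fun=> - M) (fun=> M).

Lemma coord_norm_le (x : 'rV[R]_n) i : `|x ord0 i| <= `|x|.
Proof.
rewrite [leRHS]/Num.norm /= mx_normrE; apply/bigmax_geP; right => /=.
by exists (ord0, i).
Qed.

Lemma norm_cube M (x : 'rV[R]_n) : `|x| < M -> cube M x.
Proof.
move=> xM i; rewrite -ltr_norml; exact: le_lt_trans (coord_norm_le x i) xM.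
Qed.

Lemma cube_norm M (x : 'rV[R]_n) : cube M x -> `|x| <= `|M|.
Proof.
move=> xM; rewrite [leLHS]/Num.norm /= mx_normrE; apply: bigmax_le => //.
move=> [i l] _ /=; rewrite (ord1 i); apply: le_trans (ler_norm M).
by rewrite ler_norml; have /andP[/ltW -> /ltW ->] := xM l.
Qed.

Lemma test_lipschitz phi : test_function phi ->
  exists2 L, 0 <= L & forall x y, `|phi y - phi x| <= L * `|y - x|.
Proof.
move=> tp; have [C C0 HC] := test_gradient_bounded tp.
exists (C * n%:R) => [|x y]; first by rewrite mulr_ge0.
apply: le_trans (smooth_lipschitz (test_smooth tp) HC x y) _.
rewrite -mulrA ler_wpM2l// mulrC -[n in _ * n%:R]card_ord -sumr_const mulr_sumr.
by apply: ler_sum => i _; rewrite mulr1; exact: coord_norm_le.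
Qed.

Lemma indic_integ (A : set 'rV[R]_n) : measurable A -> (mu A < +oo)%E -> integ (\1_A : _ -> R).
Proof.
move=> mA Aoo; apply: integ_ge0P => [|x|]; first exact: measurable_indic.
  by rewrite indicE.
by rewrite integral_indic// setIT.
Qed.

Lemma integ_supp (M C : R) f : mfun f -> (forall x, `|f x| <= C) -> supp_in M f -> integ f.
Proof.
move=> mf fC sM.
have := integZ C (indic_integ (in_box_measurable _ _) (in_box_finite (fun=> - (M + 1)) (fun=> M + 1))).
apply: integ_dom => // x; rewrite indicE.
have [xM|xM] := leP `|x| M; last first.
  rewrite sM// normr0 mulr_ge0// (le_trans _ (fC 0))//.
by rewrite mem_set ?mulr1//; apply: norm_cube; rewrite (le_lt_trans xM)// ltrDl.
Qed.

Lemma supp_sq M f : supp_in M f -> supp_in M (fun x => f x ^+ 2).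
Proof. by move=> sM x /sM ->; rewrite expr0n. Qed.

Lemma L2_supp (M C : R) f : mfun f -> (forall x, `|f x| <= C) -> supp_in M f -> L2 mu f.
Proof.
move=> mf fC sM; split => //; apply: (@integ_supp M (C ^+ 2)).
- exact: measurable_funX.
- by move=> x; rewrite normrX lerXn2r// nnegrE ?(le_trans _ (fC x)).
- exact: supp_sq.
Qed.

Lemma L2_test phi : test_function phi -> L2 mu phi.
Proof.
move=> tp; have [C _ HC] := test_bounded tp.
have /test_functionP[sp [M sM]] := tp.
by apply: (@L2_supp M C) => //; exact: mfun_smooth.
Qed.

Lemma integ_test phi : test_function phi -> integ phi.
Proof.
move=> tp; have [C _ HC] := test_bounded tp.
have /test_functionP[sp [M sM]] := tp.
by apply: (@integ_supp M C) => //; exact: mfun_smooth.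
Qed.

Lemma mfun_reflect (v : 'rV[R]_n) f : mfun f -> mfun (fun x => f (v - x)).
Proof. by move=> mf; apply: measurableT_comp => //; exact: measurable_rV_reflect. Qed.

Lemma int_reflect (v : 'rV[R]_n) f : mfun f -> I (fun x => f (v - x)) = I f.
Proof.
move=> mf; rewrite /Rintegral; congr fine.
have mE : measurable_fun setT (EFin \o f) by exact/measurable_EFinP.
rewrite integralE [RHS]integralE.
have A := @ge0_integral_reflect R n v _ (measurable_funepos mE) (fun x => funepos_ge0 _ x).
have B := @ge0_integral_reflect R n v _ (measurable_funeneg mE) (fun x => funeneg_ge0 _ x).
apply: etrans (congr2 (fun a b => (a - b)%E) A B); congr (_ - _)%E.
  by apply: eq_integral => x _; rewrite !funeposE.
by apply: eq_integral => x _; rewrite !funenegE.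
Qed.

Lemma integ_reflect (v : 'rV[R]_n) f : integ f -> integ (fun x => f (v - x)).
Proof.
move=> f_; have mf := integ_mfun f_.
apply/integrableP; split; first by apply/measurable_EFinP; exact: mfun_reflect.
rewrite (@ge0_integral_reflect R n v (fun x => `|(f x)%:E|)%E)//; last first.
  by apply: measurableT_comp => //; exact/measurable_EFinP.
by have /integrableP[] := f_.
Qed.

Lemma int_shift (v : 'rV[R]_n) f : mfun f -> I (fun x => f (v + x)) = I f.
Proof.
move=> mf; rewrite -(int_reflect v mf) -(int_reflect 0 (mfun_reflect v mf)).
by congr Rintegral; apply/funext => x; rewrite sub0r opprK.
Qed.

Lemma integ_shift (v : 'rV[R]_n) f : integ f -> integ (fun x => f (v + x)).
Proof.
move=> f_; have := integ_reflect 0 (integ_reflect v f_).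
by apply: eq_integrable => // x _; rewrite /= sub0r opprK.
Qed.

(** Difference quotients have integral zero by translation invariance, and they
    converge boundedly. *)
Lemma int_partial phi j : test_function phi -> I (partial j phi) = 0.
Proof.
move=> tp; have [C C0 HC] := test_bounded (test_partial j tp).
have /test_functionP[sp [M sM]] := tp.
pose h m : R := m.+1%:R^-1.
pose F m x := (h m)^-1 * (phi (h m *: e_ j + x) - phi x).
have mp := mfun_smooth sp.
have h0 m : 0 < h m by rewrite invr_gt0.
have h1 m : h m <= 1 by rewrite invf_le1// ler1n.
have Fint m : integ (F m) /\ I (F m) = 0.
  have i1 := integ_test tp; have i2 := integ_shift (h m *: e_ j) i1.
  split; first by apply: integZ; exact: integB.
  by rewrite intZ ?intB// ?int_shift ?subrr ?mulr0//; exact: integB.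
have Flim x : F ^~ x @ \oo --> partial j phi x.
  have [D1 D2] := smooth_is_derive j x sp.
  have : (fun h : R => h^-1 *: (phi (h *: e_ j + x) - phi x)) @ 0^' --> partial j phi x.
    by rewrite -D2; exact: D1.
  move=> H; have hl : h @ \oo --> 0^'.
    move=> A A0; have := @cvg_harmonic R _ A0.
    apply: (@filterS nat \oo _ (fun m => h m != 0 -> A (h m))) => m; apply.
    by rewrite gt_eqF.
  have := cvg_comp _ _ hl H; apply: cvg_trans; apply: near_eq_cvg; exact: nearW.
have bound x m : `|F m x| <= C * \1_(cube (M + 2)) x.
  rewrite indicE; have [/set_mem xM|/negP xM] := boolP (x \in cube (M + 2)).
    rewrite mulr1 normrM normfV ler_pdivrMl ?normr_gt0 ?gt_eqF// mulrC.
    exact: smooth_axis_lipschitz.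
  have Mx : M + 2 <= `|x|.
    by rewrite leNgt; apply/negP => /norm_cube/mem_set; exact: xM.
  rewrite /F !sM ?subrr ?mulr0 ?normr0//; first by rewrite (lt_le_trans _ Mx)// ltrDl.
  have := ler_normB (h m *: e_ j + x) (h m *: e_ j); rewrite [_ + x]addrC addrK.
  have : `|h m *: e_ j| <= 1.
    rewrite normrZ (ger0_norm (ltW (h0 m))) mulr_ile1 ?normr_ge0// ?(ltW (h0 m))//.
    exact: norm_delta_le1.
  by move: Mx; lra.
have [||||| _ L] := @int_dct _ _ _ mu F (partial j phi) (fun x => C * \1_(cube (M + 2)) x).
- by move=> m; have [/integ_mfun] := Fint m.
- exact: (mfun_smooth (smooth_partial j sp)).
- by apply/integZ/indic_integ; [exact: in_box_measurable|exact: in_box_finite].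
- by apply: aeW => x; exact: Flim.
- by apply: aeW => x m; exact: bound.
have : (fun m => I (F m)) @ \oo --> (0 : R).
  by rewrite (_ : (fun m => _) = fun=> 0); [exact: cvg_cst|apply/funext => m; have [] := Fint m].
by move=> L0; exact: (cvg_unique _ L L0).
Qed.

Lemma int_by_parts phi psi j : smooth phi -> test_function psi ->
  I (fun x => partial j phi x * psi x) = - I (fun x => phi x * partial j psi x).
Proof.
move=> sp tp; apply/eqP; rewrite -addr_eq0 -intD; last 2 first.
- by apply/integ_test/testMl; [exact: smooth_partial|].
- by apply/integ_test/(testMl sp); exact: test_partial.
rewrite -(partialM _ sp (test_smooth tp)) int_partial; first by [].
exact: testMl sp tp.
Qed.

End test_integration.

(** * Density of test functions *)

Section density.
Import HBNNSimple.
Context (R : realType) (n : nat).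
Implicit Types (f g phi psi : 'rV[R]_n -> R) (j : 'I_n).
Local Notation mu := (lebesgue_rV R n).
Local Notation integ f := (mu.-integrable setT (EFin \o f)).
Local Notation mfun f := (measurable_fun setT (f : 'rV[R]_n -> R)).
Local Notation I f := (\int[mu]_x f x).
Local Notation V := 'rV[R]_n.

(** A weight concentrated on a box lets one argument serve two purposes: the weight
    [|g|] in the fundamental lemma, and the indicator of the box for density in mean
    square. *)
Section weighted.
Variables (a b : 'I_n -> R) (w : 'rV[R]_n -> R).
Hypothesis w0 : forall x, 0 <= w x.
Hypothesis w_out : forall x, ~ in_box a b x -> w x = 0.
Hypothesis w_ : integ w.

Let cutoff phi := [/\ test_function phi, forall x, 0 <= phi x <= 1 &
  forall x, ~ in_box a b x -> phi x = 0].

Let approximable (A : set V) := measurable A /\ forall e, 0 < e ->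
  exists2 phi, cutoff phi & I (fun x => `|\1_A x - phi x| * w x) < e.

Let indic01 (A : set V) x : 0 <= (\1_A x : R) <= 1.
Proof. by rewrite indicE; case: (_ \in _); rewrite /= ?lexx ?ler01. Qed.

Let dist_le1 (s t : R) : 0 <= s <= 1 -> 0 <= t <= 1 -> `|s - t| <= 1.
Proof. by move=> /andP[? ?] /andP[? ?]; rewrite ler_norml; apply/andP; split; lra. Qed.

Let dist_integ f g : mfun f -> mfun g ->
  (forall x, 0 <= f x <= 1) -> (forall x, 0 <= g x <= 1) ->
  integ (fun x => `|f x - g x| * w x).
Proof.
move=> mf mg f01 g01; apply: integ_dom w_.
  apply: measurable_funM; last exact: integ_mfun w_.
  by apply: measurableT_comp => //; exact: measurable_funB.
by move=> x; rewrite normrM normr_id (ger0_norm (w0 x)) ler_piMl// dist_le1.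
Qed.

Let mcutoff phi : cutoff phi -> mfun phi.
Proof. by move=> [tp _ _]; exact: (mfun_smooth (test_smooth tp)). Qed.

(* Indicators of subboxes are limits of bumps, by dominated convergence. *)
Let approximable_subbox (A : set V) a' b' : measurable A ->
  (forall x, in_box a b x -> A x <-> in_box a' b' x) -> in_box a' b' `<=` in_box a b ->
  approximable A.
Proof.
move=> mA AB sub; split => // e e0.
pose F m x := `|\1_A x - box_bump m.+1%:R a' b' x| * w x.
have c m : cutoff (box_bump m.+1%:R a' b').
  split; first exact: test_box_bump.
    by move=> x; rewrite box_bump_ge0 box_bump_le1.
  by move=> x H; apply: box_bump_out => // /sub.
have F_ m : integ (F m).
  by apply: dist_integ (measurable_indic mA) (mcutoff (c m)) (indic01 _) _; case: (c m).
have [|||||_ ] := @int_dct _ _ _ mu F (fun=> 0) w.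
- by move=> m; exact: integ_mfun (F_ m).
- exact: measurable_cst.
- by [].
- apply: aeW => x; rewrite /F.
  have [xab|/w_out ->] := pselect (in_box a b x); last first.
    by under eq_fun do rewrite mulr0; exact: cvg_cst.
  rewrite -(mul0r (w x)); apply: cvgM; last exact: cvg_cst.
  have -> : \1_A x = \1_(in_box a' b') x :> R.
    have [Ax|nAx] := pselect (A x); rewrite !indicE; first by rewrite !mem_set//; exact/AB.
    rewrite (memNset nAx) memNset// => H; apply: nAx; exact/AB.
  rewrite -(normr0 R); apply: cvg_norm; rewrite -(subrr (\1_(in_box a' b') x : R)).
  by apply: cvgB; [exact: cvg_cst|exact: box_bump_cvg].
- apply: aeW => x m; rewrite /F normrM normr_id (ger0_norm (w0 x)) ler_piMl// dist_le1//.
  by case: (c m).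
rewrite Rintegral_cst ?mul0r//= => /cvgr0Pnorm_lt/(_ e e0)[m _ /(_ m (leqnn m))] /=.
rewrite ger0_norm; last by apply: int_ge0 => x; rewrite mulr_ge0.
by exists (box_bump m.+1%:R a' b').
Qed.

Let approximable_setT : approximable setT.
Proof.
by apply: (@approximable_subbox setT a b) => // x xab; split.
Qed.

Let approximable_setC A : approximable A -> approximable (~` A).
Proof.
move=> [mA HA]; split; first exact: measurableC.
move=> e e0; have e20 : 0 < e / 2 by rewrite divr_gt0.
have [phi cphi Hphi] := HA _ e20; have [_ /(_ _ e20)[chi cchi Hchi]] := approximable_setT.
have [tp p01 pout] := cphi; have [tc c01 cout] := cchi.
have c' : cutoff (fun x => chi x * (1 - phi x)).
  split.
  - rewrite (_ : (fun x => _) = fun x => chi x - phi x * chi x).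
      by apply: testB => //; apply: testMl => //; exact: test_smooth.
    by apply/funext => x; ring.
  - move=> x; have /andP[? ?] := p01 x; have /andP[? ?] := c01 x.
    by apply/andP; split; nra.
  - by move=> x /cout ->; rewrite mul0r.
exists (fun x => chi x * (1 - phi x)) => //.
have i1 := dist_integ (measurable_indic measurableT) (mcutoff cchi) (indic01 _) c01.
have i2 := dist_integ (measurable_indic mA) (mcutoff cphi) (indic01 _) p01.
apply: le_lt_trans (_ : I (fun x => `|\1_setT x - chi x| * w x + `|\1_A x - phi x| * w x) < _).
  apply: int_le; [|exact: integD|].
    apply: dist_integ (mcutoff c') (indic01 _) _; last by case: c'.
    exact/measurable_indic/measurableC.
  move=> x; rewrite -mulrDl ler_wpM2r//.
  have -> : \1_(~` A) x = 1 - \1_A x :> R.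
    by rewrite !indicE in_setC; case: (x \in A); rewrite /= ?subrr ?subr0.
  rewrite indicT.
  have -> : 1 - \1_A x - chi x * (1 - phi x) =
    (1 - chi x) * (1 - \1_A x) + chi x * (phi x - \1_A x) by ring.
  apply: le_trans (ler_normD _ _) _; rewrite !normrM [`|phi x - _|]distrC.
  have /andP[? ?] := c01 x; have /andP[? ?] := indic01 A x.
  by apply: lerD; [rewrite ler_piMr|rewrite ler_piMl]; rewrite // ger0_norm; lra.
by rewrite intD// [ltRHS](splitr e) ltrD.
Qed.

Let approximable_setU A B : approximable A -> approximable B -> approximable (A `|` B).
Proof.
move=> [mA HA] [mB HB]; split; first exact: measurableU.
move=> e e0; have e20 : 0 < e / 2 by rewrite divr_gt0.
have [phi cphi Hphi] := HA _ e20; have [psi cpsi Hpsi] := HB _ e20.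
have [tp p01 pout] := cphi; have [tc c01 cout] := cpsi.
have c' : cutoff (fun x => phi x + psi x - phi x * psi x).
  split.
  - apply: testB; first exact: testD.
    by apply: testMl => //; exact: test_smooth.
  - move=> x; have /andP[? ?] := p01 x; have /andP[? ?] := c01 x.
    by apply/andP; split; nra.
  - by move=> x H; rewrite pout// cout// mul0r addr0 subrr.
exists (fun x => phi x + psi x - phi x * psi x) => //.
have i1 := dist_integ (measurable_indic mB) (mcutoff cpsi) (indic01 _) c01.
have i2 := dist_integ (measurable_indic mA) (mcutoff cphi) (indic01 _) p01.
apply: le_lt_trans (_ : I (fun x => `|\1_A x - phi x| * w x + `|\1_B x - psi x| * w x) < _).
  apply: int_le; [|exact: integD|].
    apply: dist_integ (mcutoff c') (indic01 _) _; last by case: c'.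
    exact/measurable_indic/measurableU.
  move=> x; rewrite -mulrDl ler_wpM2r//.
  have -> : \1_(A `|` B) x = \1_A x + \1_B x - \1_A x * \1_B x :> R.
    by rewrite !indicE in_setU; case: (x \in A); case: (x \in B); rewrite /=; ring.
  have -> : \1_A x + \1_B x - \1_A x * \1_B x - (phi x + psi x - phi x * psi x) =
    (\1_A x - phi x) * (1 - \1_B x) + (\1_B x - psi x) * (1 - phi x) by ring.
  apply: le_trans (ler_normD _ _) _; rewrite !normrM.
  have /andP[? ?] := p01 x; have /andP[? ?] := indic01 B x.
  by apply: lerD; rewrite ler_piMr// ger0_norm; lra.
by rewrite intD// [ltRHS](splitr e) ltrD.
Qed.

Let approximable_bigcup (A : nat -> set V) : (forall k, approximable (A k)) ->
  approximable (\bigcup_k A k).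
Proof.
move=> HA; have mA k : measurable (A k) by have [] := HA k.
split; first exact: bigcupT_measurable.
pose B k := \big[setU/set0]_(i < k) A i.
have HB k : approximable (B k).
  elim: k => [|k IH]; last by rewrite /B big_ord_recr; exact: approximable_setU.
  by rewrite /B big_ord0 -setCT; exact: approximable_setC.
have mB k : measurable (B k) by have [] := HB k.
move=> e e0; have e20 : 0 < e / 2 by rewrite divr_gt0.
pose F k x := `|\1_(\bigcup_k A k) x - \1_(B k) x| * w x.
have mU : mfun (\1_(\bigcup_k A k) : V -> R) by exact/measurable_indic/bigcupT_measurable.
have F_ k : integ (F k).
  exact: dist_integ.
have [|||||_ ] := @int_dct _ _ _ mu F (fun=> 0) w.
- by move=> m; exact: integ_mfun (F_ m).
- exact: measurable_cst.
- by [].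
- apply: aeW => x; rewrite /F -(mul0r (w x)); apply: cvgM; last exact: cvg_cst.
  apply: cvg_near_cst.
  have [[k _ Akx]|nA] := pselect ((\bigcup_k A k) x).
    exists k.+1 => // m /= km; rewrite !indicE mem_set; last by exists k.
    rewrite mem_set ?subrr ?normr0//.
    by rewrite /B -bigcup_mkord; exists k.
  apply: nearW => m; rewrite !indicE memNset// memNset ?subrr ?normr0//.
  by rewrite /B -bigcup_mkord => -[k _ Akx]; apply: nA; exists k.
- by apply: aeW => x m; rewrite /F normrM normr_id (ger0_norm (w0 x)) ler_piMl// dist_le1.
rewrite Rintegral_cst ?mul0r//= => /cvgr0Pnorm_lt/(_ _ e20)[k _ /(_ k (leqnn k))] /=.
rewrite ger0_norm; last by apply: int_ge0 => x; rewrite mulr_ge0.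
move=> Hk; have [_ /(_ _ e20)[phi cphi Hphi]] := HB k; exists phi => //.
have [_ p01 _] := cphi.
have i2 := dist_integ (measurable_indic (mB k)) (mcutoff cphi) (indic01 _) p01.
apply: le_lt_trans (_ : I (fun x => F k x + `|\1_(B k) x - phi x| * w x) < _).
  apply: int_le; [|exact: integD|].
    by apply: dist_integ (mcutoff cphi) (indic01 _) p01.
  by move=> x; rewrite -mulrDl ler_wpM2r// ler_distD.
by rewrite intD// [ltRHS](splitr e) ltrD.
Qed.

(** The sets whose indicators are limits, in the weighted mean on the box, of
    test functions with values in [0, 1] form a sigma-algebra that contains the
    coordinate half-spaces. *)
Lemma dense_indic (A : set V) : measurable A -> approximable A.
Proof.
move: A; suff key : g_sigma_preimage (@rV_coord R n) `<=` approximable by [].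
apply: smallest_sub.
  split.
  - by rewrite -setCT; exact: approximable_setC.
  - by move=> A HA; rewrite setTD; exact: approximable_setC.
  - exact: approximable_bigcup.
move=> A; rewrite -bigcup_seq => -[i _ [B mB <-]] /=; rewrite setTI.
suff : measurable `<=` [set B | approximable (@rV_coord R n i @^-1` B)] by apply.
rewrite [X in X `<=` _]RGenOInfty.measurableE; apply: smallest_sub.
  split.
  - by rewrite /= preimage_set0 -setCT; exact: approximable_setC.
  - by move=> C HC; rewrite /= setTD preimage_setC; exact: approximable_setC.
  - by move=> F HF; rewrite /= preimage_bigcup; exact: approximable_bigcup.
move=> _ [c ->] /=.
pose a' k := if k == i then Num.max (a k) c else a k.
apply: (@approximable_subbox _ a' b).
- by rewrite -[X in measurable X]setTI; exact: measurable_rV_coord.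
- move=> x xab; rewrite /= in_itv /= andbT; split => [cx k|/(_ i)].
    by have /andP[ak kb] := xab k; rewrite /a'; case: eqP => [->|_]; rewrite ?gt_max ?ak ?kb ?cx//;
      case: (xab i) => /andP[-> ->].
  by rewrite /a' eqxx gt_max => /andP[/andP[_ ->]].
- move=> x H k; have := H k; rewrite /a'; case: ifP => // _.
  by rewrite gt_max => /andP[/andP[-> _]].
Qed.

End weighted.

(** Testing against approximations of the indicators of [g > 0] and of its
    complement shows that [|g|] has integral zero over every cube. *)
Lemma fundamental_lemma g : mfun g ->
  (forall M, integ (fun x => \1_(@cube R n M) x * `|g x|)) ->
  (forall phi, test_function phi -> I (fun x => g x * phi x) = 0) ->
  {ae mu, forall x, g x = 0}.
Proof.
move=> mg g_ gphi.
suff H N : {ae mu, forall x, \1_(@cube R n N%:R) x * `|g x| = 0}.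
  have := ae_foralln H; apply: filterS => x Hx.
  have [N xN] : exists N : nat, `|x| < N%:R.
    by exists (Num.bound `|x|); exact: archi_boundP.
  have := Hx N; rewrite indicE mem_set ?mul1r; last exact: norm_cube.
  by move=> /eqP; rewrite normr_eq0 => /eqP.
pose c := @cube R n N%:R; pose w x : R := \1_c x * `|g x|.
have w0 x : 0 <= w x by rewrite mulr_ge0// indicE.
have mc : measurable c by exact: in_box_measurable.
have gc_ (A : set V) : measurable A -> integ (fun x => g x * (\1_A x * \1_c x)).
  move=> mA; apply: integ_dom (g_ N%:R).
    apply: measurable_funM => //.
    by apply: measurable_funM; exact: measurable_indic.
  move=> x; rewrite -/c !normrM mulrC ler_wpM2r// !indicE.
  by case: (_ \in _); case: (_ \in _); rewrite /= ?normr1 ?normr0 ?mulr0 ?mul0r ?mulr1.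
have gA (A : set V) : measurable A -> I (fun x => g x * (\1_A x * \1_c x)) = 0.
  move=> mA; apply/eqP; rewrite -normr_le0; apply/ler_addgt0Pl => e e0; rewrite addr0.
  have w_out x : ~ c x -> w x = 0 by move=> H; rewrite /w indicE memNset// mul0r.
  have [_ /(_ e e0)[phi [tphi phi01 pout] Hphi]] := dense_indic w0 w_out (g_ N%:R) mA.
  have gphi_ : integ (fun x => g x * phi x).
    apply: integ_dom (g_ N%:R).
      by apply: measurable_funM => //; exact: (mfun_smooth (test_smooth tphi)).
    move=> x; rewrite -/c normrM mulrC.
    have [cx|nc] := pselect (c x); last by rewrite pout// normr0 mul0r mulr_ge0// indicE.
    rewrite indicE mem_set// ler_wpM2r//=.
    by have /andP[p0 p1] := phi01 x; rewrite ger0_norm.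
  rewrite -[X in `|X|]subr0 -(gphi phi tphi) -intB//; last exact: gc_.
  have Z : integ (fun x => g x * (\1_A x * \1_c x) - g x * phi x) by apply: integB => //; exact: gc_.
  apply: le_trans (int_norm_le Z) _; apply: ltW; apply: le_lt_trans Hphi.
  rewrite le_eqVlt; apply/orP; left; apply/eqP; congr Rintegral; apply/funext => x.
  rewrite -mulrBr normrM mulrC /w.
  have [cx|nc] := pselect (c x); last first.
    by rewrite pout// !indicE (memNset nc) !mulr0 mul0r subr0 normr0 mul0r mulr0.
  by rewrite !indicE (mem_set cx) !mulr1 mul1r.
pose A : set V := g @^-1` `]0, +oo[.
have mA : measurable A by rewrite -[A]setTI; exact: mg.
apply: int_eq0_ae => //.
rewrite -[RHS](subrr (0 : R)) -{1}(gA A mA) -(gA (~` A) (measurableC mA)).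
rewrite -intB; [|exact: gc_|by apply: gc_; exact: measurableC].
congr Rintegral; apply/funext => x; rewrite -mulrBr.
have -> : \1_(~` A) x = 1 - \1_A x :> R.
  by rewrite !indicE in_setC; case: (x \in A); rewrite /= ?subrr ?subr0.
rewrite -mulrBl [\1_A x]indicE.
have AE : A x <-> 0 < g x by rewrite /A /= in_itv /= andbT.
have [Ax|nAx] := pselect (A x).
  by rewrite (mem_set Ax) (gtr0_norm (AE.1 Ax)) /= -/c; ring.
rewrite (memNset nAx) ler0_norm /=; last by rewrite leNgt; apply/negP => /AE.
by ring.
Qed.

Let approx2 f := L2 mu f /\ forall e, 0 < e ->
  exists2 phi, test_function phi & I (fun x => (phi x - f x) ^+ 2) < e.

Let approx2_lim F f : cvg2 mu F f -> (forall m, approx2 (F m)) -> approx2 f.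
Proof.
move=> [F_ f_ Ff] HF; split => // e e0.
have e40 : 0 < e / 4 by rewrite divr_gt0.
have /cvgr0Pnorm_lt/(_ _ e40)[m _ /(_ m (leqnn m)) /= Hm] := Ff.
have [_ /(_ _ e40)[phi tphi Hphi]] := HF m; exists phi => //.
have p_ := L2_test tphi.
have i1 := integ_sq (L2B p_ (F_ m)); have i2 := integ_sq (L2B (F_ m) f_).
apply: (@le_lt_trans _ _ (I (fun x => 2 * ((phi x - F m x) ^+ 2 + (F m x - f x) ^+ 2)))).
  apply: int_le; [exact/integ_sq/L2B|by apply/integZ/integD|].
  move=> x; rewrite -[phi x - f x](subrKA (F m x)); exact: sqrD_le.
rewrite intZ ?intD//; last exact: integD.
rewrite ger0_norm in Hm; last by apply: int_ge0 => x; exact: sqr_ge0.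
by move: Hphi Hm; lra.
Qed.

Let approx2D f g : approx2 f -> approx2 g -> approx2 (fun x => f x + g x).
Proof.
move=> [f_ Hf] [g_ Hg]; split; first exact: L2D.
move=> e e0; have e40 : 0 < e / 4 by rewrite divr_gt0.
have [phi tphi Hphi] := Hf _ e40; have [psi tpsi Hpsi] := Hg _ e40.
exists (fun x => phi x + psi x); first exact: testD.
have p_ := L2_test tphi; have q_ := L2_test tpsi.
have i1 := integ_sq (L2B p_ f_); have i2 := integ_sq (L2B q_ g_).
apply: (@le_lt_trans _ _ (I (fun x => 2 * ((phi x - f x) ^+ 2 + (psi x - g x) ^+ 2)))).
  apply: int_le; [by apply/integ_sq/L2B; exact: L2D|by apply/integZ/integD|].
  move=> x; rewrite (_ : phi x + psi x - (f x + g x) = (phi x - f x) + (psi x - g x)); last by ring.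
  exact: sqrD_le.
rewrite intZ ?intD//; last exact: integD.
by move: Hphi Hpsi; lra.
Qed.

Let approx2Z c f : approx2 f -> approx2 (fun x => c * f x).
Proof.
move=> [f_ Hf]; split; first exact: L2Z.
move=> e e0; have e40 : 0 < e / (c ^+ 2 + 1) by rewrite divr_gt0// ltr_wpDl// sqr_ge0.
have [phi tphi Hphi] := Hf _ e40; exists (fun x => c * phi x); first exact: testZ.
have i1 := integ_sq (L2B (L2_test tphi) f_).
rewrite (_ : (fun x => _) = fun x => c ^+ 2 * (phi x - f x) ^+ 2); last first.
  by apply/funext => x; ring.
rewrite intZ//; move: Hphi; rewrite ltr_pdivlMr ?ltr_wpDl ?sqr_ge0//.
have : 0 <= I (fun x => (phi x - f x) ^+ 2) by apply: int_ge0 => x; exact: sqr_ge0.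
by lra.
Qed.

Let approx2_sum (J : Type) (s : seq J) (F : J -> V -> R) : (forall i, approx2 (F i)) ->
  approx2 (fun x => \sum_(i <- s) F i x).
Proof.
move=> HF; elim: s => [|i s IH].
  rewrite (_ : (fun x => _) = fun x => 0 * (0 : R)); last first.
    by apply/funext => x; rewrite big_nil mul0r.
  apply: approx2Z; split; first exact: L20.
  move=> e e0; exists (fun=> 0); first exact: test0.
  by rewrite (_ : (fun x => _) = fun=> 0) ?Rintegral_cst ?mul0r//; apply/funext => x; rewrite subrr expr0n.
rewrite (_ : (fun x => _) = fun x => F i x + \sum_(i <- s) F i x); first exact: approx2D.
by apply/funext => x; rewrite big_cons.
Qed.

Let approx2_indic (A : set V) (M : R) : measurable A -> approx2 (fun x => \1_A x * \1_(@cube R n M) x).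
Proof.
move=> mA; pose c := @cube R n M; have mc : measurable c by exact: in_box_measurable.
have c_ : integ (\1_c : V -> R).
  by apply: indic_integ => //; exact: in_box_finite.
have m1 : mfun (fun x => \1_A x * \1_c x) by apply: measurable_funM; exact: measurable_indic.
split.
  split=> //; apply: integ_dom c_; first exact: measurable_funX.
  move=> x; rewrite !indicE; case: (_ \in _); case: (_ \in _);
    by rewrite /= ?(mul1r, mul0r, mulr0, expr1n, expr0n) /= ?normr1 ?normr0.
move=> e e0.
have c0 x : 0 <= (\1_c x : R) by rewrite indicE.
have c_out x : ~ c x -> (\1_c x : R) = 0 by move=> H; rewrite indicE memNset.
have [_ /(_ e e0)[phi [tphi phi01 pout] Hphi]] := dense_indic c0 c_out c_ mA.
exists phi => //; apply: le_lt_trans Hphi.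
have bound x : (phi x - \1_A x * \1_c x) ^+ 2 <= `|\1_A x - phi x| * \1_c x.
  have [cx|nc] := pselect (c x); last first.
    by rewrite pout// !indicE (memNset nc) !mulr0 subr0 expr0n.
  rewrite !indicE (mem_set cx) !mulr1 distrC -(real_normK (num_real (phi x - _))) expr2.
  rewrite ler_piMr//; have /andP[? ?] := phi01 x.
  by case: (x \in A); rewrite /= ler_norml; apply/andP; split; lra.
apply: int_le => //.
  apply: integ_dom c_.
    by apply: measurable_funX; apply: measurable_funB => //; exact: (mfun_smooth (test_smooth tphi)).
  move=> x; rewrite ger0_norm ?sqr_ge0//; apply: le_trans (bound x) _.
  rewrite ler_piMl//; have /andP[? ?] := phi01 x; rewrite indicE.
  by case: (x \in A); rewrite /= ler_norml; apply/andP; split; lra.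
apply: integ_dom c_.
  apply: measurable_funM; last exact: measurable_indic.
  apply: measurableT_comp => //; apply: measurable_funB; first exact: measurable_indic.
  exact: (mfun_smooth (test_smooth tphi)).
move=> x; rewrite normrM normr_id (ger0_norm (c0 x)) ler_piMl//.
have /andP[? ?] := phi01 x; rewrite indicE.
by case: (x \in A); rewrite /= ler_norml; apply/andP; split; lra.
Qed.

Let approx2_ge0 f : L2 mu f -> (forall x, 0 <= f x) -> approx2 f.
Proof.
move=> f_ f0; have mf := L2_mfun f_.
have mE : measurable_fun setT (EFin \o f) by exact/measurable_EFinP.
pose g := nnsfun_approx measurableT mE.
have gf x : (fun m => g m x) @ \oo --> f x.
  have : (fun m => (g m x)%:E) @ \oo --> (f x)%:E.
    by apply: cvg_nnsfun_approx => // y _; rewrite /= lee_fin.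
  by move/fine_cvg.
have gle m x : g m x <= f x.
  rewrite -(cvg_lim _ (gf x))//; apply: nondecreasing_cvgn_le.
    by move=> p q pq; exact/lefP/nd_nnsfun_approx.
  by apply/cvg_ex; exists (f x).
pose F m x := g m x * \1_(@cube R n m%:R) x.
have F0 m x : 0 <= F m x <= f x.
  rewrite /F indicE; case: (_ \in _); rewrite /= ?mulr1 ?mulr0 ?lexx ?f0//.
  by rewrite gle fun_ge0.
have AF m : approx2 (F m).
  have [s sE] : exists s : seq R, forall x, g m x = \sum_(y <- s) y * \1_(g m @^-1` [set y]) x.
    by eexists => x; rewrite fimfunE fsbig_finite//; reflexivity.
  rewrite (_ : F m = fun x => \sum_(y <- s) y *
      (\1_(g m @^-1` [set y]) x * \1_(@cube R n m%:R) x)).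
    by apply: approx2_sum => y; apply: approx2Z; exact: approx2_indic.
  by apply/funext => x; rewrite /F sE mulr_suml; apply: eq_bigr => y _; rewrite mulrA.
apply: (approx2_lim _ AF); split => //; first by move=> m; have [] := AF m.
have F_ m : L2 mu (F m) by have [] := AF m.
have [|||||_ ] := @int_dct _ _ _ mu (fun m x => (F m x - f x) ^+ 2) (fun=> 0) (fun x => f x ^+ 2).
- by move=> m; exact: integ_mfun (integ_sq (L2B (F_ m) f_)).
- exact: measurable_cst.
- exact: integ_sq.
- apply: aeW => x; rewrite [X in _ --> X](_ : _ = (f x - f x) ^+ 2); last by rewrite subrr expr0n.
  have D : (fun m => F m x - f x) @ \oo --> f x - f x.
    apply: cvgB; last exact: cvg_cst.
    rewrite -[f x in X in _ --> X]mulr1; apply: cvgM; first exact: gf.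
    apply: cvg_near_cst; exists (Num.bound `|x|) => // m /= xm.
    rewrite indicE mem_set//; apply: norm_cube.
    apply: (@lt_le_trans _ _ (Num.bound `|x|)%:R); first exact: archi_boundP.
    by rewrite ler_nat.
  by under eq_fun do rewrite expr2; rewrite expr2; exact: cvgM.
- apply: aeW => x m; rewrite ger0_norm ?sqr_ge0//.
  have /andP[? ?] := F0 m x; rewrite -[leLHS]sqrrN lerXn2r ?nnegrE//; lra.
by rewrite Rintegral_cst ?mul0r.
Qed.

(** A nonnegative function is the limit of simple functions supported in cubes, whose
    level sets have approximable indicators. *)
Lemma L2_dense f : L2 mu f -> forall e, 0 < e ->
  exists2 phi, test_function phi & I (fun x => (phi x - f x) ^+ 2) < e.
Proof.
move=> f_; have mf := L2_mfun f_.
pose p x := Num.max (f x) 0; pose q x := Num.max (- f x) 0.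
have p_ : L2 mu p.
  apply: L2_dom f_; first by apply: measurable_maxr => //; exact: measurable_cst.
  by move=> x; rewrite /p; case: (leP (f x) 0) => H; rewrite ?normr0.
have q_ : L2 mu q.
  apply: L2_dom f_.
    by apply: measurable_maxr; [exact: measurableT_comp|exact: measurable_cst].
  by move=> x; rewrite /q; case: (leP (- f x) 0) => H; rewrite ?normr0 ?normrN.
have Hp : approx2 p by apply: approx2_ge0 => // x; rewrite le_max lexx orbT.
have Hq : approx2 q by apply: approx2_ge0 => // x; rewrite le_max lexx orbT.
have [_ H] := approx2D Hp (approx2Z (-1) Hq).
move=> e e0; have [phi tphi] := H e e0; exists phi => //.
suff <- : (fun x => p x + -1 * q x) = f by [].
apply/funext => x; rewrite /p /q.
by case: (leP (f x) 0) => H1; case: (leP (- f x) 0) => H2; lra.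
Qed.

End density.

(** * Convolution with test functions *)

Section convolution.
Context (R : realType) (n : nat).
Implicit Types (f g k phi psi : 'rV[R]_n -> R) (j : 'I_n).
Local Notation mu := (lebesgue_rV R n).
Local Notation integ f := (mu.-integrable setT (EFin \o f)).
Local Notation mfun f := (measurable_fun setT (f : 'rV[R]_n -> R)).
Local Notation I f := (\int[mu]_x f x).
Local Notation V := 'rV[R]_n.
Local Notation e_ j := (delta_mx ord0 j : 'rV[R]_n).

Definition convol f k (x : V) : R := I (fun y => f y * k (x - y)).

Lemma smooth_reflect k (x : V) : smooth k -> smooth (fun y => k (x - y)).
Proof.
move=> sk; rewrite (_ : (fun y => _) = fun y => k ((-1) *: y + x)).
  exact: smooth_affine.
by apply/funext => y; rewrite scaleN1r addrC.
Qed.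

Lemma partial_reflect k (x : V) j : smooth k ->
  partial j (fun y => k (x - y)) = fun y => - partial j k (x - y).
Proof.
move=> sk; rewrite (_ : (fun y => k _) = fun y => k ((-1) *: y + x)).
  by rewrite partial_affine//; apply/funext => y; rewrite mulN1r scaleN1r addrC.
by apply/funext => y; rewrite scaleN1r addrC.
Qed.

Lemma test_reflect k (x : V) : test_function k -> test_function (fun y => k (x - y)).
Proof.
move=> /test_functionP[sk [M sM]]; apply/test_functionP; split; first exact: smooth_reflect.
exists (M + `|x|) => y My; apply: sM.
have := ler_normB x (x - y); rewrite opprB addrC subrK => H.
by move: My; rewrite -ltrBrDr => /lt_le_trans; apply; lra.
Qed.

Lemma conv_integ f k x : L2 mu f -> test_function k -> integ (fun y => f y * k (x - y)).
Proof. by move=> f_ tk; apply: integM => //; apply: L2_test; exact: test_reflect. Qed.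

(* A majorant for all convolutions of [f] with kernels supported in the cube. *)
Let J M f x := I (fun y => `|f y| * \1_(@cube R n M) (x - y)).

Let L2_cube M x : L2 mu (fun y => \1_(@cube R n M) (x - y) : R).
Proof.
have i1 : integ (\1_(@cube R n M) : V -> R).
  by apply: indic_integ; [exact: in_box_measurable|exact: in_box_finite].
split; first by apply: (@mfun_reflect R n x (\1_(@cube R n M))); exact: integ_mfun i1.
have := @integ_reflect R n x (\1_(@cube R n M)) i1.
apply: eq_integrable => // y _ /=; rewrite indicE.
by case: (_ \in _); rewrite /= ?expr1n ?expr0n.
Qed.

Let L2_abs f : L2 mu f -> L2 mu (fun x => `|f x|).
Proof.
move=> f_; apply: (L2_dom _ _ f_); last by move=> x; rewrite normr_id.
by apply: measurableT_comp => //; exact: L2_mfun f_.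
Qed.

Let J_integ M f x : L2 mu f -> integ (fun y => `|f y| * \1_(@cube R n M) (x - y)).
Proof. by move=> f_; apply: integM; [exact: L2_abs|exact: L2_cube]. Qed.

Let conv_bound f (r : V -> R) M (c : R) x : L2 mu f -> mfun r -> 0 <= c ->
  (forall z, `|r z| <= c) -> supp_in M r ->
  `|I (fun y => f y * r (x - y))| <= c * J (M + 1) f x.
Proof.
move=> f_ mr c0 rc sM; have mf := L2_mfun f_.
have J_ := J_integ (M + 1) x f_.
have B y : `|f y * r (x - y)| <= c * (`|f y| * \1_(@cube R n (M + 1)) (x - y)).
  rewrite normrM mulrCA indicE; apply: ler_wpM2l => //.
  have [H|H] := leP `|x - y| M; last by rewrite sM// normr0 mulr_ge0.
  by rewrite mem_set ?mulr1//; apply: norm_cube; rewrite (le_lt_trans H)// ltrDl.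
have i1 : integ (fun y => f y * r (x - y)).
  apply: integ_dom (integZ c J_) => //.
  by apply: measurable_funM => //; exact: mfun_reflect.
apply: le_trans (int_norm_le i1) _; rewrite /J -intZ//.
by apply: int_le => //; [exact: integ_norm|exact: integZ].
Qed.

Lemma smooth_taylor k j (C : R) : smooth k ->
  (forall z, `|partial j (partial j k) z| <= C) ->
  forall z t, `|k (t *: e_ j + z) - k z - t * partial j k z| <= C * t ^+ 2.
Proof.
move=> sk HC z t; have C0 : 0 <= C by apply: le_trans (HC 0).
have [s st ->] : exists2 s, `|s| <= `|t| &
    k (t *: e_ j + z) - k z = t * partial j k (s *: e_ j + z).
  have [t0|t0] := leP 0 t.
    have [s /andP[s0 st] ->] := smooth_MVT j z sk t0.
    by exists s => //; rewrite !ger0_norm.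
  have nt0 : 0 <= - t by rewrite oppr_ge0 ltW.
  have [s /andP[s0 st]] := smooth_MVT j (t *: e_ j + z) sk nt0.
  rewrite addrA -scalerDl addNr scale0r add0r addrA -scalerDl => E.
  exists (s + t); last by rewrite -[LHS]opprB E mulNr opprK.
  by rewrite (ltr0_norm t0) ler_norml; apply/andP; split; lra.
rewrite -mulrBr normrM expr2 mulrC.
apply: (@le_trans _ _ (C * `|s| * `|t|)).
  rewrite ler_wpM2r//.
  exact: (smooth_axis_lipschitz (smooth_partial j sk) HC).
rewrite -mulrA ler_wpM2l// -[t * t]ger0_norm -?expr2 ?sqr_ge0// normrX expr2.
by rewrite ler_wpM2r.
Qed.

(** By Taylor's formula for [k], the error of the difference quotient is the
    convolution of [f] with a kernel of size [O(t^2)] and fixed support. *)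
Lemma is_derive_conv f k j x : L2 mu f -> test_function k ->
  is_derive x (e_ j) (convol f k) (convol f (partial j k) x).
Proof.
move=> f_ tk; have tjk := test_partial j tk.
have [C C0 HC] := test_bounded (test_partial j tjk).
have /test_functionP[sk [M sM]] := tk.
pose K := C * J (M + 1 + 1) f x.
have K0 : 0 <= K.
  by rewrite mulr_ge0//; apply: int_ge0 => y; rewrite mulr_ge0// indicE.
have Q t : `|t| <= 1 -> `|convol f k (t *: e_ j + x) - convol f k x - t * convol f (partial j k) x|
    <= t ^+ 2 * K.
  move=> t1.
  have i1 := conv_integ (t *: e_ j + x) f_ tk; have i2 := conv_integ x f_ tk.
  have i3 := conv_integ x f_ tjk.
  rewrite /convol -intZ// -intB// -intB//; [|exact: integB|exact: integZ].
  pose r z := k (t *: e_ j + z) - k z - t * partial j k z.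
  rewrite (_ : (fun y => _) = fun y => f y * r (x - y)); last first.
    by apply/funext => y; rewrite /r addrA; ring.
  rewrite /K mulrA [_ * C]mulrC; apply: conv_bound => //.
  - have sr : smooth r.
      apply: smoothB; last by apply: smoothZ; exact: smooth_partial.
      apply: (smoothB _ sk).
      rewrite (_ : (fun x => _) = fun z => k (1 *: z + t *: e_ j)).
        exact: smooth_affine.
      by apply/funext => z; rewrite scale1r addrC.
    exact: mfun_smooth.
  - by rewrite mulr_ge0// sqr_ge0.
  - by move=> z; exact: (smooth_taylor sk HC).
  - move=> z Mz; rewrite /r.
    have Mz' : M < `|z| by apply: lt_trans Mz; rewrite ltrDl.
    rewrite (supp_in_partial j sM Mz') (sM z Mz') (sM (_ + _)) ?mulr0 ?subrr//.
    have := ler_normB (t *: e_ j + z) (t *: e_ j); rewrite [_ + z]addrC addrK.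
    have : `|t *: e_ j| <= 1 by rewrite normrZ mulr_ile1// norm_delta_le1.
    by move: Mz; lra.
have H : (fun h : R => h^-1 *: (convol f k (h *: e_ j + x) - convol f k x)) @ 0^' -->
    convol f (partial j k) x.
  apply/cvgrPdist_le => e e0; near=> h.
  have h0 : h != 0 by near: h; exact: nbhs_dnbhs_neq.
  have h1 : `|h| < Num.min 1 (e / (K + 1)).
    near: h; apply: dnbhs0_lt; rewrite lt_min ltr01/= divr_gt0// ltr_wpDl//.
  move: h1; rewrite lt_min => /andP[h1 h2].
  rewrite distrC /GRing.scale /=.
  have -> : h^-1 * (convol f k (h *: e_ j + x) - convol f k x) - convol f (partial j k) x =
     h^-1 * (convol f k (h *: e_ j + x) - convol f k x - h * convol f (partial j k) x).
    by rewrite [RHS]mulrBr mulKf.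
  rewrite normrM normfV ler_pdivrMl ?normr_gt0//.
  apply: le_trans (Q h (ltW h1)) _.
  rewrite -[h ^+ 2]ger0_norm ?sqr_ge0// normrX expr2 -mulrA ler_wpM2l//.
  apply: (@le_trans _ _ (`|h| * (K + 1))); first by rewrite ler_wpM2l// lerDl.
  by rewrite -ler_pdivlMr ?ltr_wpDl// ltW.
split; first by apply/cvg_ex; exists (convol f (partial j k) x).
exact: cvg_lim.
Unshelve. all: by end_near. Qed.

Lemma continuous_conv f k : L2 mu f -> test_function k -> continuous (convol f k).
Proof.
move=> f_ tk x.
have [C C0 HC] := test_lipschitz tk.
have /test_functionP[sk [M sM]] := tk.
pose K := C * J (M + 1 + 1) f x.
have K0 : 0 <= K.
  by rewrite !mulr_ge0//; apply: int_ge0 => y; rewrite mulr_ge0// indicE.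
have Q v : `|v| <= 1 -> `|convol f k (v + x) - convol f k x| <= `|v| * K.
  move=> v1.
  have i1 := conv_integ (v + x) f_ tk; have i2 := conv_integ x f_ tk.
  rewrite /convol -intB//.
  pose r z := k (v + z) - k z.
  rewrite (_ : (fun y => _) = fun y => f y * r (x - y)); last first.
    by apply/funext => y; rewrite /r addrA; ring.
  rewrite /K mulrA; apply: conv_bound => //.
  - have sr : smooth r.
      apply: (smoothB _ sk).
      rewrite (_ : (fun x => _) = fun z => k (1 *: z + v)).
        exact: smooth_affine.
      by apply/funext => z; rewrite scale1r addrC.
    exact: mfun_smooth.
  - by rewrite !mulr_ge0.
  - by move=> z; apply: le_trans (HC z (v + z)) _; rewrite addrK mulrC.
  - move=> z Mz; rewrite /r.
    have Mz' : M < `|z| by apply: lt_trans Mz; rewrite ltrDl.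
    rewrite (sM z)// (sM (_ + _)) ?subrr//.
    have := ler_normB (v + z) v; rewrite [_ + z]addrC addrK.
    by move: Mz; lra.
move=> A /nbhs_ballP[e /= e0 eA]; apply/nbhs_ballP.
exists (Num.min 1 (e / (K + 1))) => /=.
  by rewrite lt_min ltr01/= divr_gt0// ltr_wpDl.
move=> y; rewrite -ball_normE /= lt_min distrC => /andP[h1 h2].
apply: eA; rewrite -ball_normE /= distrC.
have := Q (y - x) (ltW h1); rewrite subrK => /le_lt_trans; apply.
apply: (@le_lt_trans _ _ (`|y - x| * (K + 1))); first by rewrite ler_wpM2l// lerDl.
by rewrite -ltr_pdivlMr// ltr_wpDl.
Qed.

Lemma partial_conv f k j : L2 mu f -> test_function k ->
  partial j (convol f k) = convol f (partial j k).
Proof. by move=> f_ tk; apply: partial_eq => x; exact: is_derive_conv. Qed.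

Lemma smooth_conv f k : L2 mu f -> test_function k -> smooth (convol f k).
Proof.
move=> f_ tk; apply: (@smooth_coind _ _ (fun G => exists2 k, test_function k & G = convol f k)).
  move=> _ [l tl ->]; split; first exact: continuous_conv.
  move=> j; split; first by move=> x; have [] := is_derive_conv j x f_ tl.
  by rewrite partial_conv//; exists (partial j l) => //; exact: test_partial.
by exists k.
Qed.

(** Young's inequality, from Cauchy-Schwarz for the weight [|k(x - y)|] and
    Tonelli. *)
Lemma conv_young f k : L2 mu f -> test_function k ->
  L2 mu (convol f k) /\
  I (fun x => convol f k x ^+ 2) <= I (fun z => `|k z|) ^+ 2 * I (fun x => f x ^+ 2).
Proof.
move=> f_ tk; set c := I (fun z => `|k z|).
have k_ : integ (fun z => `|k z|) by apply: integ_norm; exact: integ_test.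
have c0 : 0 <= c by apply: int_ge0.
have mf := L2_mfun f_; have mk := mfun_smooth (test_smooth tk).
have [C C0 HC] := test_bounded tk.
have sq k' x : L2 mu k' -> L2 mu (fun y => k' y * Num.sqrt `|k (x - y)|).
  move=> k'_; rewrite (_ : (fun y => _) = fun y => Num.sqrt `|k (x - y)| * k' y); last first.
    by apply/funext => y; rewrite mulrC.
  apply: (@L2_mulb _ _ _ _ (Num.sqrt C)) k'_.
    apply: (@measurableT_comp _ _ _ _ _ _ (@Num.sqrt R)).
      by apply: continuous_measurable_fun; exact: sqrt_continuous.
    by apply: measurableT_comp => //; exact: mfun_reflect.
  by move=> y; rewrite ger0_norm ?sqrtr_ge0//; exact: ler_wsqrtr.
have sqk x : L2 mu (fun y => Num.sqrt `|k (x - y)|).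
  split.
    apply: (@measurableT_comp _ _ _ _ _ _ (@Num.sqrt R)).
      by apply: continuous_measurable_fun; exact: sqrt_continuous.
    by apply: measurableT_comp => //; exact: mfun_reflect.
  have := integ_reflect x k_; apply: eq_integrable => // y _ /=.
  by rewrite sqr_sqrtr.
have fk_ x : integ (fun y => f y ^+ 2 * `|k (x - y)|).
  have [_] := sq f x f_; apply: eq_integrable => // y _ /=.
  by rewrite exprMn sqr_sqrtr.
have B x : convol f k x ^+ 2 <= c * I (fun y => f y ^+ 2 * `|k (x - y)|).
  have H := cauchy_schwarz (sq _ x (L2_abs f_)) (sqk x).
  apply: (@le_trans _ _ (I (fun y => `|f y| * Num.sqrt `|k (x - y)| * Num.sqrt `|k (x - y)|) ^+ 2)).
    have i1 := conv_integ x f_ tk.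
    rewrite -(real_normK (num_real (convol f k x))) lerXn2r ?nnegrE//.
      by apply: int_ge0 => y; rewrite !mulr_ge0 ?sqrtr_ge0.
    apply: le_trans (int_norm_le i1) _; rewrite le_eqVlt; apply/orP; left; apply/eqP.
    by congr Rintegral; apply/funext => y; rewrite -mulrA -expr2 sqr_sqrtr// normrM.
  apply: le_trans H _; rewrite mulrC; apply: ler_pM.
  - by apply: int_ge0 => y; exact: sqr_ge0.
  - by apply: int_ge0 => y; exact: sqr_ge0.
  - rewrite (_ : (fun y => _) = fun y => `|k (x - y)|); last first.
      by apply/funext => y; rewrite sqr_sqrtr.
    by rewrite (@int_reflect R n x (fun z => `|k z|))//; exact: integ_mfun k_.
  - rewrite le_eqVlt; apply/orP; left; apply/eqP; congr Rintegral.
    by apply/funext => y; rewrite exprMn sqr_sqrtr// real_normK ?num_real.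
pose Phi (p : V * V) : \bar R := (f p.2 ^+ 2 * `|k (p.1 - p.2)|)%:E.
have mPhi : measurable_fun setT Phi.
  apply/measurable_EFinP; apply: measurable_funM.
    by apply: measurable_funX; exact: measurableT_comp.
  apply: measurableT_comp => //; apply: (@measurableT_comp _ _ _ _ _ _ k) => //.
  apply: measurable_fun_rVP => i.
  rewrite (_ : _ \o _ = fun p : V * V => rV_coord i p.1 - rV_coord i p.2).
    by apply: measurable_funB; apply: measurableT_comp => //; exact: measurable_rV_coord.
  by apply/funext => p; rewrite /rV_coord /= !mxE.
have Phi0 p : (0 <= Phi p)%E by rewrite lee_fin mulr_ge0// sqr_ge0.
have mF : measurable_fun setT (fun x => \int[mu]_y Phi (x, y))%E.
  exact: measurable_fun_fubini_tonelli_F.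
have FE x : (\int[mu]_y Phi (x, y) = (I (fun y => f y ^+ 2 * `|k (x - y)|))%:E)%E.
  by rewrite -integE.
have tot : (\int[mu]_x (I (fun y => f y ^+ 2 * `|k (x - y)|))%:E = (c * I (fun x => f x ^+ 2))%:E)%E.
  under eq_integral do rewrite -FE.
  rewrite (fubini_tonelli Phi)//.
  transitivity (\int[mu]_y (c * f y ^+ 2)%:E)%E.
    apply: eq_integral => y _.
    have shE : (fun x => `|k (x - y)|) = (fun x => (fun z => `|k z|) (- y + x)).
      by apply/funext => x; rewrite addrC.
    have ish : integ (fun x => `|k (x - y)|) by rewrite shE; exact: (integ_shift (- y) k_).
    transitivity ((\int[mu]_x (f y ^+ 2 * `|k (x - y)|)%:E))%E; first by [].
    rewrite integE; last exact: integZ.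
    rewrite intZ// shE (int_shift (- y) (integ_mfun k_)) mulrC//.
  rewrite integE ?intZ//; [exact: integ_sq|exact/integZ/integ_sq].
have h_ : integ (fun x => I (fun y => f y ^+ 2 * `|k (x - y)|)).
  apply: integ_ge0P.
  - by apply/measurable_EFinP; apply: eq_measurable_fun mF => x _; rewrite FE.
  - by move=> x; apply: int_ge0 => y; rewrite mulr_ge0// sqr_ge0.
  - by rewrite tot ltry.
have mc : mfun (convol f k) by apply: mfun_smooth; exact: smooth_conv.
have c_ : L2 mu (convol f k).
  split => //; apply: integ_dom (integZ c h_); first exact: measurable_funX.
  by move=> x; rewrite ger0_norm ?sqr_ge0.
split => //.
apply: (@le_trans _ _ (I (fun x => c * I (fun y => f y ^+ 2 * `|k (x - y)|)))).
  by apply: int_le => //; [exact: integ_sq|exact: integZ].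
rewrite intZ// expr2 -mulrA ler_wpM2l//.
by rewrite -lee_fin -integE// tot.
Qed.

End convolution.

(** * Test functions are dense for the graph norm of the Laplacian *)

Section laplacian_density.
Context (R : realType) (n : nat).
Implicit Types (f g h k phi psi : 'rV[R]_n -> R) (j a b : 'I_n).
Local Notation mu := (lebesgue_rV R n).
Local Notation integ f := (mu.-integrable setT (EFin \o f)).
Local Notation mfun f := (measurable_fun setT (f : 'rV[R]_n -> R)).
Local Notation I f := (\int[mu]_x f x).
Local Notation V := 'rV[R]_n.

Local Opaque partial.

Definition bump (d : R) : V -> R := box_bump 1 (fun=> - d) (fun=> d).

Lemma test_bump d : test_function (bump d). Proof. exact: test_box_bump. Qed.

Lemma bump_out d x : 0 < d -> d < `|x| -> bump d x = 0.
Proof.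
move=> d0 dx; apply: box_bump_out => // xd; move: dx; rewrite ltNge => /negP; apply.
rewrite /Num.norm /= mx_normrE; apply: bigmax_le; first exact: ltW.
by move=> [i j] _ /=; rewrite (ord1 i) ler_norml; have /andP[/ltW -> /ltW ->] := xd j.
Qed.

Lemma int_bump_gt0 d : 0 < d -> 0 < I (bump d).
Proof.
move=> d0; have b0 x : 0 <= bump d x by exact: box_bump_ge0.
rewrite lt_neqAle int_ge0// andbT; apply/negP => /eqP/esym I0.
have [N [mN N0 sN]] := int_eq0_ae (integ_test (test_bump d)) b0 I0.
have : (0 < mu (in_box (fun=> (- d)%R) (fun=> d)))%E.
  by apply: in_box_positive => _; rewrite gtrN.
rewrite ltNge => /negP; apply; rewrite -N0; apply: le_measure; rewrite ?inE//.
  exact: in_box_measurable.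
move=> x xd; apply: sN => /= x0.
by have := box_bump_gt0 (@ltr01 R) xd; rewrite -/(bump d x) x0 ltxx.
Qed.

Definition mollifier (m : nat) (x : V) : R := (I (bump m.+1%:R^-1))^-1 * bump m.+1%:R^-1 x.

Let d_gt0 m : 0 < m.+1%:R^-1 :> R. Proof. by rewrite invr_gt0. Qed.

Lemma test_mollifier m : test_function (mollifier m).
Proof. by apply: testZ; exact: test_bump. Qed.

Lemma mollifier_ge0 m x : 0 <= mollifier m x.
Proof. by rewrite mulr_ge0 ?box_bump_ge0// invr_ge0 ltW// int_bump_gt0. Qed.

Lemma mollifier_out m x : m.+1%:R^-1 < `|x| -> mollifier m x = 0.
Proof. by move=> H; rewrite /mollifier bump_out ?mulr0. Qed.

Lemma int_mollifier m : I (mollifier m) = 1.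
Proof.
by rewrite intZ ?mulVf ?gt_eqF ?int_bump_gt0//; exact: integ_test (test_bump _).
Qed.

Let conv_mollifier_test phi : test_function phi ->
  (fun m => I (fun x => (convol phi (mollifier m) x - phi x) ^+ 2)) @ \oo --> (0 : R).
Proof.
move=> tp; have [L L0 HL] := test_lipschitz tp.
have /test_functionP[sp [M sM]] := tp.
have p_ := L2_test tp.
pose c : R := I (\1_(@cube R n (M + 2)) : V -> R).
have i1 : integ (\1_(@cube R n (M + 2)) : V -> R).
  by apply: indic_integ; [exact: in_box_measurable|exact: in_box_finite].
have lim : (fun m => L ^+ 2 * c * m.+1%:R^-1 * m.+1%:R^-1) @ \oo --> L ^+ 2 * c * 0 * (0 : R).
  apply: cvgM; last exact: cvg_harmonic.
  by apply: cvgM; [exact: cvg_cst|exact: cvg_harmonic].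
rewrite mulr0 in lim; apply: squeeze_cvgr lim; last exact: cvg_cst.
apply: nearW => m; apply/andP; split; first by apply: int_ge0 => x; exact: sqr_ge0.
set d : R := m.+1%:R^-1; have d0 : 0 < d by exact: d_gt0.
have d1 : d <= 1 by rewrite /d invf_le1// ler1n.
have tm := test_mollifier m.
have B x : (convol phi (mollifier m) x - phi x) ^+ 2 <= (L * d) ^+ 2 * \1_(@cube R n (M + 2)) x.
  have i2 := conv_integ x p_ tm.
  have i3 : integ (fun y => mollifier m (x - y)).
    by apply: integ_reflect; exact: integ_test.
  have n1 : I (fun y => mollifier m (x - y)) = 1.
    by rewrite (int_reflect x (integ_mfun (integ_test tm))) int_mollifier.
  have E : convol phi (mollifier m) x - phi x = I (fun y => (phi y - phi x) * mollifier m (x - y)).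
    rewrite (_ : (fun y => (phi y - phi x) * _) =
        fun y => phi y * mollifier m (x - y) - phi x * mollifier m (x - y)); last first.
      by apply/funext => y; rewrite mulrBl.
    by rewrite (intB i2 (integZ _ i3)) (intZ _ i3) n1 mulr1.
  have i4 : integ (fun y => (phi y - phi x) * mollifier m (x - y)).
    have := integB i2 (integZ (phi x) i3); apply: eq_integrable => // y _ /=.
    by rewrite mulrBl.
  have bd : `|convol phi (mollifier m) x - phi x| <= L * d.
    rewrite E; apply: le_trans (int_norm_le i4) _.
    rewrite -[leRHS]mulr1 -n1 -intZ//.
    apply: int_le; [exact: integ_norm|exact: integZ|move=> y].
    rewrite normrM (ger0_norm (mollifier_ge0 _ _)).
    have [H|H] := leP `|x - y| d; last by rewrite mollifier_out// !mulr0.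
    rewrite ler_wpM2r ?mollifier_ge0//; apply: le_trans (HL x y) _.
    by rewrite ler_wpM2l// distrC.
  rewrite indicE; have [xM|xM] := boolP (x \in _).
    rewrite mulr1 -[leLHS]ger0_norm ?sqr_ge0// normrX lerXn2r// ?nnegrE ?mulr_ge0//.
    exact: ltW.
  have Mx : M + 2 <= `|x|.
    by rewrite leNgt; apply/negP => /norm_cube/mem_set H; rewrite H in xM.
  rewrite mulr0 (sM x); last by rewrite (lt_le_trans _ Mx)// ltrDl.
  rewrite subr0 [convol _ _ _](_ : _ = 0) ?expr0n//.
  rewrite /convol (_ : (fun y => _) = fun=> 0) ?Rintegral_cst ?mul0r//.
  apply/funext => y; have [yM|yM] := leP `|y| M; last by rewrite sM// mul0r.
  rewrite mollifier_out ?mulr0// -/d.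
  have := ler_normD (x - y) y; rewrite subrK; move: Mx yM d1; lra.
have cm_ : L2 mu (convol phi (mollifier m)) by have [] := conv_young p_ tm.
apply: (@le_trans _ _ (I (fun x => (L * d) ^+ 2 * \1_(@cube R n (M + 2)) x))).
  by apply: int_le => //; [exact/integ_sq/L2B|exact: integZ].
by rewrite intZ// -/c -/d; rewrite le_eqVlt; apply/orP; left; apply/eqP; ring.
Qed.

Lemma convB f g k x : L2 mu f -> L2 mu g -> test_function k ->
  convol (fun y => f y - g y) k x = convol f k x - convol g k x.
Proof.
move=> f_ g_ tk; rewrite /convol -intB; [|exact: conv_integ..].
by congr Rintegral; apply/funext => y; rewrite mulrBl.
Qed.

(** Mollification converges in mean square: it is a contraction, and converges
    on the dense class of test functions. *)
Lemma conv_mollifier f : L2 mu f -> cvg2 mu (fun m => convol f (mollifier m)) f.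
Proof.
move=> f_; split => // [m|]; first by have [] := conv_young f_ (test_mollifier m).
apply/cvgr0Pnorm_lt => e e0.
have e90 : 0 < e / 9 by rewrite divr_gt0.
have [phi tp Hphi] := L2_dense f_ e90.
have p_ := L2_test tp.
have /cvgr0Pnorm_lt/(_ _ e90) := conv_mollifier_test tp.
apply: filterS => m; rewrite !ger0_norm; [|by apply: int_ge0 => x; exact: sqr_ge0..].
move=> Hm; have tm := test_mollifier m.
have [c1 y1] := conv_young (L2B f_ p_) tm.
have [c2 _] := conv_young p_ tm; have [c3 _] := conv_young f_ tm.
have n1 : I (fun z => `|mollifier m z|) = 1.
  rewrite -(int_mollifier m); congr Rintegral; apply/funext => z.
  by rewrite ger0_norm// mollifier_ge0.
rewrite n1 expr1n mul1r in y1.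
have j1 := integ_sq c1; have j2 := integ_sq (L2B c2 p_); have j3 := integ_sq (L2B p_ f_).
apply: (@le_lt_trans _ _ (I (fun x => 3 * (convol (fun y => f y - phi y) (mollifier m) x ^+ 2
    + (convol phi (mollifier m) x - phi x) ^+ 2 + (phi x - f x) ^+ 2)))).
  apply: int_le; [exact/integ_sq/L2B|by apply/integZ/integD => //; exact: integD|].
  move=> x; rewrite convB//.
  move: (convol f _ x) (convol phi _ x) => s t.
  have := sqr_ge0 (s - t - (t - phi x)); have := sqr_ge0 (s - t - (phi x - f x)).
  by have := sqr_ge0 (t - phi x - (phi x - f x)); nra.
rewrite intZ ?intD//; try exact: integD; last by apply: integD => //; exact: integD.
have y2 : I (fun x => (f x - phi x) ^+ 2) = I (fun x => (phi x - f x) ^+ 2).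
  by congr Rintegral; apply/funext => x; rewrite -sqrrN opprB.
by move: y1 Hm Hphi; rewrite y2; lra.
Qed.

Definition lap phi : V -> R := fun x => \sum_(j < n) partial j (partial j phi) x.

Definition weak_lap f h := forall phi, test_function phi ->
  I (fun x => f x * lap phi x) = I (fun x => h x * phi x).

(** Two derivatives of the kernel turn the convolution into a test of the equation
    [weak_lap f h] against the reflected kernel. *)
Lemma lap_conv f h k : L2 mu f -> L2 mu h -> weak_lap f h -> test_function k ->
  lap (convol f k) = convol h k.
Proof.
move=> f_ h_ fh tk; apply/funext => x; rewrite /lap.
under eq_bigr => j _.
  rewrite (partial_conv j f_ tk) (partial_conv j f_ (test_partial j tk)).
  over.
rewrite /convol -int_sum; last first.
  by move=> j; apply: conv_integ => //; do 2 apply: test_partial.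
rewrite -(fh _ (test_reflect x tk)); congr Rintegral; apply/funext => y.
have sk := test_smooth tk.
have H j : partial j (partial j (fun y => k (x - y))) y = partial j (partial j k) (x - y).
  have sjk := smooth_partial j sk.
  rewrite (partial_reflect x j sk).
  rewrite (_ : (fun y0 => - partial j k (x - y0)) = fun y0 => (-1) * partial j k (x - y0)); last first.
    by apply/funext => z; rewrite mulN1r.
  rewrite (partialZ _ _ (smooth_reflect x sjk)) (partial_reflect x j sjk).
  by rewrite mulN1r opprK.
by rewrite /lap mulr_sumr; apply: eq_bigr => j _; rewrite H.
Qed.

Lemma cvg2_scaled psi g : test_function psi -> L2 mu g ->
  cvg2 mu (fun m x => psi (m.+1%:R^-1 *: x) * g x) (fun x => psi 0 * g x).
Proof.
move=> tpsi g_; have [C C0 HC] := test_bounded tpsi; have sp := test_smooth tpsi.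
have ms m : mfun (fun x => psi (m.+1%:R^-1 *: x)).
  rewrite (_ : (fun x => _) = fun x => psi (m.+1%:R^-1 *: x + 0)).
    by apply: mfun_smooth; exact: smooth_affine.
  by apply/funext => x; rewrite addr0.
have F_ m : L2 mu (fun x => psi (m.+1%:R^-1 *: x) * g x) by exact: (L2_mulb (ms m) (fun x => HC _) g_).
have f_ : L2 mu (fun x => psi 0 * g x) by exact: L2Z.
split => //.
have [|||||_] := @int_dct _ _ _ mu (fun m x => (psi (m.+1%:R^-1 *: x) * g x - psi 0 * g x) ^+ 2)
   (fun=> 0) (fun x => (C + C) ^+ 2 * g x ^+ 2).
- by move=> m; exact: integ_mfun (integ_sq (L2B (F_ m) f_)).
- exact: measurable_cst.
- exact/integZ/integ_sq.
- apply: aeW => x.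
  have L : (fun m => psi (m.+1%:R^-1 *: x)) @ \oo --> psi 0.
    apply: continuous_cvg; first exact: (smooth_continuous sp).
    rewrite -[X in _ --> X](scale0r x); apply: cvgZr_tmp; exact: cvg_harmonic.
  have D : (fun m => psi (m.+1%:R^-1 *: x) * g x - psi 0 * g x) @ \oo --> psi 0 * g x - psi 0 * g x.
    by apply: cvgB; [apply: cvgM => //; exact: cvg_cst|exact: cvg_cst].
  rewrite subrr in D; rewrite -[X in _ --> X](mulr0 (0 : R)).
  by under eq_fun do rewrite expr2; exact: cvgM.
- apply: aeW => x m; rewrite ger0_norm ?sqr_ge0// -mulrBl exprMn ler_wpM2r ?sqr_ge0//.
  rewrite -[leLHS]ger0_norm ?sqr_ge0// normrX lerXn2r ?nnegrE ?addr_ge0//.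
  by apply: le_trans (ler_normB _ _) _; apply: lerD; exact: HC.
by rewrite Rintegral_cst ?mul0r.
Qed.

Lemma cvg2_vanish (c : nat -> R) (F : nat -> V -> R) f : c @ \oo --> (0 : R) -> cvg2 mu F f ->
  cvg2 mu (fun m x => c m * F m x) (fun=> 0).
Proof.
move=> c0 Ff; have [F_ f_ _] := Ff; split.
- by move=> m; exact: L2Z.
- exact: L20.
have : (fun m => c m * c m * I (fun x => F m x * F m x)) @ \oo --> 0 * 0 * I (fun x => f x * f x).
  by apply: cvgM; [exact: cvgM|exact: cvg2_int].
rewrite !mul0r; apply: cvg_trans; apply: near_eq_cvg; apply: nearW => m /=.
rewrite -intZ; last exact: integM.
by congr Rintegral; apply/funext => x; rewrite subr0; ring.
Qed.

Definition cutoff (x : V) : R := (bump 1 0)^-1 * bump 1 x.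

Lemma test_cutoff : test_function cutoff.
Proof. by apply: testZ; exact: test_bump. Qed.

Lemma cutoff0 : cutoff 0 = 1.
Proof.
rewrite /cutoff mulVf// gt_eqF//; apply: box_bump_gt0 => // i.
by rewrite mxE oppr_lt0 ltr01.
Qed.

(** Mollify, then multiply by dilated cutoffs: every derivative that falls on a cutoff
    gains a factor tending to zero, and the mollified function has square-integrable
    derivatives. *)
Lemma lap_density f h : L2 mu f -> L2 mu h -> weak_lap f h -> forall e, 0 < e ->
  exists phi, [/\ test_function phi, I (fun x => (phi x - f x) ^+ 2) < e &
    I (fun x => (lap phi x - h x) ^+ 2) < e].
Proof.
move=> f_ h_ fh e e0; have e40 : 0 < e / 4 by rewrite divr_gt0.
have [_ _ /cvgr0Pnorm_lt/(_ _ e40) H1] := conv_mollifier f_.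
have [_ _ /cvgr0Pnorm_lt/(_ _ e40) H2] := conv_mollifier h_.
have [m _ /(_ m (leqnn m)) [/= {}H1 {}H2]] := filterI H1 H2.
have tm := test_mollifier m.
pose F := convol f (mollifier m).
have sF : smooth F by exact: smooth_conv.
have L2F k : test_function k -> L2 mu (convol f k) by move=> tk; have [] := conv_young f_ tk.
have F_ : L2 mu F by exact: L2F.
have E1 j : partial j F = convol f (partial j (mollifier m)) by exact: partial_conv.
have E2 j : partial j (partial j F) = convol f (partial j (partial j (mollifier m))).
  by rewrite E1 partial_conv//; exact: test_partial.
have F1 j : L2 mu (partial j F) by rewrite E1; apply: L2F; exact: test_partial.
have F2 j : L2 mu (partial j (partial j F)).
  by rewrite E2; apply: L2F; do 2 apply: test_partial.
have lapF : lap F = convol h (mollifier m) by exact: lap_conv.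
pose chi p (x : V) : R := cutoff (p.+1%:R^-1 *: x).
have sc := test_smooth test_cutoff.
have chiE p k : smooth k -> (fun x : V => k (p.+1%:R^-1 *: x)) = fun x => k (p.+1%:R^-1 *: x + 0).
  by move=> _; apply/funext => x; rewrite addr0.
have schi p k : smooth k -> smooth (fun x : V => k (p.+1%:R^-1 *: x)).
  by move=> sk; rewrite (chiE _ _ sk); exact: smooth_affine.
have pchi p k j : smooth k -> partial j (fun x : V => k (p.+1%:R^-1 *: x)) =
    fun x => p.+1%:R^-1 * partial j k (p.+1%:R^-1 *: x).
  by move=> sk; rewrite (chiE _ _ sk) (partial_affine _ _ _ sk); apply/funext => x; rewrite addr0.
pose G p x := chi p x * F x.
have tG p : test_function (G p).
  apply/test_functionP; split; first by apply: smoothM sF; exact: schi.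
  have /test_functionP[_ [M sM]] := test_cutoff; exists (p.+1%:R * M) => x Mx.
  rewrite /G /chi sM ?mul0r// normrZ ger0_norm ?invr_ge0//.
  by rewrite ltr_pdivlMl.
have GF : cvg2 mu G F.
  have := cvg2_scaled test_cutoff F_; rewrite cutoff0.
  by rewrite (_ : (fun x => 1 * F x) = F)//; apply/funext => x; rewrite mul1r.
have harm : (fun p => p.+1%:R^-1 : R) @ \oo --> (0 : R) by exact: cvg_harmonic.
have alg (c u v w y0 y1 y2 : R) : c * (c * u) * y0 + c * v * y1 + (c * v * y1 + w * y2) =
    c * (c * (u * y0)) + (2 * (c * (v * y1)) + w * y2) by ring.
have Gj j : cvg2 mu (fun p => partial j (partial j (G p))) (partial j (partial j F)).
  have sjF := smooth_partial j sF; have sjc := smooth_partial j sc.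
  have E p : partial j (partial j (G p)) = fun x =>
      p.+1%:R^-1 * (p.+1%:R^-1 * (partial j (partial j cutoff) (p.+1%:R^-1 *: x) * F x)) +
      (2 * (p.+1%:R^-1 * (partial j cutoff (p.+1%:R^-1 *: x) * partial j F x)) +
       cutoff (p.+1%:R^-1 *: x) * partial j (partial j F) x).
    have s1 := schi p _ sc; have s2 := schi p _ sjc.
    rewrite /G (partialM _ s1 sF) (pchi _ _ _ sc).
    rewrite (partialD _ (smoothM (smoothZ _ s2) sF) (smoothM s1 sjF)).
    rewrite (partialM _ (smoothZ _ s2) sF) (partialZ _ _ s2) (pchi _ _ _ sjc).
    rewrite (partialM _ s1 sjF) (pchi _ _ _ sc).
    by apply/funext => x; exact: alg.
  have c1 := cvg2_scaled (test_partial j (test_partial j test_cutoff)) F_.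
  have c2 := cvg2_scaled (test_partial j test_cutoff) (F1 j).
  have c3 := cvg2_scaled test_cutoff (F2 j).
  have := cvg2D (cvg2_vanish harm (cvg2_vanish harm c1))
    (cvg2D (cvg2Z 2 (cvg2_vanish harm c2)) c3).
  rewrite (_ : (fun m x => _ + _) = (fun p => partial j (partial j (G p)))); last first.
    by apply/funext => p; rewrite E.
  rewrite (_ : (fun x => _ + _) = partial j (partial j F))//.
  by apply/funext => x; rewrite cutoff0; ring.
have Glap : cvg2 mu (fun p => lap (G p)) (lap F) by exact: cvg2_sum.
have [_ _ /cvgr0Pnorm_lt/(_ _ e40) K1] := GF.
have [lG_ lF_ /cvgr0Pnorm_lt/(_ _ e40) K2] := Glap.
have [p _ /(_ p (leqnn p)) [/= {}K1 {}K2]] := filterI K1 K2.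
have nn (u v : V -> R) : 0 <= I (fun x => (u x - v x) ^+ 2).
  by apply: int_ge0 => x; exact: sqr_ge0.
have tri (u v w : V -> R) : L2 mu u -> L2 mu v -> L2 mu w ->
    `|I (fun x => (u x - v x) ^+ 2)| < e / 4 -> `|I (fun x => (v x - w x) ^+ 2)| < e / 4 ->
    I (fun x => (u x - w x) ^+ 2) < e.
  move=> u_ v_ w_; rewrite !ger0_norm// => uv vw.
  have j1 := integ_sq (L2B u_ v_); have j2 := integ_sq (L2B v_ w_).
  apply: (@le_lt_trans _ _ (I (fun x => 2 * ((u x - v x) ^+ 2 + (v x - w x) ^+ 2)))).
    apply: int_le; [exact/integ_sq/L2B|by apply/integZ/integD|].
    by move=> x; rewrite -[u x - w x](subrKA (v x)); exact: sqrD_le.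
  by rewrite intZ ?intD//; [move: uv vw; lra|exact: integD].
exists (G p); split => //.
  by apply: (tri _ F) => //; exact: L2_test.
apply: (tri _ (lap F) _ (lG_ p) lF_ h_ K2).
by rewrite lapF.
Qed.

Let sqE (g : V -> R) : (fun x => g x ^+ 2) = fun x => g x * g x.
Proof. by apply/funext => x; rewrite expr2. Qed.

Let ler_sum2 (c : 'I_n -> 'I_n -> R) a b : (forall j i, 0 <= c j i) ->
  c a b <= \sum_(j < n) \sum_(i < n) c j i.
Proof.
move=> nn; rewrite (bigD1 a)//= (bigD1 b)//= -addrA lerDl addr_ge0//.
  by apply: sumr_ge0.
by apply: sumr_ge0 => j _; exact: sumr_ge0.
Qed.

(** Two integrations by parts show that the squares of all second derivatives
    together have the same integral as the square of the Laplacian. *)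
Lemma test_hessian_le phi a b : test_function phi ->
  I (fun x => partial b (partial a phi) x ^+ 2) <= I (fun x => lap phi x ^+ 2).
Proof.
move=> tp; have sp := test_smooth tp.
have t2 i j : test_function (partial i (partial j phi)) by do 2 apply: test_partial.
have E i j : I (fun x => partial i (partial j phi) x ^+ 2) =
    I (fun x => partial j (partial j phi) x * partial i (partial i phi) x).
  apply: etrans (congr1 (Rintegral mu setT) (sqE _)) _.
  apply: etrans (int_by_parts i (smooth_partial j sp) (t2 i j)) _.
  apply: etrans _ (esym (int_by_parts j (smooth_partial j sp) (t2 i i))).
  by rewrite (smooth_schwarz i j sp) (smooth_schwarz i j (smooth_partial i sp)).
have i_ i j : integ (fun x => partial j (partial j phi) x * partial i (partial i phi) x).
  by apply: integM; exact: L2_test.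
have -> : I (fun x => lap phi x ^+ 2) =
    \sum_(j < n) \sum_(i < n) I (fun x => partial i (partial j phi) x ^+ 2).
  rewrite (_ : (fun x => lap phi x ^+ 2) = fun x => \sum_(j < n) \sum_(i < n)
      partial j (partial j phi) x * partial i (partial i phi) x); last first.
    by apply/funext => x; rewrite expr2 /lap big_distrlr.
  rewrite int_sum; last by move=> j; exact: integ_sum.
  apply: eq_bigr => j _; rewrite int_sum; last by move=> i; exact: i_.
  by apply: eq_bigr => i _; exact: (esym (E i j)).
have nn' j i : 0 <= I (fun x => partial i (partial j phi) x ^+ 2).
  by apply: int_ge0 => x; exact: sqr_ge0.
exact: (ler_sum2 (c := fun j i => I (fun x => partial i (partial j phi) x ^+ 2)) a b nn').
Qed.

Lemma test_gradient_le phi a : test_function phi ->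
  I (fun x => partial a phi x ^+ 2) <= I (fun x => phi x ^+ 2) + I (fun x => lap phi x ^+ 2).
Proof.
move=> tp; have sp := test_smooth tp.
have p_ := L2_test tp.
have q_ j : L2 mu (partial j (partial j phi)) by apply: L2_test; do 2 apply: test_partial.
have l_ : L2 mu (lap phi) by exact: L2_sum.
have E j : I (fun x => partial j phi x ^+ 2) = - I (fun x => phi x * partial j (partial j phi) x).
  apply: etrans (congr1 (Rintegral mu setT) (sqE _)) _.
  exact: int_by_parts sp (test_partial j tp).
apply: (@le_trans _ _ (\sum_(j < n) I (fun x => partial j phi x ^+ 2))).
  rewrite (bigD1 a)//= lerDl; apply: sumr_ge0 => j _; apply: int_ge0 => x; exact: sqr_ge0.
under eq_bigr do rewrite E.
rewrite sumrN.
have -> : \sum_(j < n) I (fun x => phi x * partial j (partial j phi) x) =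
    I (fun x => phi x * lap phi x).
  rewrite -int_sum; last by move=> j; exact: integM.
  by congr Rintegral; apply/funext => x; rewrite /lap mulr_sumr.
rewrite -intN; last exact: integM.
rewrite -intD; [|exact: integ_sq|exact: integ_sq].
apply: int_le.
- have := integZ (-1) (integM p_ l_); apply: eq_integrable => // x _ /=.
  by rewrite mulN1r.
- by apply: integD; exact: integ_sq.
- move=> x; have := sqr_ge0 (phi x + lap phi x).
  have := sqr_ge0 (phi x); have := sqr_ge0 (lap phi x).
  by rewrite sqrrD; lra.
Qed.

Lemma lapB phi psi : smooth phi -> smooth psi ->
  lap (fun x => phi x - psi x) = fun x => lap phi x - lap psi x.
Proof.
move=> sp sq; apply/funext => x; rewrite /lap -sumrB; apply: eq_bigr => j _.
by rewrite (partialB _ sp sq) (partialB _ (smooth_partial j sp) (smooth_partial j sq)).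
Qed.

(** Elliptic regularity in mean square: since the Laplacian controls all first
    and second derivatives of test functions, an approximating sequence for the
    graph norm of the Laplacian has convergent first and second derivatives. *)
Theorem lap_regularity f h : L2 mu f -> L2 mu h -> weak_lap f h ->
  exists (phi : nat -> V -> R) (u : 'I_n -> V -> R) (H : 'I_n -> 'I_n -> V -> R),
  [/\ forall m, test_function (phi m), cvg2 mu phi f,
      forall a, cvg2 mu (fun m => partial a (phi m)) (u a) &
      forall a b, cvg2 mu (fun m => partial b (partial a (phi m))) (H a b)].
Proof.
move=> f_ h_ fh.
(* Fast enough for the increments to satisfy the hypothesis of [cvg2_complete]. *)
pose d m : R := (16 * 8 ^+ m)^-1.
have d0 m : 0 < d m by rewrite invr_gt0 mulr_gt0// exprn_gt0.
have dS m : d m.+1 <= d m.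
  rewrite /d lef_pV2 ?posrE ?mulr_gt0 ?exprn_gt0// ler_wpM2l//.
  by rewrite exprS ler_peMl ?exprn_ge0// ler1n.
have dE m : 4 ^+ m * (8 * d m) = (2 ^ m.+1)%:R^-1.
  rewrite natrX exprS /d (_ : 8 = 4 * 2 :> R); last by ring.
  rewrite exprMn; field.
  by apply/andP; split; apply: expf_neq0; rewrite pnatr_eq0.
have /choice[phi Hphi] m := lap_density f_ h_ fh (d0 m).
have tphi m : test_function (phi m) by have [] := Hphi m.
have sphi m := test_smooth (tphi m).
have l_ m : L2 mu (lap (phi m)).
  by apply: L2_sum => j; apply: L2_test; do 2 apply: test_partial.
have p_ m := L2_test (tphi m).
have tri (u v w : V -> R) c c' : L2 mu u -> L2 mu v -> L2 mu w ->
    I (fun x => (u x - w x) ^+ 2) < c -> I (fun x => (v x - w x) ^+ 2) < c' -> c <= c' ->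
    I (fun x => (u x - v x) ^+ 2) <= 4 * c'.
  move=> u_ v_ w_ uw vw cc'.
  have j1 := integ_sq (L2B u_ w_); have j2 := integ_sq (L2B v_ w_).
  apply: (@le_trans _ _ (I (fun x => 2 * ((u x - w x) ^+ 2 + (v x - w x) ^+ 2)))).
    apply: int_le; [exact/integ_sq/L2B|by apply/integZ/integD|].
    move=> x; rewrite -[(v x - w x) ^+ 2]sqrrN opprB -[u x - v x](subrKA (w x)).
    exact: sqrD_le.
  by rewrite intZ ?intD//; [move: uw vw cc'; lra|exact: integD].
have D0 m : I (fun x => (phi m.+1 x - phi m x) ^+ 2) <= 4 * d m.
  have [_ A _] := Hphi m.+1; have [_ B _] := Hphi m; exact: tri A B (dS m).
have D2 m : I (fun x => (lap (phi m.+1) x - lap (phi m) x) ^+ 2) <= 4 * d m.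
  have [_ _ A] := Hphi m.+1; have [_ _ B] := Hphi m; exact: tri A B (dS m).
have td m : test_function (fun x => phi m.+1 x - phi m x) by exact: testB.
have G a m : 4 ^+ m * I (fun x => (partial a (phi m.+1) x - partial a (phi m) x) ^+ 2)
    <= (2 ^ m.+1)%:R^-1.
  rewrite -dE ler_wpM2l ?exprn_ge0//.
  have := test_gradient_le a (td m).
  rewrite (partialB _ (sphi _) (sphi _)) (lapB (sphi _) (sphi _)) => /le_trans; apply.
  by have := D0 m; have := D2 m; lra.
have HH a b m : 4 ^+ m * I (fun x => (partial b (partial a (phi m.+1)) x
    - partial b (partial a (phi m)) x) ^+ 2) <= (2 ^ m.+1)%:R^-1.
  rewrite -dE ler_wpM2l ?exprn_ge0//.
  have := test_hessian_le a b (td m).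
  rewrite (partialB _ (sphi _) (sphi _)) (lapB (sphi _) (sphi _)).
  rewrite (partialB _ (smooth_partial a (sphi _)) (smooth_partial a (sphi _))) => /le_trans; apply.
  by have := D2 m; have := d0 m; lra.
have /choice[u Hu] a := cvg2_complete (fun m => L2_test (test_partial a (tphi m))) (G a).
have /choice[H HH'] (p : 'I_n * 'I_n) := cvg2_complete
   (fun m => L2_test (test_partial p.2 (test_partial p.1 (tphi m)))) (HH p.1 p.2).
exists phi, u, (fun a b => H (a, b)); split => //; last by move=> a b; exact: (HH' (a, b)).
split => //.
have dlim : d @ \oo --> (0 : R).
  rewrite (_ : d = fun m => 16^-1 * (8^-1) ^+ m).
    rewrite -[X in _ --> X](mulr0 (16^-1 : R)); apply: cvgM; first exact: cvg_cst.
    by apply: cvg_expr; rewrite ger0_norm// invf_lt1// ltr1n.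
  by apply/funext => m; rewrite /d invfM exprVn.
apply: squeeze_cvgr dlim; last exact: cvg_cst.
apply: nearW => m; apply/andP; split; first by apply: int_ge0 => x; exact: sqr_ge0.
by have [_ /ltW] := Hphi m.
Qed.

End laplacian_density.

(** * Hardy's inequality *)

Lemma integ_monotone d (T : measurableType d) (R : realType) (mu : {measure set T -> \bar R})
    (F : nat -> T -> R) (f : T -> R) (C : R) :
  (forall m, mu.-integrable setT (EFin \o F m)) -> measurable_fun setT f ->
  (forall m x, 0 <= F m x) -> (forall x m p, (m <= p)%N -> F m x <= F p x) ->
  (forall x, F ^~ x @ \oo --> f x) -> (forall m, \int[mu]_x F m x <= C) ->
  mu.-integrable setT (EFin \o f).
Proof.
move=> F_ mf F0 ndF Ff FC.
have f0 x : 0 <= f x by apply: (ler_cvg_to (cvg_cst 0) (Ff x)); exact: nearW.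
apply: integ_ge0P => //.
have fE x : limn (fun m => (F m x)%:E) = (f x)%:E.
  by apply: cvg_lim => //; apply: cvg_EFin; [exact: nearW|exact: Ff].
have H := @cvg_monotone_convergence _ _ _ mu setT measurableT (fun m x => (F m x)%:E).
have {}H : ((\int[mu]_x (F m x)%:E)%E @[m --> \oo] --> (\int[mu]_x (f x)%:E)%E).
  rewrite (_ : (\int[mu]_x (f x)%:E)%E = (\int[mu]_x limn (fun m => (F m x)%:E))%E); last first.
    by apply: eq_integral => x _; rewrite fE.
  apply: H => [m|m x _|x _ m p mp]; [|by rewrite lee_fin|by rewrite lee_fin; exact: ndF].
  by apply/measurable_EFinP; exact: integ_mfun (F_ m).
apply: (@le_lt_trans _ _ C%:E); last exact: ltry.
rewrite -(cvg_lim _ H)//; apply: lime_le; first by apply/cvg_ex; exists (\int[mu]_x (f x)%:E)%E.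
by apply: nearW => m; rewrite integE// lee_fin.
Qed.

Lemma ae_head_neq0 (R : realType) n :
  {ae lebesgue_rV R n.+1, forall x : 'rV[R]_n.+1, x ord0 ord0 != 0}.
Proof.
pose A : set ('rV[R]_n.+1) := (@rV_coord R n.+1 ord0) @^-1` [set 0].
have mA : measurable A.
  by rewrite /A -[X in measurable X]setTI; exact: measurable_rV_coord.
exists A; split => //; last by move=> x /= /negP; rewrite negbK => /eqP.
rewrite /= /lebesgue_cons /pushforward.
rewrite (_ : _ @^-1` A = [set 0] `*` setT).
  apply: etrans (product_measure1E _ _ _ _) _ => //.
  by apply: etrans (congr1 (fun z => z * _)%E (lebesgue_measure_set1 _)) (mul0e _).
apply/seteqP; split => [[a y]|[a y]] /=.
  by rewrite /A /= /rV_coord => H; split => //; rewrite -H -{1}[a](congr1 fst (rV_consK (a, y))).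
by move=> [-> _]; rewrite /A /= /rV_coord; exact: (congr1 fst (rV_consK (0, y))).
Qed.

Section hardy.
Context (R : realType) (n : nat).
Implicit Types (f g h k phi psi : 'rV[R]_n -> R) (j a b : 'I_n).
Local Notation mu := (lebesgue_rV R n).
Local Notation integ f := (mu.-integrable setT (EFin \o f)).
Local Notation mfun f := (measurable_fun setT (f : 'rV[R]_n -> R)).
Local Notation I f := (\int[mu]_x f x).
Local Notation V := 'rV[R]_n.

Local Opaque partial.

Lemma ae_neq0 : (0 < n)%N -> {ae mu, forall x : V, x != 0}.
Proof.
clear; case: n => // p _; have := @ae_head_neq0 R p; apply: filterS => x.
by apply: contra_neq => ->; rewrite mxE.
Qed.

Lemma enormE (x : V) : enorm x = Num.sqrt (sqn x). Proof. by []. Qed.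

Lemma enorm_ge0 (x : V) : 0 <= enorm x. Proof. exact: sqrtr_ge0. Qed.

Lemma enorm_sq (x : V) : enorm x ^+ 2 = sqn x.
Proof. by rewrite sqr_sqrtr// sqn_ge0. Qed.

Lemma coord_sq_le (x : V) j : x ord0 j ^+ 2 <= sqn x.
Proof. by rewrite /sqn (bigD1 j)//= lerDl; apply: sumr_ge0 => i _; exact: sqr_ge0. Qed.

Lemma sqn_gt0 (x : V) : x != 0 -> 0 < sqn x.
Proof.
move=> x0; rewrite lt_neqAle sqn_ge0 andbT eq_sym; apply: contra_neq x0 => s0.
apply/rowP => j; rewrite mxE; apply/eqP; rewrite -sqrf_eq0 eq_le sqr_ge0 andbT -s0.
exact: coord_sq_le.
Qed.

Lemma enorm_gt0 (x : V) : x != 0 -> 0 < enorm x.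
Proof. by move=> x0; rewrite sqrtr_gt0 sqn_gt0. Qed.

Lemma coord_le_enorm (x : V) j : `|x ord0 j| <= enorm x.
Proof. by rewrite -sqrtr_sqr ler_sqrt ?sqn_ge0// coord_sq_le. Qed.

Lemma enorm_powR (x : V) (s : R) : enorm x `^ s = sqn x `^ (s / 2).
Proof. by rewrite enormE -powR12_sqrt ?sqn_ge0// -powRrM mulrC. Qed.

Lemma mfun_enorm_powR (s : R) : mfun (fun x => enorm x `^ s).
Proof.
rewrite (_ : (fun x => _) = (@powR R ^~ (s / 2)) \o @sqn R n); last first.
  by apply/funext => x; rewrite enorm_powR.
apply: measurableT_comp; first exact: measurable_powR.
exact: mfun_smooth (@smooth_sqn R n).
Qed.

Lemma mfun_enormV : mfun (fun x => (enorm x)^-1).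
Proof.
have := mfun_enorm_powR (-1); congr measurable_fun.
by apply/funext => x; rewrite powR_inv1// enorm_ge0.
Qed.

Definition wdir a (x : V) : R := x ord0 a / enorm x.

Lemma mfun_wdir a : mfun (wdir a).
Proof. by apply: measurable_funM; [exact: mfun_smooth (smooth_coord R a)|exact: mfun_enormV]. Qed.

Lemma wdir_le1 a x : `|wdir a x| <= 1.
Proof.
rewrite normrM normfV (ger0_norm (enorm_ge0 _)).
have [->|x0] := eqVneq (enorm x) 0; first by rewrite invr0 mulr0.
by rewrite ler_pdivrMr ?mul1r ?coord_le_enorm// lt_neqAle eq_sym x0 enorm_ge0.
Qed.

Lemma sum_wdir_sq x : x != 0 -> \sum_(a < n) wdir a x ^+ 2 = 1.
Proof.
move=> x0; rewrite /wdir; under eq_bigr do rewrite exprMn exprVn enorm_sq.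
by rewrite -mulr_suml mulfV// gt_eqF// sqn_gt0.
Qed.

(** The inverse square of the norm, regularised at the origin. *)
Definition reginv (m : nat) : V -> R := rho m.+1%:R^-1 (-1).

Let e_gt0 m : 0 < m.+1%:R^-1 :> R. Proof. by rewrite invr_gt0. Qed.

Lemma reginvE m x : reginv m x = (sqn x + m.+1%:R^-1)^-1.
Proof. by rewrite /reginv /rho powR_inv1// addr_ge0// ?sqn_ge0// ltW// e_gt0. Qed.

Lemma reginv_gt0 m x : 0 < reginv m x.
Proof. by rewrite reginvE invr_gt0 ltr_wpDl ?sqn_ge0. Qed.

Lemma smooth_reginv m : smooth (reginv m). Proof. exact: smooth_rho. Qed.

Lemma rho_sqr (e : R) (x : V) : 0 < e -> rho e (-1 - 1) x = rho e (-1) x * rho e (-1) x.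
Proof.
move=> e0; rewrite /rho powRD//; apply/implyP => _.
by rewrite gt_eqF// ltr_wpDl ?sqn_ge0.
Qed.

Lemma partial_reginv m j : partial j (reginv m) =
  fun x => - 2 * x ord0 j * (reginv m x * reginv m x).
Proof.
rewrite /reginv partial_rho//; apply/funext => x; rewrite rho_sqr//; ring.
Qed.

Lemma reginv_le m x : reginv m x <= m.+1%:R.
Proof.
rewrite reginvE -[leRHS]invrK lef_pV2 ?posrE ?ltr_wpDl ?sqn_ge0//.
by rewrite lerDr sqn_ge0.
Qed.

(** The ratio of [reginv] to [|x|^-2], which increases to [1]. *)
Definition sigma (m : nat) (x : V) : R := sqn x * reginv m x.

Lemma sigma_ge0 m x : 0 <= sigma m x.
Proof. by rewrite mulr_ge0 ?sqn_ge0// ltW// reginv_gt0. Qed.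

Lemma sigma_le1 m x : sigma m x <= 1.
Proof.
by rewrite /sigma reginvE ler_pdivrMr ?ltr_wpDl ?sqn_ge0// mul1r lerDl ltW.
Qed.

Lemma cvg_sigma x : x != 0 -> sigma ^~ x @ \oo --> (1 : R).
Proof.
move=> x0; have s0 := sqn_gt0 x0.
rewrite -[X in _ --> X](mulfV (lt0r_neq0 s0)).
apply: cvgM; first exact: cvg_cst.
rewrite (_ : reginv ^~ x = fun m => (sqn x + m.+1%:R^-1)^-1); last first.
  by apply/funext => m; rewrite reginvE.
apply: cvgV; first by rewrite gt_eqF.
rewrite -[X in _ --> X]addr0; apply: cvgD; [exact: cvg_cst|exact: cvg_harmonic].
Qed.

Lemma sigma_nd x m p : (m <= p)%N -> sigma m x <= sigma p x.
Proof.
move=> mp; rewrite /sigma ler_wpM2l ?sqn_ge0// !reginvE.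
rewrite lef_pV2 ?posrE ?ltr_wpDl ?sqn_ge0//.
by rewrite lerD2l lef_pV2 ?posrE// ler_nat ltnS.
Qed.

(** Integration of the divergence of [x / (|x|^2 + e)] against [psi^2]; the
    mixed term is absorbed by the inequality between means, which costs the
    optimal constant but keeps a positive one in dimension at least 4. *)
Lemma test_hardy m psi : test_function psi ->
  (n%:R - 3) * I (fun x => reginv m x * psi x * psi x) <=
  \sum_(j < n) I (fun x => partial j psi x * partial j psi x).
Proof.
move=> tp; have sp := test_smooth tp; have p_ := L2_test tp.
pose q := reginv m; have sq : smooth q := smooth_reginv m.
pose K j (x : V) := x ord0 j * q x.
have sK j : smooth (K j) by exact: (smoothM (smooth_coord R j) sq).
have t2 : test_function (fun x => psi x * psi x) by exact: (testMl sp tp).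
have dK j : partial j (K j) = fun x => q x - 2 * x ord0 j ^+ 2 * (q x * q x).
  rewrite /K (partialM _ (smooth_coord R j) sq) partial_coord partial_reginv.
  by apply/funext => x; rewrite eqxx /= -/q; ring.
have d2 j : partial j (fun x => psi x * psi x) = fun x => 2 * (psi x * partial j psi x).
  by rewrite (partialM _ sp sp); apply/funext => x; ring.
have B j := int_by_parts j (sK j) t2.
have tq f : smooth f -> test_function (fun x => f x * (psi x * psi x)) by move=> sf; exact: testMl.
have i1 j : integ (fun x => partial j (K j) x * (psi x * psi x)).
  by apply/integ_test/tq/(smooth_partial j (sK j)).
have i2 j : integ (fun x => K j x * partial j (fun x => psi x * psi x) x).
  by apply/integ_test/testMl; [exact: sK|exact: test_partial].
have i3 j : integ (fun x => partial j psi x * partial j psi x).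
  by apply: integM; apply: L2_test; exact: test_partial.
have i4 : integ (fun x => reginv m x * psi x * psi x).
  rewrite (_ : (fun x => _) = fun x => q x * (psi x * psi x)); first exact/integ_test/tq.
  by apply/funext => x; rewrite /q mulrA.
have E : I (fun x => \sum_(j < n) partial j (K j) x * (psi x * psi x)) =
   I (fun x => \sum_(j < n) - (K j x * partial j (fun x => psi x * psi x) x)).
  rewrite int_sum// int_sum; last first.
    by move=> j; have := integZ (-1) (i2 j); apply: eq_integrable => // x _ /=; rewrite mulN1r.
  by apply: eq_bigr => j _; rewrite B intN.
have i5 : integ (fun x => \sum_(j < n) - (K j x * partial j (fun x => psi x * psi x) x)).
  apply: integ_sum => j.
  by have := integZ (-1) (i2 j); apply: eq_integrable => // x _ /=; rewrite mulN1r.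
have i6 : integ (fun x => \sum_(j < n) partial j psi x * partial j psi x) by exact: integ_sum.
have H1 : (n%:R - 2) * I (fun x => reginv m x * psi x * psi x) <=
    I (fun x => \sum_(j < n) partial j (K j) x * (psi x * psi x)).
  rewrite -intZ//; apply: int_le; [exact: integZ|exact: integ_sum|].
  move=> x; under eq_bigr do rewrite dK.
  rewrite -mulr_suml sumrB sumr_const card_ord -mulr_suml -mulr_sumr -/(sqn x).
  have := sigma_le1 m x; rewrite /sigma -/(q x) => s1.
  have := reginv_gt0 m x; rewrite -/(q x) => q0.
  rewrite -mulrA mulrA ler_wpM2r -?expr2 ?sqr_ge0//.
  rewrite -[q x *+ n]mulr_natl; move: (n%:R) (sqn x) (q x) s1 q0 => N S Q s1 q0.
  by have := mulr_ge0 (ltW q0) (_ : 0 <= 1 - S * Q); rewrite subr_ge0 => /(_ s1); nra.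
have H2 : I (fun x => \sum_(j < n) - (K j x * partial j (fun x => psi x * psi x) x)) <=
   I (fun x => reginv m x * psi x * psi x) + I (fun x => \sum_(j < n) partial j psi x * partial j psi x).
  rewrite -intD//; apply: int_le => //; first exact: integD.
  move=> x; apply: (@le_trans _ _ (\sum_(j < n) (K j x ^+ 2 * psi x ^+ 2 + partial j psi x * partial j psi x))).
    apply: ler_sum => j _; rewrite d2.
    by have := sqr_ge0 (K j x * psi x + partial j psi x); lra.
  rewrite big_split /= lerD2r -mulr_suml -mulrA -expr2 ler_wpM2r ?sqr_ge0//.
  under eq_bigr do rewrite exprMn.
  rewrite -mulr_suml -/(sqn x) expr2 mulrA ler_piMl//; first exact: ltW (reginv_gt0 m x).
  exact: sigma_le1.
by move: H1 H2; rewrite E [I (fun x => \sum_(j < n) partial j psi x * _)]int_sum//; lra.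
Qed.

Lemma mfun_reginv m : mfun (reginv m). Proof. exact: mfun_smooth (smooth_reginv m). Qed.

(** The inequality for test functions survives the limit along the sequence; monotone
    convergence then removes the regularisation. *)
Lemma hardy (psi : nat -> V -> R) u (du : 'I_n -> V -> R) : (3 < n)%N ->
  (forall m, test_function (psi m)) -> cvg2 mu psi u ->
  (forall j, cvg2 mu (fun m => partial j (psi m)) (du j)) ->
  L2 mu (fun x => u x / enorm x).
Proof.
move=> n3 tpsi psiu dpsiu; have [_ u_ _] := psiu; have [mu_ _] := u_.
have n30 : 0 < n%:R - 3 :> R by rewrite subr_gt0 ltr_nat.
pose C := (n%:R - 3)^-1 * \sum_(j < n) I (fun x => du j x * du j x).
have bq m x : `|reginv m x| <= m.+1%:R by rewrite ger0_norm ?reginv_le// ltW// reginv_gt0.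
have mu' : mfun (fun x => u x / enorm x) by apply: measurable_funM => //; exact: mfun_enormV.
have qu m : L2 mu (fun x => reginv m x * u x) by exact: (L2_mulb (mfun_reginv m) (bq m) u_).
have HC m : I (fun x => reginv m x * u x * u x) <= C.
  rewrite /C ler_pdivlMl//.
  have L := cvg2_int (cvg2_mulb (mfun_reginv m) (bq m) psiu) psiu.
  have L1 : (fun p => (n%:R - 3) * I (fun x => reginv m x * psi p x * psi p x)) @ \oo -->
     (n%:R - 3) * I (fun x => reginv m x * u x * u x) by apply: cvgM => //; exact: cvg_cst.
  have L2 : (fun p => \sum_(j < n) I (fun x => partial j (psi p) x * partial j (psi p) x)) @ \oo -->
     \sum_(j < n) I (fun x => du j x * du j x).
    by apply: cvg_big => [|j _]; [exact: add_continuous|exact: cvg2_int].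
  by apply: (ler_cvg_to L1 L2); apply: nearW => p; exact: test_hardy.
split => //.
have fE m x : sigma m x * (u x / enorm x) ^+ 2 <= reginv m x * u x * u x.
  rewrite /sigma exprMn exprVn enorm_sq expr2.
  have [->|s0] := eqVneq (sqn x) 0.
    by rewrite !mul0r -mulrA mulr_ge0 -?expr2 ?sqr_ge0// ltW// reginv_gt0.
  by rewrite le_eqVlt; apply/orP; left; apply/eqP; field.
have ms m : mfun (sigma m).
  by apply: measurable_funM; [exact: mfun_smooth (@smooth_sqn R n)|exact: mfun_reginv].
have mf m : mfun (fun x => sigma m x * (u x / enorm x) ^+ 2).
  by apply: measurable_funM => //; exact: measurable_funX.
have i_ m : integ (fun x => sigma m x * (u x / enorm x) ^+ 2).
  apply: integ_dom (mf m) _ (integM (qu m) u_) => x.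
  by rewrite ger0_norm ?fE// mulr_ge0 ?sigma_ge0 ?sqr_ge0.
apply: (@integ_monotone _ _ _ mu (fun m x => sigma m x * (u x / enorm x) ^+ 2) _ C) => //.
- exact: measurable_funX.
- by move=> m x; rewrite mulr_ge0 ?sigma_ge0 ?sqr_ge0.
- by move=> x m p mp; rewrite ler_wpM2r ?sqr_ge0// sigma_nd.
- move=> x; have [->|x0] := eqVneq x 0.
    rewrite (_ : enorm 0 = 0); last first.
      rewrite enormE /sqn big1 ?sqrtr0// => j _; by rewrite mxE expr0n.
    by rewrite invr0 mulr0 expr0n mulr0n; under eq_fun do rewrite mulr0; exact: cvg_cst.
  rewrite -[X in _ --> X]mul1r; apply: cvgM; [exact: cvg_sigma|exact: cvg_cst].
- move=> m; apply: le_trans (HC m); apply: int_le => //; exact: integM.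
Qed.

End hardy.

(** * Integral identities for second derivatives *)

Section identities.
Context (R : realType) (n : nat).
Implicit Types (f g h k phi psi : 'rV[R]_n -> R) (i j a b c d : 'I_n).
Local Notation mu := (lebesgue_rV R n).
Local Notation integ f := (mu.-integrable setT (EFin \o f)).
Local Notation mfun f := (measurable_fun setT (f : 'rV[R]_n -> R)).
Local Notation I f := (\int[mu]_x f x).
Local Notation V := 'rV[R]_n.
Local Notation w := (@wdir R n).
Local Notation r := (@enorm R n).
Local Notation dlt a b := ((a == b)%:R : R).

Local Opaque partial.

Definition bdd (k : V -> R) := exists C, forall x, `|k x| <= C.

Lemma bddD f g : bdd f -> bdd g -> bdd (fun x => f x + g x).
Proof.
move=> [C fC] [D gD]; exists (C + D) => x.
by apply: le_trans (ler_normD _ _) _; exact: lerD.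
Qed.

Lemma bddM f g : bdd f -> bdd g -> bdd (fun x => f x * g x).
Proof. by move=> [C fC] [D gD]; exists (C * D) => x; rewrite normrM ler_pM. Qed.

Lemma bdd_cst (c : R) : bdd (fun=> c).
Proof. by exists `|c|. Qed.

Lemma bdd_eq f g : f =1 g -> bdd f -> bdd g.
Proof. by move=> fg [C fC]; exists C => x; rewrite -fg. Qed.

Let alg2 (p k k' s s' : R) : k' * (p * s) + k * (p * s') = p * (k' * s + k * s').
Proof. by ring. Qed.

Let alg3 (p p' k k' s s' : R) : k' * (p * s) + k * (p' * s) + k * (p * s') =
  k' * (p * s) + k * (p' * s + p * s').
Proof. by ring. Qed.

Let alg4 (A B C D E F : R) : A = - (C + E) -> B = - (D + F) -> E = F -> A - B + C - D = 0.
Proof. by move=> -> -> ->; ring. Qed.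

(** In both products of second derivatives the factor that contains [a] is integrated
    by parts; the resulting third derivatives agree, by symmetry, and cancel. *)
Lemma test_hessian_ibp phi k a b c : test_function phi -> smooth k ->
  I (fun x => k x * (partial b (partial a phi) x * partial c (partial c phi) x))
  - I (fun x => k x * (partial c (partial a phi) x * partial c (partial b phi) x))
  + I (fun x => partial b k x * (partial a phi x * partial c (partial c phi) x))
  - I (fun x => partial c k x * (partial a phi x * partial c (partial b phi) x)) = 0.
Proof.
move=> tp sk; have sp := test_smooth tp.
have t1 i : test_function (partial i phi) by exact: test_partial.
have t2 i j : test_function (partial i (partial j phi)) by do 2 apply: test_partial.
have key i j l : I (fun x => k x * (partial i (partial a phi) x * partial j (partial l phi) x)) =
   - (I (fun x => partial i k x * (partial a phi x * partial j (partial l phi) x)) +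
      I (fun x => k x * (partial a phi x * partial i (partial j (partial l phi)) x))).
  have B := int_by_parts i (smooth_partial a sp) (testMl sk (t2 j l)).
  have E1 : (fun x => k x * (partial i (partial a phi) x * partial j (partial l phi) x)) =
     fun x => partial i (partial a phi) x * (k x * partial j (partial l phi) x).
    by apply/funext => x; exact: mulrCA.
  apply: etrans (congr1 (Rintegral mu setT) E1) _; apply: etrans B (congr1 -%R _).
  have i1 : integ (fun x => partial i k x * (partial a phi x * partial j (partial l phi) x)).
    exact (integ_test (testMl (smooth_partial i sk) (testMl (smooth_partial a sp) (t2 j l)))).
  have i2 : integ (fun x => k x * (partial a phi x * partial i (partial j (partial l phi)) x)).
    exact (integ_test (testMl sk (testMl (smooth_partial a sp) (test_partial i (t2 j l))))).
  rewrite -(intD i1 i2); congr Rintegral; apply/funext => x.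
  apply: etrans (congr1 (fun f : V -> R => partial a phi x * f x) (partialM i sk (test_smooth (t2 j l)))) _.
  exact: esym (alg2 _ _ _ _ _).
apply: (alg4 (key b c c) (key c c b)).
have E : partial b (partial c (partial c phi)) = partial c (partial c (partial b phi)).
  by rewrite (smooth_schwarz b c (smooth_partial c sp)) (smooth_schwarz b c sp).
exact: (congr1 (fun f : V -> R => I (fun x => k x * (partial a phi x * f x))) E).
Qed.

(** The three integrands add up to a derivative of [k * partial a phi * partial b phi]. *)
Lemma test_gradient_ibp phi k a b c : test_function phi -> smooth k ->
  I (fun x => partial c k x * (partial a phi x * partial b phi x))
  + I (fun x => k x * (partial c (partial a phi) x * partial b phi x))
  + I (fun x => k x * (partial a phi x * partial c (partial b phi) x)) = 0.
Proof.
move=> tp sk; have sp := test_smooth tp.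
have t1 i : test_function (partial i phi) by exact: test_partial.
have s1 i : smooth (partial i phi) := smooth_partial i sp.
have i1 : integ (fun x => partial c k x * (partial a phi x * partial b phi x)).
  exact (integ_test (testMl (smooth_partial c sk) (testMl (s1 a) (t1 b)))).
have i2 : integ (fun x => k x * (partial c (partial a phi) x * partial b phi x)).
  exact (integ_test (testMl sk (testMl (smooth_partial c (s1 a)) (t1 b)))).
have i3 : integ (fun x => k x * (partial a phi x * partial c (partial b phi) x)).
  exact (integ_test (testMl sk (testMl (s1 a) (test_partial c (t1 b))))).
have i12 := integD i1 i2; rewrite -(intD i1 i2) -(intD i12 i3).
apply: etrans (int_partial c (testMl sk (testMl (s1 a) (t1 b)))).
congr Rintegral; apply/funext => x.
apply: etrans _ (esym (congr1 (fun f : V -> R => f x) (partialM c sk (smoothM (s1 a) (s1 b))))).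
apply: etrans (alg3 _ _ _ _ _ _) _.
exact: (congr1 (fun f : V -> R => _ + k x * f x) (esym (partialM c (s1 a) (s1 b)))).
Qed.

(** Multipliers depending on a regularisation parameter, with a bounded limit
    away from the origin. *)
Definition reg (k : nat -> V -> R) (k0 : V -> R) :=
  [/\ forall m, mfun (k m), mfun k0,
      exists C, forall m x, x != 0 -> `|k m x| <= C &
      forall x, x != 0 -> k ^~ x @ \oo --> k0 x].

Lemma reg_eq (k' k : nat -> V -> R) k0 : (forall m, mfun (k' m)) ->
  (forall m x, x != 0 -> k' m x = k m x) -> reg k k0 -> reg k' k0.
Proof.
move=> mk' E [mk mk0 [C kC] kk0]; split => //.
  by exists C => m x x0; rewrite E//; exact: kC.
by move=> x x0; rewrite (_ : k' ^~ x = k ^~ x); [exact: kk0|apply/funext => m; exact: E].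
Qed.

Lemma regD (k k' : nat -> V -> R) k0 k0' : reg k k0 -> reg k' k0' ->
  reg (fun m x => k m x + k' m x) (fun x => k0 x + k0' x).
Proof.
move=> [mk mk0 [C kC] kk0] [mk' mk0' [C' kC'] kk0']; split.
- by move=> m; exact: measurable_funD.
- exact: measurable_funD.
- exists (C + C') => m x x0; apply: le_trans (ler_normD _ _) _.
  by apply: lerD; [exact: kC|exact: kC'].
- by move=> x x0; apply: cvgD; [exact: kk0|exact: kk0'].
Qed.

Lemma regM (k k' : nat -> V -> R) k0 k0' : reg k k0 -> reg k' k0' ->
  reg (fun m x => k m x * k' m x) (fun x => k0 x * k0' x).
Proof.
move=> [mk mk0 [C kC] kk0] [mk' mk0' [C' kC'] kk0']; split.
- by move=> m; exact: measurable_funM.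
- exact: measurable_funM.
- by exists (C * C') => m x x0; rewrite normrM ler_pM ?kC ?kC'.
- by move=> x x0; apply: cvgM; [exact: kk0|exact: kk0'].
Qed.

Lemma reg_cst (c : R) : reg (fun _ _ => c) (fun=> c).
Proof.
split; [by move=> m; exact: measurable_cst|exact: measurable_cst|by exists (Num.norm c)|].
by move=> x _; exact: cvg_cst.
Qed.

Lemma reg_wdir a : reg (fun=> w a) (w a).
Proof.
split; [by move=> m; exact: mfun_wdir|exact: mfun_wdir| |].
  by exists 1 => m x _; exact: wdir_le1.
by move=> x _; exact: cvg_cst.
Qed.

Lemma mfun_sigma m : mfun (@sigma R n m).
Proof.
by apply: measurable_funM; [exact: mfun_smooth (@smooth_sqn R n)|exact: mfun_reginv].
Qed.

Lemma reg_sigma : reg (@sigma R n) (fun=> 1).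
Proof.
split; [by move=> m; exact: mfun_sigma|exact: measurable_cst| |].
  by exists 1 => m x _; rewrite ger0_norm ?sigma_le1// sigma_ge0.
by move=> x x0; exact: cvg_sigma.
Qed.

Lemma ae_n0 (P : V -> Prop) : (0 < n)%N -> (forall x, x != 0 -> P x) -> {ae mu, forall x, P x}.
Proof. by move=> n0 HP; have := @ae_neq0 R n n0; apply: filterS. Qed.

Lemma reg_int (k : nat -> V -> R) k0 f g : (0 < n)%N -> reg k k0 -> L2 mu f -> L2 mu g ->
  integ (fun x => k0 x * (f x * g x)) /\
  (fun m => I (fun x => k m x * (f x * g x))) @ \oo --> I (fun x => k0 x * (f x * g x)).
Proof.
move=> n0 [mk mk0 [C kC] kk0] f_ g_.
have [mf _] := f_; have [mg _] := g_.
apply: (@int_dct _ _ _ mu _ _ (fun x => C * `|f x * g x|)).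
- by move=> m; apply: measurable_funM => //; exact: measurable_funM.
- by apply: measurable_funM => //; exact: measurable_funM.
- by apply: integZ; apply: integ_norm; exact: integM.
- apply: ae_n0 => // x x0; apply: cvgM; [exact: kk0|exact: cvg_cst].
- apply: ae_n0 => // x x0 m; rewrite normrM ler_wpM2r//; exact: kC.
Qed.

(** The vector field [x_b / (|x|^2 + e)], from which all multipliers are built. *)
Definition radfield m b (x : V) : R := x ord0 b * reginv m x.

Lemma smooth_radfield m b : smooth (radfield m b).
Proof. exact (smoothM (smooth_coord R b) (smooth_reginv R m)). Qed.

Lemma partial_radfield m b j : partial j (radfield m b) =
  fun x => dlt b j * reginv m x + (- 2) * (radfield m b x * radfield m j x).
Proof.
rewrite /radfield (partialM _ (smooth_coord R b) (smooth_reginv R m)) partial_coord partial_reginv.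
by apply/funext => x; move: (_ == _)%:R (reginv m x) (x ord0 b) (x ord0 j) => D Q B J; ring.
Qed.

Lemma bdd_reginv m : bdd (reginv m).
Proof. by exists m.+1%:R => x; rewrite gtr0_norm ?reginv_le// reginv_gt0. Qed.

Lemma bdd_radfield m b : bdd (radfield m b).
Proof.
exists (1 + m.+1%:R) => x; rewrite normrM (gtr0_norm (reginv_gt0 m x)).
have := reginv_le m x; have := sigma_le1 m x; have := reginv_gt0 m x.
have := coord_sq_le x b; rewrite /sigma -(real_normK (num_real (x ord0 b))).
move: (reginv m x) (sqn x) (m.+1%:R) => Q S M; have := normr_ge0 (x ord0 b).
move: `|_| => B B0 BS Q0 SQ QM; have := sqr_ge0 (B - 1).
have : 0 <= (S - B ^+ 2) * Q by rewrite mulr_ge0 ?subr_ge0// ltW.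
have : 0 <= Q * (B - 1) ^+ 2 by rewrite mulr_ge0 ?sqr_ge0// ltW.
by nra.
Qed.

Lemma bdd_partial_radfield m b j : bdd (partial j (radfield m b)).
Proof.
rewrite partial_radfield; apply: bddD; first exact: bddM (bdd_cst _) (bdd_reginv m).
by apply: bddM (bdd_cst _) _; exact: bddM (bdd_radfield m b) (bdd_radfield m j).
Qed.

Definition radfield2 m a b (x : V) : R := x ord0 a * radfield m b x.

Lemma smooth_radfield2 m a b : smooth (radfield2 m a b).
Proof. exact (smoothM (smooth_coord R a) (smooth_radfield m b)). Qed.

Lemma partial_radfield2 m a b j : partial j (radfield2 m a b) =
  fun x => dlt a j * radfield m b x + x ord0 a * partial j (radfield m b) x.
Proof.
by rewrite /radfield2 (partialM _ (smooth_coord R a) (smooth_radfield m b)) partial_coord.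
Qed.

Lemma bdd_radfield2 m a b : bdd (radfield2 m a b).
Proof.
exists 1 => x; rewrite /radfield2 /radfield !normrM (gtr0_norm (reginv_gt0 m x)).
apply: le_trans (sigma_le1 m x); rewrite mulrA /sigma ler_wpM2r//; first exact: ltW (reginv_gt0 m x).
by rewrite -enorm_sq expr2 ler_pM// coord_le_enorm.
Qed.

Lemma bdd_partial_radfield2 m a b j : bdd (partial j (radfield2 m a b)).
Proof.
rewrite partial_radfield2; apply: bddD; first exact: bddM (bdd_cst _) (bdd_radfield m b).
apply: (bdd_eq (f := fun x => dlt b j * radfield m a x +
    (- 2) * (radfield2 m a b x * radfield m j x))).
  move=> x; rewrite partial_radfield /radfield2 /radfield.
  by move: (_ == _)%:R (reginv m x) (x ord0 b) (x ord0 j) (x ord0 a) => D Q B J A; ring.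
apply: bddD; first exact: bddM (bdd_cst _) (bdd_radfield m a).
by apply: bddM (bdd_cst _) _; exact: bddM (bdd_radfield2 m a b) (bdd_radfield m j).
Qed.

Definition radfield3 m a b c (x : V) : R := radfield2 m a b x * radfield m c x.

Lemma smooth_radfield3 m a b c : smooth (radfield3 m a b c).
Proof. exact (smoothM (smooth_radfield2 m a b) (smooth_radfield m c)). Qed.

Lemma partial_radfield3 m a b c j : partial j (radfield3 m a b c) =
  fun x => partial j (radfield2 m a b) x * radfield m c x +
           radfield2 m a b x * partial j (radfield m c) x.
Proof. exact (partialM j (smooth_radfield2 m a b) (smooth_radfield m c)). Qed.

Lemma bdd_radfield3 m a b c : bdd (radfield3 m a b c).
Proof. exact: bddM (bdd_radfield2 m a b) (bdd_radfield m c). Qed.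

Lemma bdd_partial_radfield3 m a b c j : bdd (partial j (radfield3 m a b c)).
Proof.
rewrite partial_radfield3; apply: bddD.
  exact: bddM (bdd_partial_radfield2 m a b j) (bdd_radfield m c).
exact: bddM (bdd_radfield2 m a b) (bdd_partial_radfield m c j).
Qed.

Lemma mfun_enorm : mfun r.
Proof.
have := @mfun_enorm_powR R n 1; congr measurable_fun.
by apply/funext => x; rewrite powRr1// enorm_ge0.
Qed.

Let mMr k : mfun k -> mfun (fun x => k x * r x).
Proof. by move=> mk; apply: measurable_funM => //; exact: mfun_enorm. Qed.

Let mMr2 k : mfun k -> mfun (fun x => k x * r x ^+ 2).
Proof. by move=> mk; apply: measurable_funM => //; apply: measurable_funX; exact: mfun_enorm. Qed.

Lemma reg_radfield b : reg (fun m x => radfield m b x * r x) (w b).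
Proof.
have := regM (reg_wdir b) reg_sigma.
rewrite (_ : (fun x => w b x * 1) = w b); last by apply/funext => x; rewrite mulr1.
apply: reg_eq => [m|m x /enorm_gt0 r0].
  by apply: mMr; exact: mfun_smooth (smooth_radfield m b).
by rewrite /sigma -enorm_sq /wdir /radfield; field; rewrite lt0r_neq0.
Qed.

(** The limit of [|x|^2 * partial j (radfield m b)]; below, [radder2] and [radder3]
    are the limits of the derivatives of the products of fields, multiplied by the
    power of [|x|] that makes them homogeneous of degree [0]. *)
Definition radder b j (x : V) : R := dlt b j + (- 2) * (w b x * w j x).

Lemma reg_partial_radfield b j :
  reg (fun m x => partial j (radfield m b) x * r x ^+ 2) (radder b j).
Proof.
have := regD (regM (reg_cst (dlt b j)) reg_sigma)
  (regM (reg_cst (- 2)) (regM (reg_radfield b) (reg_radfield j))).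
rewrite (_ : (fun x => _ + _) = radder b j); last by apply/funext => x; rewrite mulr1.
apply: reg_eq => [m|m x _].
  by apply: mMr2; exact: mfun_smooth (smooth_partial j (smooth_radfield m b)).
rewrite partial_radfield /sigma -enorm_sq.
by move: (_ == _)%:R (reginv m x) (r x) (radfield m b x) (radfield m j x) => D Q S B J; ring.
Qed.

Lemma reg_radfield2 a b : reg (fun m => radfield2 m a b) (fun x => w a x * w b x).
Proof.
have := regM (reg_wdir a) (reg_radfield b).
apply: reg_eq => [m|m x /enorm_gt0 r0]; first exact: mfun_smooth (smooth_radfield2 m a b).
by rewrite /wdir /radfield2; field; rewrite lt0r_neq0.
Qed.

Definition radder2 a b j (x : V) : R := dlt a j * w b x + w a x * radder b j x.

Lemma reg_partial_radfield2 a b j :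
  reg (fun m x => partial j (radfield2 m a b) x * r x) (radder2 a b j).
Proof.
have := regD (regM (reg_cst (dlt a j)) (reg_radfield b))
  (regM (reg_wdir a) (reg_partial_radfield b j)).
apply: reg_eq => [m|m x /enorm_gt0 r0].
  by apply: mMr; exact: mfun_smooth (smooth_partial j (smooth_radfield2 m a b)).
rewrite partial_radfield2 /wdir.
move: (_ == _)%:R (partial j _ x) (radfield m b x) => D P B.
by field; rewrite lt0r_neq0.
Qed.

Lemma reg_radfield3 a b c :
  reg (fun m x => radfield3 m a b c x * r x) (fun x => w a x * w b x * w c x).
Proof.
have := regM (reg_radfield2 a b) (reg_radfield c).
apply: reg_eq => [m|m x _]; last by rewrite /radfield3 mulrA.
by apply: mMr; exact: mfun_smooth (smooth_radfield3 m a b c).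
Qed.

Definition radder3 a b c j (x : V) : R := radder2 a b j x * w c x + w a x * w b x * radder c j x.

Lemma reg_partial_radfield3 a b c j :
  reg (fun m x => partial j (radfield3 m a b c) x * r x ^+ 2) (radder3 a b c j).
Proof.
have := regD (regM (reg_partial_radfield2 a b j) (reg_radfield c))
  (regM (reg_radfield2 a b) (reg_partial_radfield c j)).
apply: reg_eq => [m|m x _].
  by apply: mMr2; exact: mfun_smooth (smooth_partial j (smooth_radfield3 m a b c)).
rewrite partial_radfield3.
move: (partial j _ x) (partial j _ x) (radfield m c x) (radfield2 m a b x) (r x) => P P' A B S.
by ring.
Qed.

Definition zero_int f := integ f /\ I f = 0.

Lemma zero_intD f g : zero_int f -> zero_int g -> zero_int (fun x => f x + g x).
Proof.
by move=> [f_ f0] [g_ g0]; split; [exact: integD|rewrite intD// f0 g0 addr0].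
Qed.

Lemma zero_intZ (c : R) f : zero_int f -> zero_int (fun x => c * f x).
Proof. by move=> [f_ f0]; split; [exact: integZ|rewrite intZ// f0 mulr0]. Qed.

Lemma zero_int_sum (J : finType) (F : J -> V -> R) :
  (forall l : J, zero_int (F l)) -> zero_int (fun x => \sum_(l : J) F l x).
Proof.
move=> F0; have F_ l : integ (F l) by have [] := F0 l.
split; first exact: integ_sum.
by rewrite int_sum// big1// => l _; have [] := F0 l.
Qed.

Lemma zero_int_eq f g : (0 < n)%N -> mfun g -> (forall x, x != 0 -> f x = g x) ->
  zero_int f -> zero_int g.
Proof.
move=> n0 mg fg [f_ f0]; have E := ae_n0 n0 fg; split; first exact: integ_ae_eq mg E f_.
by rewrite -f0; apply: esym; apply: int_ae_eq E => //; exact: integ_mfun f_.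
Qed.

Section limits.
Context (phi : nat -> V -> R) (u : 'I_n -> V -> R) (H : 'I_n -> 'I_n -> V -> R).
Hypothesis n3 : (3 < n)%N.
Hypothesis tphi : forall m, test_function (phi m).
Hypothesis phiu : forall a, cvg2 mu (fun m => partial a (phi m)) (u a).
Hypothesis phiH : forall a b, cvg2 mu (fun m => partial b (partial a (phi m))) (H a b).

Definition over_r a (x : V) : R := u a x / r x.
Local Notation Y := over_r.

Let n0 : (0 < n)%N. Proof. exact: ltn_trans n3. Qed.

Lemma L2_over_r a : L2 mu (Y a).
Proof. exact: hardy n3 (fun m => test_partial a (tphi m)) (phiu a) (phiH a). Qed.

Let L2_u a : L2 mu (u a). Proof. by have [] := phiu a. Qed.
Let L2_H a b : L2 mu (H a b). Proof. by have [] := phiH a b. Qed.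

Let cvg_mul k F G f g : mfun k -> bdd k -> cvg2 mu F f -> cvg2 mu G g ->
  (fun m => I (fun x => k x * (F m x * G m x))) @ \oo --> I (fun x => k x * (f x * g x)).
Proof.
move=> mk [C kC] Ff Gg; have := cvg2_int (cvg2_mulb mk kC Ff) Gg.
rewrite (_ : (fun m => _) = fun m => I (fun x => k x * (F m x * G m x))); last first.
  by apply/funext => m; congr Rintegral; apply/funext => x; rewrite mulrA.
by rewrite (_ : (fun x => k x * f x * g x) = fun x => k x * (f x * g x))//;
   apply/funext => x; rewrite mulrA.
Qed.

Let cvg0 (s : nat -> R) (l : R) : (forall m, s m = 0) -> s @ \oo --> l -> l = 0.
Proof.
move=> s0; rewrite (_ : s = fun=> 0); last by apply/funext.
by move=> L; rewrite -(cvg_lim (@norm_hausdorff _ _) L) lim_cst.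
Qed.

Lemma hessian_ibp k a b c : smooth k -> bdd k -> (forall j, bdd (partial j k)) ->
  I (fun x => k x * (H a b x * H c c x)) - I (fun x => k x * (H a c x * H b c x))
  + I (fun x => partial b k x * (u a x * H c c x))
  - I (fun x => partial c k x * (u a x * H b c x)) = 0.
Proof.
move=> sk bk bdk; have mk := mfun_smooth sk.
have mdk j : mfun (partial j k) := mfun_smooth (smooth_partial j sk).
have Z m := test_hessian_ibp a b c (tphi m) sk; apply: cvg0 Z _.
apply: cvgB; last exact: (cvg_mul (mdk c) (bdk c) (phiu a) (phiH b c)).
apply: cvgD; last exact: (cvg_mul (mdk b) (bdk b) (phiu a) (phiH c c)).
apply: cvgB; first exact: (cvg_mul mk bk (phiH a b) (phiH c c)).
exact: (cvg_mul mk bk (phiH a c) (phiH b c)).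
Qed.

Lemma gradient_ibp k a b c : smooth k -> bdd k -> (forall j, bdd (partial j k)) ->
  I (fun x => partial c k x * (u a x * u b x)) + I (fun x => k x * (H a c x * u b x))
  + I (fun x => k x * (u a x * H b c x)) = 0.
Proof.
move=> sk bk bdk; have mk := mfun_smooth sk.
have mdk j : mfun (partial j k) := mfun_smooth (smooth_partial j sk).
have Z m := test_gradient_ibp a b c (tphi m) sk; apply: cvg0 Z _.
apply: cvgD; last exact: (cvg_mul mk bk (phiu a) (phiH b c)).
apply: cvgD; first exact: (cvg_mul (mdk c) (bdk c) (phiu a) (phiu b)).
exact: (cvg_mul mk bk (phiH a c) (phiu b)).
Qed.

Let ae_int f g : mfun f -> mfun g -> (forall x, x != 0 -> f x = g x) -> I f = I g.
Proof. by move=> mf mg fg; apply: int_ae_eq => //; exact: ae_n0. Qed.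

Let mM3 f g h : mfun f -> mfun g -> mfun h -> mfun (fun x => f x * (g x * h x)).
Proof. by move=> mf mg mh; apply: measurable_funM => //; exact: measurable_funM. Qed.

(** The gradient of the multiplier is singular like [1/|x|]; this factor is moved to
    the first derivative of the function, which bears it by Hardy's inequality. *)
Lemma hessian_ibp_reg (k : nat -> V -> R) k0 (D : 'I_n -> V -> R) a b c :
  (forall m, smooth (k m)) -> (forall m, bdd (k m)) -> (forall m j, bdd (partial j (k m))) ->
  reg k k0 -> (forall j, reg (fun m x => partial j (k m) x * r x) (D j)) ->
  zero_int (fun x => k0 x * (H a b x * H c c x) - k0 x * (H a c x * H b c x)
    + D b x * (Y a x * H c c x) - D c x * (Y a x * H b c x)).
Proof.
move=> sk bk bdk kk0 dk.
have [i1 l1] := reg_int n0 kk0 (L2_H a b) (L2_H c c).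
have [i2 l2] := reg_int n0 kk0 (L2_H a c) (L2_H b c).
have [i3 l3] := reg_int n0 (dk b) (L2_over_r a) (L2_H c c).
have [i4 l4] := reg_int n0 (dk c) (L2_over_r a) (L2_H b c).
split; first exact: integB (integD (integB i1 i2) i3) i4.
rewrite (intB (integD (integB i1 i2) i3) i4) (intD (integB i1 i2) i3) (intB i1 i2).
have E j m h : L2 mu h -> I (fun x => partial j (k m) x * (u a x * h x)) =
    I (fun x => partial j (k m) x * r x * (Y a x * h x)).
  move=> [mh _].
  have [mu_ _] := L2_u a; have [mY _] := L2_over_r a.
  have mdk := mfun_smooth (smooth_partial j (sk m)).
  apply: ae_int; [exact: mM3| |].
    by apply: mM3 => //; apply: measurable_funM => //; exact: mfun_enorm.
  move=> x x0; rewrite /over_r; field; rewrite lt0r_neq0//; exact: enorm_gt0.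
have Z m := hessian_ibp a b c (sk m) (bk m) (bdk m).
apply: cvg0 Z _.
apply: cvgB; last by under eq_fun do rewrite E//.
apply: cvgD; last by under eq_fun do rewrite E//.
exact: cvgB.
Qed.

(** Here the multiplier itself is singular like [1/|x|] and its gradient like
    [1/|x|^2], but they multiply one and two first derivatives. *)
Lemma gradient_ibp_reg (k : nat -> V -> R) k0 D a b c :
  (forall m, smooth (k m)) -> (forall m, bdd (k m)) -> (forall m j, bdd (partial j (k m))) ->
  reg (fun m x => k m x * r x) k0 -> reg (fun m x => partial c (k m) x * r x ^+ 2) D ->
  zero_int (fun x => D x * (Y a x * Y b x) + k0 x * (H a c x * Y b x)
    + k0 x * (Y a x * H b c x)).
Proof.
move=> sk bk bdk kk0 dk.
have [i1 l1] := reg_int n0 dk (L2_over_r a) (L2_over_r b).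
have [i2 l2] := reg_int n0 kk0 (L2_H a c) (L2_over_r b).
have [i3 l3] := reg_int n0 kk0 (L2_over_r a) (L2_H b c).
split; first exact: integD (integD i1 i2) i3.
rewrite (intD (integD i1 i2) i3) (intD i1 i2).
have mY i : mfun (Y i) by have [] := L2_over_r i.
have mu_ i : mfun (u i) by have [] := L2_u i.
have mH i j : mfun (H i j) by have [] := L2_H i j.
have mk m := mfun_smooth (sk m).
have mdk m := mfun_smooth (smooth_partial c (sk m)).
have mr := mfun_enorm.
have mkr m : mfun (fun x => k m x * r x) by exact: measurable_funM.
have E1 m : I (fun x => partial c (k m) x * (u a x * u b x)) =
    I (fun x => partial c (k m) x * r x ^+ 2 * (Y a x * Y b x)).
  apply: ae_int; [exact: mM3| |].
    by apply: mM3 => //; apply: measurable_funM => //; exact: measurable_funX.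
  by move=> x x0; rewrite /over_r; field; rewrite lt0r_neq0//; exact: enorm_gt0.
have E2 m : I (fun x => k m x * (H a c x * u b x)) = I (fun x => k m x * r x * (H a c x * Y b x)).
  apply: ae_int; [exact: mM3|exact: mM3|].
  by move=> x x0; rewrite /over_r; field; rewrite lt0r_neq0//; exact: enorm_gt0.
have E3 m : I (fun x => k m x * (u a x * H b c x)) = I (fun x => k m x * r x * (Y a x * H b c x)).
  apply: ae_int; [exact: mM3|exact: mM3|].
  by move=> x x0; rewrite /over_r; field; rewrite lt0r_neq0//; exact: enorm_gt0.
have Z m := gradient_ibp a b c (sk m) (bk m) (bdk m).
apply: cvg0 Z _.
under eq_fun do rewrite E1 E2 E3.
by apply: cvgD => //; exact: cvgD.
Qed.

Lemma hessian_identity a b c :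
  zero_int (fun x => w a x * w b x * (H a b x * H c c x) - w a x * w b x * (H a c x * H b c x)
    + radder2 a b b x * (Y a x * H c c x) - radder2 a b c x * (Y a x * H b c x)).
Proof.
exact: (hessian_ibp_reg a b c (fun m => smooth_radfield2 m a b) (fun m => bdd_radfield2 m a b)
  (fun m j => bdd_partial_radfield2 m a b j) (reg_radfield2 a b) (reg_partial_radfield2 a b)).
Qed.

Lemma gradient_identity a b c d :
  zero_int (fun x => radder d c x * (Y a x * Y b x) + w d x * (H a c x * Y b x)
    + w d x * (Y a x * H b c x)).
Proof.
exact: (gradient_ibp_reg a b (fun m => smooth_radfield m d) (fun m => bdd_radfield m d)
  (fun m j => bdd_partial_radfield m d j) (reg_radfield d) (reg_partial_radfield d c)).
Qed.

Lemma gradient_identity3 a b c :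
  zero_int (fun x => radder3 a b c c x * (Y a x * Y b x)
    + w a x * w b x * w c x * (H a c x * Y b x) + w a x * w b x * w c x * (Y a x * H b c x)).
Proof.
exact: (gradient_ibp_reg a b (fun m => smooth_radfield3 m a b c) (fun m => bdd_radfield3 m a b c)
  (fun m j => bdd_partial_radfield3 m a b c j) (reg_radfield3 a b c)
  (reg_partial_radfield3 a b c c)).
Qed.

End limits.
End identities.

(** * The identity for real functions *)

(** Pointwise algebra: [w] is the unit radial vector, [y] the gradient divided by
    [|x|], and [H] the Hessian. The coefficients [d1], [d2], [d3] are those of the
    identities for [H] and [y], which are contracted here to invariants. *)
Section contractions.
Context (F : comRingType) (n : nat).
Implicit Types (w y : 'I_n -> F) (H : 'I_n -> 'I_n -> F) (a b c : 'I_n).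

Lemma sum_delta a y : \sum_(b < n) (a == b)%:R * y b = y a.
Proof.
rewrite (bigD1 a)//= eqxx mul1r big1 ?addr0// => b ba.
by rewrite eq_sym (negbTE ba) mul0r.
Qed.

Lemma sum_triple (f : 'I_n -> 'I_n -> 'I_n -> F) :
  \sum_(l : 'I_n * 'I_n * 'I_n) f l.1.1 l.1.2 l.2 =
  \sum_(a < n) \sum_(b < n) \sum_(c < n) f a b c.
Proof.
rewrite -(pair_bigA _ (fun (i : 'I_n * 'I_n) c => f i.1 i.2 c)) /=.
by rewrite -(pair_bigA _ (fun a b => \sum_(c < n) f a b c)).
Qed.

Lemma sum_pair (f : 'I_n -> 'I_n -> F) :
  \sum_(l : 'I_n * 'I_n) f l.1 l.2 = \sum_(a < n) \sum_(b < n) f a b.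
Proof. by rewrite -(pair_bigA _ (fun a b => f a b)). Qed.

Context (w y : 'I_n -> F) (H : 'I_n -> 'I_n -> F).
Hypothesis w1 : \sum_(a < n) w a ^+ 2 = 1.
Hypothesis Hsym : forall a b, H a b = H b a.

Let h a := \sum_(b < n) w b * H a b.
Let p := \sum_(a < n) w a * h a.
Let tau := \sum_(c < n) H c c.
Let z := \sum_(a < n) w a * y a.
Let T := \sum_(a < n) y a ^+ 2.
Let Q := \sum_(a < n) h a ^+ 2.
Let M := \sum_(a < n) y a * h a.
Let d1 b j : F := (b == j)%:R + (- 2) * (w b * w j).
Let d2 a b j : F := (a == j)%:R * w b + w a * d1 b j.
Let d3 a b c j : F := d2 a b j * w c + w a * w b * d1 c j.

Let hE a : \sum_(b < n) w b * H b a = h a.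
Proof. by apply: eq_bigr => b _; rewrite Hsym. Qed.

Let sum_d1 b (f : 'I_n -> F) : \sum_(j < n) d1 b j * f j = f b - 2 * (w b * \sum_(j < n) w j * f j).
Proof.
rewrite /d1; under eq_bigr do rewrite mulrDl.
rewrite big_split /= sum_delta; congr (_ + _).
rewrite -mulNr !mulr_sumr; apply: eq_bigr => j _; ring.
Qed.

Let sum_d2 a b (f : 'I_n -> F) : \sum_(j < n) d2 a b j * f j =
  w b * f a + w a * (f b - 2 * (w b * \sum_(j < n) w j * f j)).
Proof.
rewrite /d2; under eq_bigr do rewrite mulrDl -mulrA -[w a * _ * _]mulrA.
rewrite big_split /= sum_delta; congr (_ + _).
by rewrite -mulr_sumr sum_d1.
Qed.

Let trace_d1 : \sum_(j < n) d1 j j = n%:R - 2.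
Proof.
rewrite /d1 big_split /=; under eq_bigr do rewrite eqxx.
rewrite sumr_const card_ord; congr (_ + _).
by rewrite -mulr_sumr (eq_bigr (fun j => w j ^+ 2)) ?w1 ?mulr1// => j _; rewrite expr2.
Qed.

Let sum_ww : \sum_(j < n) w j * w j = 1.
Proof. by rewrite -w1; apply: eq_bigr => j _; rewrite expr2. Qed.

Let trace_d2 a : \sum_(j < n) d2 a j j = (n%:R - 1) * w a.
Proof.
rewrite /d2 big_split /= sum_delta -mulr_sumr trace_d1; ring.
Qed.

Lemma contract_hessian :
  \sum_(l : 'I_n * 'I_n * 'I_n)
    (w l.1.1 * w l.1.2 * (H l.1.1 l.1.2 * H l.2 l.2) - w l.1.1 * w l.1.2 * (H l.1.1 l.2 * H l.1.2 l.2)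
     + d2 l.1.1 l.1.2 l.1.2 * (y l.1.1 * H l.2 l.2) - d2 l.1.1 l.1.2 l.2 * (y l.1.1 * H l.1.2 l.2)) =
  p * tau - Q + (n%:R - 2) * (z * tau) - M + 2 * (z * p).
Proof.
rewrite sumrB big_split /= sumrB.
rewrite (sum_triple (fun a b c => w a * w b * (H a b * H c c))).
rewrite (sum_triple (fun a b c => w a * w b * (H a c * H b c))).
rewrite (sum_triple (fun a b c => d2 a b b * (y a * H c c))).
rewrite (sum_triple (fun a b c => d2 a b c * (y a * H b c))).
have E1 : \sum_(a < n) \sum_(b < n) \sum_(c < n) w a * w b * (H a b * H c c) = p * tau.
  rewrite /p mulr_suml; apply: eq_bigr => a _.
  transitivity (\sum_(b < n) (w a * (w b * H a b)) * tau); last by rewrite -mulr_suml -mulr_sumr.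
  by apply: eq_bigr => b _; rewrite /tau mulr_sumr; apply: eq_bigr => c _; rewrite !mulrA.
have E2 : \sum_(a < n) \sum_(b < n) \sum_(c < n) w a * w b * (H a c * H b c) = Q.
  rewrite /Q; under [RHS]eq_bigr => c _.
    rewrite expr2 -hE mulr_suml; under eq_bigr do rewrite mulr_sumr; over.
  rewrite [RHS]exchange_big; apply: eq_bigr => a _.
  rewrite [RHS]exchange_big; apply: eq_bigr => b _; apply: eq_bigr => c _ /=; ring.
have E3 : \sum_(a < n) \sum_(b < n) \sum_(c < n) d2 a b b * (y a * H c c) =
    (n%:R - 1) * (z * tau).
  rewrite /z mulr_suml mulr_sumr; apply: eq_bigr => a _.
  under eq_bigr => b _ do rewrite -mulr_sumr -mulr_sumr -/tau.
  by rewrite -mulr_suml trace_d2; ring.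
have E4 : \sum_(a < n) \sum_(b < n) \sum_(c < n) d2 a b c * (y a * H b c) =
    M + z * tau - 2 * (z * p).
  rewrite /M /z mulr_suml mulr_suml mulr_sumr -big_split -sumrB /=; apply: eq_bigr => a _.
  transitivity (y a * \sum_(b < n) \sum_(c < n) d2 a b c * H b c).
    rewrite mulr_sumr; apply: eq_bigr => b _; rewrite mulr_sumr; apply: eq_bigr => c _; ring.
  under eq_bigr => b _ do rewrite sum_d2 -/(h b).
  rewrite big_split /= hE -mulr_sumr sumrB -/tau -mulr_sumr -/p; ring.
by rewrite E1 E2 E3 E4; ring.
Qed.

Lemma contract_gradient :
  \sum_(l : 'I_n * 'I_n)
    (d1 l.2 l.2 * (y l.1 * y l.1) + w l.2 * (H l.1 l.2 * y l.1) + w l.2 * (y l.1 * H l.1 l.2)) =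
  (n%:R - 2) * T + 2 * M.
Proof.
rewrite (sum_pair (fun a c => d1 c c * (y a * y a) + w c * (H a c * y a) + w c * (y a * H a c))).
rewrite /T /M !mulr_sumr -big_split /=; apply: eq_bigr => a _.
rewrite !big_split /= -mulr_suml trace_d1 -addrA expr2; congr (_ + _).
rewrite /h mulr_sumr mulr_sumr -big_split; apply: eq_bigr => c _ /=; ring.
Qed.

Lemma contract_divergence :
  \sum_(l : 'I_n * 'I_n)
    (d1 l.1 l.2 * (y l.1 * y l.2) + w l.1 * (H l.1 l.2 * y l.2) + w l.1 * (y l.1 * H l.2 l.2)) =
  T - 2 * z ^+ 2 + M + z * tau.
Proof.
rewrite (sum_pair (fun a c => d1 a c * (y a * y c) + w a * (H a c * y c) + w a * (y a * H c c))).
under eq_bigr => a _ do rewrite !big_split /=.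
rewrite !big_split /=; congr (_ + _ + _).
- transitivity (\sum_(a < n) (y a ^+ 2 - 2 * (w a * y a * z))).
    apply: eq_bigr => a _.
    transitivity (y a * \sum_(c < n) d1 a c * y c).
      by rewrite mulr_sumr; apply: eq_bigr => c _; ring.
    by rewrite sum_d1 -/z; ring.
  by rewrite sumrB -mulr_sumr -mulr_suml -/z -/T expr2.
- rewrite exchange_big /M; apply: eq_bigr => c _ /=; rewrite -hE mulr_sumr.
  by apply: eq_bigr => a _; ring.
- rewrite /z mulr_suml; apply: eq_bigr => a _; rewrite /tau mulr_sumr.
  by apply: eq_bigr => c _; ring.
Qed.

Lemma contract_gradient3 :
  \sum_(l : 'I_n * 'I_n * 'I_n)
    (d3 l.1.1 l.1.2 l.2 l.2 * (y l.1.1 * y l.1.2)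
     + w l.1.1 * w l.1.2 * w l.2 * (H l.1.1 l.2 * y l.1.2)
     + w l.1.1 * w l.1.2 * w l.2 * (y l.1.1 * H l.1.2 l.2)) =
  (n%:R - 2) * z ^+ 2 + 2 * (z * p).
Proof.
rewrite !big_split /=.
rewrite (sum_triple (fun a b c => d3 a b c c * (y a * y b))).
rewrite (sum_triple (fun a b c => w a * w b * w c * (H a c * y b))).
rewrite (sum_triple (fun a b c => w a * w b * w c * (y a * H b c))).
have E1 : \sum_(a < n) \sum_(b < n) \sum_(c < n) d3 a b c c * (y a * y b) = (n%:R - 2) * z ^+ 2.
  rewrite expr2 /z mulr_suml mulr_sumr; apply: eq_bigr => a _; rewrite !mulr_sumr.
  apply: eq_bigr => b _; rewrite -mulr_suml /d3 big_split /= -mulr_sumr trace_d1 sum_d2 sum_ww.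
  ring.
have E2 : \sum_(a < n) \sum_(b < n) \sum_(c < n) w a * w b * w c * (H a c * y b) = z * p.
  rewrite mulrC /p mulr_suml; apply: eq_bigr => a _.
  transitivity (\sum_(b < n) w a * h a * (w b * y b)); last by rewrite -mulr_sumr.
  by apply: eq_bigr => b _; rewrite /h !mulr_sumr mulr_suml; apply: eq_bigr => c _; ring.
have E3 : \sum_(a < n) \sum_(b < n) \sum_(c < n) w a * w b * w c * (y a * H b c) = z * p.
  rewrite /z mulr_suml; apply: eq_bigr => a _; rewrite /p !mulr_sumr.
  by apply: eq_bigr => b _; rewrite /h !mulr_sumr; apply: eq_bigr => c _; ring.
by rewrite E1 E2 E3; ring.
Qed.

(** The two sides of the identity differ by a combination of the four quantities
    with vanishing integral. *)
Lemma decomposition :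
  2 * tau ^+ 2 = 2 * (p + (n%:R - 1) * z) ^+ 2 + 2 * (tau - (p + (n%:R - 1) * z)) ^+ 2
  + n%:R * (n%:R - 4) * \sum_(a < n) (y a - w a * z) ^+ 2
  + \sum_(a < n) (2 * (h a - w a * p) + (n%:R - 2) * (y a - w a * z)) ^+ 2
  + (4 * (p * tau - Q + (n%:R - 2) * (z * tau) - M + 2 * (z * p))
     + 4 * (T - 2 * z ^+ 2 + M + z * tau)
     - 2 * (n%:R - 2) * ((n%:R - 2) * T + 2 * M)
     - 2 * (n%:R + 2) * ((n%:R - 2) * z ^+ 2 + 2 * (z * p))).
Proof.
have E1 : \sum_(a < n) (y a - w a * z) ^+ 2 = T - z ^+ 2.
  transitivity (\sum_(a < n) (y a ^+ 2 - 2 * (w a * y a * z) + w a ^+ 2 * z ^+ 2)).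
    by apply: eq_bigr => a _; ring.
  by rewrite big_split sumrB /= -mulr_sumr -!mulr_suml w1 -/z -/T; ring.
have E2 : \sum_(a < n) (h a - w a * p) ^+ 2 = Q - p ^+ 2.
  transitivity (\sum_(a < n) (h a ^+ 2 - 2 * (w a * h a * p) + w a ^+ 2 * p ^+ 2)).
    by apply: eq_bigr => a _; ring.
  by rewrite big_split sumrB /= -mulr_sumr -!mulr_suml w1 -/p -/Q; ring.
have E3 : \sum_(a < n) (h a - w a * p) * (y a - w a * z) = M - p * z.
  transitivity (\sum_(a < n) (y a * h a - w a * h a * z - w a * y a * p + w a ^+ 2 * (p * z))).
    by apply: eq_bigr => a _; ring.
  by rewrite big_split !sumrB /= -!mulr_suml w1 -/z -/p -/M; ring.
have -> : \sum_(a < n) (2 * (h a - w a * p) + (n%:R - 2) * (y a - w a * z)) ^+ 2 =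
    4 * (Q - p ^+ 2) + 4 * (n%:R - 2) * (M - p * z) + (n%:R - 2) ^+ 2 * (T - z ^+ 2).
  rewrite -E1 -E2 -E3 !mulr_sumr -!big_split /=; apply: eq_bigr => a _; ring.
rewrite E1; ring.
Qed.

End contractions.

Section real_identity.
Context (R : realType) (n : nat).
Implicit Types (f g h : 'rV[R]_n -> R) (a b c : 'I_n).
Local Notation mu := (lebesgue_rV R n).
Local Notation integ f := (mu.-integrable setT (EFin \o f)).
Local Notation mfun f := (measurable_fun setT (f : 'rV[R]_n -> R)).
Local Notation I f := (\int[mu]_x f x).
Local Notation V := 'rV[R]_n.
Local Notation w := (@wdir R n).

Local Opaque partial.

Context (phi : nat -> V -> R) (u : 'I_n -> V -> R) (H : 'I_n -> 'I_n -> V -> R).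
Hypothesis n3 : (3 < n)%N.
Hypothesis tphi : forall m, test_function (phi m).
Hypothesis phiu : forall a, cvg2 mu (fun m => partial a (phi m)) (u a).
Hypothesis phiH : forall a b, cvg2 mu (fun m => partial b (partial a (phi m))) (H a b).
Hypothesis Hsym : forall a b, H a b = H b a.
Local Notation Y := (over_r u).

Definition rad_over_r (x : V) : R := \sum_(a < n) w a x * Y a x.
Definition hess_rad a (x : V) : R := \sum_(b < n) w b x * H a b x.
Definition rad_rad (x : V) : R := \sum_(a < n) w a x * hess_rad a x.
Definition trace_hess (x : V) : R := \sum_(c < n) H c c x.
(** The radial part of the Laplacian. *)
Definition rad_part (x : V) : R := rad_rad x + (n%:R - 1) * rad_over_r x.
(** A spherical derivative divided by [|x|]. *)
Definition sph_over_r a (x : V) : R := Y a x - w a x * rad_over_r x.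
(** The radial derivative of a spherical derivative: since [wdir] is constant along
    rays, the coefficients are not differentiated. *)
Definition rad_sph a (x : V) : R := hess_rad a x - w a x * rad_rad x.

Let n0 : (0 < n)%N. Proof. exact: ltn_trans n3. Qed.
Let Y_ a : L2 mu (Y a). Proof. exact: L2_over_r n3 tphi phiu phiH a. Qed.
Let H_ a b : L2 mu (H a b). Proof. by have [] := phiH a b. Qed.

Lemma L2_wdir a f : L2 mu f -> L2 mu (fun x => w a x * f x).
Proof. by move=> f_; exact: (L2_mulb (mfun_wdir a) (wdir_le1 a) f_). Qed.

Lemma L2_rad_over_r : L2 mu rad_over_r.
Proof. by apply: L2_sum => a; exact: L2_wdir. Qed.

Lemma L2_hess_rad a : L2 mu (hess_rad a).
Proof. by apply: L2_sum => b; exact: L2_wdir. Qed.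

Lemma L2_rad_rad : L2 mu rad_rad.
Proof. by apply: L2_sum => a; apply: L2_wdir; exact: L2_hess_rad. Qed.

Lemma L2_trace_hess : L2 mu trace_hess.
Proof. exact: L2_sum. Qed.

Lemma L2_rad_part : L2 mu rad_part.
Proof. by apply: L2D; [exact: L2_rad_rad|apply: L2Z; exact: L2_rad_over_r]. Qed.

Lemma L2_sph_over_r a : L2 mu (sph_over_r a).
Proof. by apply: L2B => //; apply: L2_wdir; exact: L2_rad_over_r. Qed.

Lemma L2_rad_sph a : L2 mu (rad_sph a).
Proof. by apply: L2B; [exact: L2_hess_rad|apply: L2_wdir; exact: L2_rad_rad]. Qed.

Let halve (a b c N s t : R) : 2 * a - (2 * b + 2 * c + N * s + 4 * t) = 0 ->
  a = b + c + N / 2 * s + 2 * t.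
Proof. by lra. Qed.

(** By [decomposition], the two sides differ by integrals of contracted identities. *)
Theorem real_identity :
  I (fun x => trace_hess x ^+ 2) =
  I (fun x => rad_part x ^+ 2) + I (fun x => (trace_hess x - rad_part x) ^+ 2)
  + n%:R * (n%:R - 4) / 2 * \sum_(a < n) I (fun x => sph_over_r a x ^+ 2)
  + 2 * \sum_(a < n) I (fun x => (rad_sph a x + (n%:R - 2) / 2 * sph_over_r a x) ^+ 2).
Proof.
have z1 := zero_int_sum (fun l : 'I_n * 'I_n * 'I_n =>
  hessian_identity n3 tphi phiu phiH l.1.1 l.1.2 l.2).
have z2 := zero_int_sum (fun l : 'I_n * 'I_n =>
  gradient_identity n3 tphi phiu phiH l.1 l.1 l.2 l.2).
have z3 := zero_int_sum (fun l : 'I_n * 'I_n =>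
  gradient_identity n3 tphi phiu phiH l.1 l.2 l.2 l.1).
have z4 := zero_int_sum (fun l : 'I_n * 'I_n * 'I_n =>
  gradient_identity3 n3 tphi phiu phiH l.1.1 l.1.2 l.2).
have := zero_intD (zero_intD (zero_intZ 4 z1) (zero_intZ 4 z3))
  (zero_intD (zero_intZ (- 2 * (n%:R - 2)) z2) (zero_intZ (- 2 * (n%:R + 2)) z4)).
set Z := (fun x => _ + _) => zZ.
pose A x := 2 * rad_part x ^+ 2 + 2 * (trace_hess x - rad_part x) ^+ 2
  + n%:R * (n%:R - 4) * \sum_(a < n) sph_over_r a x ^+ 2
  + 4 * \sum_(a < n) (rad_sph a x + (n%:R - 2) / 2 * sph_over_r a x) ^+ 2.
have iT := integ_sq L2_trace_hess.
have iA := integ_sq L2_rad_part.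
have iB := integ_sq (L2B L2_trace_hess L2_rad_part).
have iv a := integ_sq (L2_sph_over_r a).
have iS a := integ_sq (L2D (L2_rad_sph a) (L2Z ((n%:R - 2) / 2) (L2_sph_over_r a))).
have iAA := integD (integD (integD (integZ 2 iA) (integZ 2 iB))
  (integZ (n%:R * (n%:R - 4)) (integ_sum (index_enum 'I_n) iv))) (integZ 4 (integ_sum (index_enum 'I_n) iS)).
have E x : x != 0 -> Z x = 2 * trace_hess x ^+ 2 - A x.
  move=> x0; have w1 := sum_wdir_sq x0.
  have Hs a b : H a b x = H b a x by rewrite Hsym.
  have D := decomposition (fun a => Y a x) (fun a b => H a b x) w1.
  have c1 := contract_hessian (fun a => Y a x) w1 Hs.
  have c2 := contract_gradient (fun a => Y a x) (fun a b => H a b x) w1.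
  have c3 := contract_divergence (fun a => w a x) (fun a => Y a x) Hs.
  have c4 := contract_gradient3 (fun a => Y a x) (fun a b => H a b x) w1.
  rewrite -c1 -c2 -c3 -c4 in D.
  rewrite /A /trace_hess D /Z /=.
  have -> : 4 * \sum_(a < n) (rad_sph a x + (n%:R - 2) / 2 * sph_over_r a x) ^+ 2 =
      \sum_(a < n) (2 * rad_sph a x + (n%:R - 2) * sph_over_r a x) ^+ 2.
    by rewrite mulr_sumr; apply: eq_bigr => a _; field.
  rewrite /rad_part /rad_sph /sph_over_r /rad_rad /hess_rad /rad_over_r /trace_hess.
  rewrite /radder3 /radder2 /radder.
  set s1 := \sum_(l : _ * _ * _) _; set s2 := \sum_(l : _ * _ * _) _.
  set s3 := \sum_(l : _ * _) _; set s4 := \sum_(l : _ * _) _.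
  ring.
have [_ Z0] := zero_int_eq n0 (integ_mfun (integB (integZ 2 iT) iAA)) E zZ.
move: Z0; rewrite (intB (integZ 2 iT) iAA).
rewrite (intD _ (integZ 4 (integ_sum (index_enum 'I_n) iS))); last exact: integD (integD (integZ 2 iA) (integZ 2 iB)) (integZ _ (integ_sum (index_enum 'I_n) iv)).
rewrite (intD (integD (integZ 2 iA) (integZ 2 iB)) (integZ _ (integ_sum (index_enum 'I_n) iv))).
rewrite (intD (integZ 2 iA) (integZ 2 iB)).
rewrite (intZ 2 iT) (intZ 2 iA) (intZ 2 iB) (intZ _ (integ_sum (index_enum 'I_n) iv)).
rewrite (intZ 4 (integ_sum (index_enum 'I_n) iS)) (int_sum (index_enum 'I_n) iv) (int_sum (index_enum 'I_n) iS).
exact: halve.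
Qed.

End real_identity.

(** * Weak derivatives of real functions *)

Section weak_derivatives.
Context (R : realType) (n : nat).
Implicit Types (f g h k u v phi psi : 'rV[R]_n -> R) (i j a b c : 'I_n).
Local Notation mu := (lebesgue_rV R n).
Local Notation integ f := (mu.-integrable setT (EFin \o f)).
Local Notation mfun f := (measurable_fun setT (f : 'rV[R]_n -> R)).
Local Notation I f := (\int[mu]_x f x).
Local Notation V := 'rV[R]_n.
Local Notation w := (@wdir R n).
Local Notation r := (@enorm R n).
Local Notation Q M := (\1_(@cube R n M) : V -> R).

Local Opaque partial.

Let mfunM f g : mfun f -> mfun g -> mfun (fun x => f x * g x).
Proof. exact: measurable_funM. Qed.

Let mfunD f g : mfun f -> mfun g -> mfun (fun x => f x + g x).
Proof. exact: measurable_funD. Qed.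

Definition locint f := mfun f /\ forall M, integ (fun x => Q M x * `|f x|).

Let mQ M : mfun (Q M). Proof. by apply: measurable_indic; exact: in_box_measurable. Qed.

Let Q0 M x : 0 <= Q M x. Proof. by rewrite indicE. Qed.

Let lim_unique (s : nat -> R) (l l' : R) : s @ \oo --> l -> s @ \oo --> l' -> l = l'.
Proof. by move=> L L'; rewrite -(cvg_lim (@norm_hausdorff _ _) L) (cvg_lim _ L'). Qed.

Let mQf M f : mfun f -> mfun (fun x => Q M x * `|f x|).
Proof. by move=> mf; apply: measurable_funM => //; exact: measurableT_comp. Qed.

Let Qnorm M x (t : R) : `|Q M x * `|t| | = Q M x * `|t|.
Proof. by rewrite ger0_norm// mulr_ge0. Qed.

Lemma L2_locint f : L2 mu f -> locint f.
Proof.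
move=> f_; have [mf _] := f_; split => // M; apply: integM.
  split => //; apply: integ_dom (indic_integ (in_box_measurable (fun=> - M) (fun=> M)) (in_box_finite _ _)).
    by apply: measurable_funX.
  by move=> x; rewrite indicE; case: (_ \in _); rewrite /= ?expr1n ?expr0n /= ?normr0 ?normr1.
by apply: L2_dom f_ => [|x]; [exact: measurableT_comp|rewrite normr_id].
Qed.

Lemma locint_dom f g : mfun g -> (forall x, `|g x| <= `|f x|) -> locint f -> locint g.
Proof.
move=> mg gf [mf f_]; split => // M; apply: integ_dom (f_ M); first exact: mQf.
by move=> x; rewrite Qnorm ler_wpM2l.
Qed.

Lemma locintD f g : locint f -> locint g -> locint (fun x => f x + g x).
Proof.
move=> [mf f_] [mg g_]; have m := mfunD mf mg; split => // M.
apply: integ_dom (mQf M m) _ (integD (f_ M) (g_ M)) => x.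
by rewrite Qnorm -mulrDr ler_wpM2l// ler_normD.
Qed.

Lemma locint_smoothM k f : smooth k -> locint f -> locint (fun x => k x * f x).
Proof.
move=> sk [mf f_]; have m := mfunM (mfun_smooth sk) mf; split => // M.
have [C C0 kC] := continuous_ball_bounded `|M| (smooth_continuous sk).
apply: integ_dom (mQf M m) _ (integZ C (f_ M)) => x.
rewrite Qnorm indicE; have [xM|_] := boolP (x \in _); last by rewrite !mul0r mulr0.
by rewrite !mul1r normrM ler_wpM2r// kC// cube_norm//; exact: set_mem xM.
Qed.

Lemma locintZ (c : R) f : locint f -> locint (fun x => c * f x).
Proof. exact: locint_smoothM (@smooth_cst R n c). Qed.

Lemma locint_sum (J : Type) (s : seq J) (F : J -> V -> R) : (forall l, locint (F l)) ->
  locint (fun x => \sum_(l <- s) F l x).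
Proof.
move=> F_; elim: s => [|l s IH].
  rewrite (_ : (fun x => _) = fun=> 0); first exact/L2_locint/L20.
  by apply/funext => x; rewrite big_nil.
rewrite (_ : (fun x => _) = fun x => F l x + \sum_(m <- s) F m x); first exact: locintD.
by apply/funext => x; rewrite big_cons.
Qed.

Lemma locint_wdir a f : locint f -> locint (fun x => w a x * f x).
Proof.
move=> f_; have [mf _] := f_; apply: locint_dom f_; first exact: mfunM (mfun_wdir a) mf.
by move=> x; rewrite normrM ler_piMl// wdir_le1.
Qed.

Lemma locint_ae f g : mfun g -> {ae mu, forall x, f x = g x} -> locint f -> locint g.
Proof.
move=> mg fg [mf f_]; split => // M; apply: integ_ae_eq (f_ M); first exact: mQf.
by move: fg; apply: filterS => x ->.
Qed.

Lemma locint_test f phi : locint f -> test_function phi -> integ (fun x => f x * phi x).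
Proof.
move=> [mf f_] tp; have [C C0 pC] := test_bounded tp.
have /test_functionP[sp [M sM]] := tp.
apply: integ_dom (integZ C (f_ (M + 1))); first exact: mfunM mf (mfun_smooth sp).
move=> x; rewrite indicE; have [xM|xM] := leP `|x| M.
  rewrite mem_set ?mul1r; last by apply: norm_cube; rewrite (le_lt_trans xM)// ltrDl.
  by rewrite normrM mulrC ler_wpM2r.
by rewrite sM// mulr0 normr0 mulr_ge0// mulr_ge0.
Qed.

Lemma locint_lim (F : nat -> V -> R) f g : (0 < n)%N ->
  (forall m, mfun (F m)) -> mfun f -> locint g ->
  (forall m x, x != 0 -> `|F m x| <= `|g x|) ->
  (forall x, x != 0 -> F ^~ x @ \oo --> f x) ->
  [/\ forall m, locint (F m), locint f & forall phi, test_function phi ->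
      (fun m => I (fun x => F m x * phi x)) @ \oo --> I (fun x => f x * phi x)].
Proof.
move=> n0 mF mf g_ Fg Ff.
have main m : locint (F m).
  split => // M; have [mg {}g_] := g_.
  have [] := @int_dct _ _ _ mu (fun=> fun x => Q M x * `|F m x|) (fun x => Q M x * `|F m x|)
    _ (fun=> mQf M (mF m)) (mQf M (mF m)) (g_ M) => //.
    by apply: ae_n0 => // x _; exact: cvg_cst.
  by apply: ae_n0 => // x x0 p; rewrite Qnorm ler_wpM2l// Fg.
split => //.
  split => // M; have [mg {}g_] := g_.
  have [] := @int_dct _ _ _ mu (fun m x => Q M x * `|F m x|) (fun x => Q M x * `|f x|)
    _ (fun m => mQf M (mF m)) (mQf M mf) (g_ M) => //.
    apply: ae_n0 => // x x0; apply: cvgM; first exact: cvg_cst.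
    by apply: cvg_norm; exact: Ff.
  by apply: ae_n0 => // x x0 p; rewrite Qnorm ler_wpM2l// Fg.
move=> phi tp; have mp := mfun_smooth (test_smooth tp).
have [] := @int_dct _ _ _ mu (fun m x => F m x * phi x) (fun x => f x * phi x)
  _ (fun m => mfunM (mF m) mp) (mfunM mf mp)
  (integ_norm (locint_test g_ tp)) => //.
  by apply: ae_n0 => // x x0; apply: cvgM; [exact: Ff|exact: cvg_cst].
by apply: ae_n0 => // x x0 m; rewrite !normrM ler_wpM2r// Fg.
Qed.

Definition wd j u v := [/\ locint u, locint v & forall phi, test_function phi ->
  I (fun x => u x * partial j phi x) = - I (fun x => v x * phi x)].

Lemma wdD j u v u' v' : wd j u v -> wd j u' v' ->
  wd j (fun x => u x + u' x) (fun x => v x + v' x).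
Proof.
move=> [u_ v_ uv] [u_' v_' uv']; split; [exact: locintD|exact: locintD|move=> phi tp].
have D f g psi : locint f -> locint g -> test_function psi ->
    I (fun x => (f x + g x) * psi x) = I (fun x => f x * psi x) + I (fun x => g x * psi x).
  move=> f_ g_ tpsi; rewrite -(intD (locint_test f_ tpsi) (locint_test g_ tpsi)).
  by congr Rintegral; apply/funext => x; rewrite mulrDl.
apply: etrans (D _ _ _ u_ u_' (test_partial j tp)) _.
by rewrite (D _ _ _ v_ v_' tp) (uv _ tp) (uv' _ tp) opprD.
Qed.

Lemma wdZ j (c : R) u v : wd j u v -> wd j (fun x => c * u x) (fun x => c * v x).
Proof.
move=> [u_ v_ uv]; split; [exact: locintZ|exact: locintZ|move=> phi tp].
have Z f psi : locint f -> test_function psi ->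
    I (fun x => (c * f x) * psi x) = c * I (fun x => f x * psi x).
  move=> f_ tpsi; rewrite -(intZ c (locint_test f_ tpsi)).
  by congr Rintegral; apply/funext => x; rewrite mulrA.
apply: etrans (Z _ _ u_ (test_partial j tp)) _.
by rewrite (Z _ _ v_ tp) (uv _ tp) mulrN.
Qed.

Lemma wdB j u v u' v' : wd j u v -> wd j u' v' ->
  wd j (fun x => u x - u' x) (fun x => v x - v' x).
Proof.
move=> d /(wdZ (-1)) /(wdD d).
rewrite (_ : (fun x => u x + _) = fun x => u x - u' x); last first.
  by apply/funext => x; rewrite mulN1r.
by rewrite (_ : (fun x => v x + _) = fun x => v x - v' x)//; apply/funext => x; rewrite mulN1r.
Qed.

Lemma wd0 j : wd j (fun=> 0) (fun=> 0).
Proof.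
have l0 : locint (fun=> 0) by exact/L2_locint/L20.
split => // phi tp; under eq_fun do rewrite mul0r; under [in RHS]eq_fun do rewrite mul0r.
by rewrite Rintegral_cst ?mul0r ?oppr0.
Qed.

Lemma wd_sum j (J : Type) (s : seq J) (F G : J -> V -> R) : (forall l, wd j (F l) (G l)) ->
  wd j (fun x => \sum_(l <- s) F l x) (fun x => \sum_(l <- s) G l x).
Proof.
move=> FG; elim: s => [|l s IH].
  have := wd0 j; rewrite (_ : (fun x => \sum_(l <- [::]) F l x) = fun=> 0); last first.
    by apply/funext => x; rewrite big_nil.
  by rewrite (_ : (fun x => \sum_(l <- [::]) G l x) = fun=> 0)//; apply/funext => x; rewrite big_nil.
have := wdD (FG l) IH.
rewrite (_ : (fun x => F l x + _) = fun x => \sum_(m <- l :: s) F m x); last first.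
  by apply/funext => x; rewrite big_cons.
by rewrite (_ : (fun x => G l x + _) = fun x => \sum_(m <- l :: s) G m x)//;
  apply/funext => x; rewrite big_cons.
Qed.

Lemma wd_ae j u v u' v' : mfun u' -> mfun v' -> {ae mu, forall x, u x = u' x} ->
  {ae mu, forall x, v x = v' x} -> wd j u v -> wd j u' v'.
Proof.
move=> mu' mv' uu vv [u_ v_ uv]; split; [exact: locint_ae uu u_|exact: locint_ae vv v_|].
move=> phi tp.
have E f f' psi : mfun f -> mfun f' -> {ae mu, forall x, f x = f' x} -> test_function psi ->
    I (fun x => f x * psi x) = I (fun x => f' x * psi x).
  move=> mf mf' ff tpsi; have mp := mfun_smooth (test_smooth tpsi).
  apply: int_ae_eq (mfunM mf mp) (mfunM mf' mp) _.
  by move: ff; apply: filterS => x ->.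
apply: etrans (esym (E _ _ _ u_.1 mu' uu (test_partial j tp))) _.
by rewrite -(E _ _ _ v_.1 mv' vv tp) (uv _ tp).
Qed.

Lemma wd_unique j u v v' : wd j u v -> wd j u v' -> {ae mu, forall x, v x = v' x}.
Proof.
move=> [u_ v_ uv] [_ v_' uv'].
have B := locintD v_ (locintZ (-1) v_'); have [mB iB] := B.
have := fundamental_lemma mB iB; have H phi : test_function phi ->
    I (fun x => (v x + -1 * v' x) * phi x) = 0.
  move=> tp.
  have E : (fun x => (v x + -1 * v' x) * phi x) = fun x => v x * phi x - v' x * phi x.
    by apply/funext => x; ring.
  rewrite E (intB (locint_test v_ tp) (locint_test v_' tp)).
  by apply/eqP; rewrite subr_eq0 -eqr_opp -(uv _ tp) -(uv' _ tp).
by move=> /(_ H); apply: filterS => x /eqP; rewrite mulN1r subr_eq0 => /eqP.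
Qed.

Lemma wd_cvg2 j (phi : nat -> V -> R) u v : (forall m, test_function (phi m)) ->
  cvg2 mu phi u -> cvg2 mu (fun m => partial j (phi m)) v -> wd j u v.
Proof.
move=> tphi pu dv; have [_ u_ _] := pu; have [_ v_ _] := dv.
split; [exact: L2_locint|exact: L2_locint|move=> psi tp].
have L1 := cvg2_int pu (cvg2_cst (L2_test (test_partial j tp))).
have L2' : (fun m => - I (fun x => partial j (phi m) x * psi x)) @ \oo --> - I (fun x => v x * psi x).
  by apply: cvgN; exact: cvg2_int dv (cvg2_cst (L2_test tp)).
have E : (fun m => I (fun x => phi m x * partial j psi x)) =
    (fun m => - I (fun x => partial j (phi m) x * psi x)).
  apply/funext => m; have := int_by_parts j (test_smooth (tphi m)) tp.
  by move=> ->; rewrite opprK.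
by rewrite E in L1; exact: lim_unique L1 L2'.
Qed.

Let rearrange (A B C D : R) : A + B = - C -> C = D -> B = - (D + A).
Proof. by move=> AB <-; lra. Qed.

(** Product rule for a factor that is smooth away from the origin, approximated by
    smooth functions with controlled derivatives. *)
Lemma wdM j u v (k : nat -> V -> R) k0 d0 kb db : (0 < n)%N -> wd j u v ->
  (forall m, smooth (k m)) -> mfun k0 -> mfun d0 ->
  (forall m x, x != 0 -> `|k m x| <= `|kb x|) ->
  (forall m x, x != 0 -> `|partial j (k m) x| <= `|db x|) ->
  (forall x, x != 0 -> k ^~ x @ \oo --> k0 x) ->
  (forall x, x != 0 -> (fun m => partial j (k m) x) @ \oo --> d0 x) ->
  locint (fun x => kb x * u x) -> locint (fun x => kb x * v x) -> locint (fun x => db x * u x) ->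
  wd j (fun x => k0 x * u x) (fun x => k0 x * v x + d0 x * u x).
Proof.
move=> n0 [u_ v_ uv] sk mk0 md0 kkb ddb kk0 dd0 ku kv du.
have [mu_ _] := u_; have [mv _] := v_.
have mk m := mfun_smooth (sk m); have mdk m := mfun_smooth (smooth_partial j (sk m)).
have b (p q s : R) : `|p| <= `|q| -> `|p * s| <= `|q * s|.
  by move=> pq; rewrite !normrM ler_wpM2r.
have c (p : nat -> R) (q s : R) : p @ \oo --> q -> (fun m => p m * s) @ \oo --> q * s.
  by move=> pq; apply: cvgM => //; exact: cvg_cst.
have [l1 l1' L1] := locint_lim n0 (fun m => mfunM (mk m) mu_) (mfunM mk0 mu_) ku
  (fun m x x0 => b _ _ _ (kkb m x x0)) (fun x x0 => c _ _ _ (kk0 x x0)).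
have [l2 l2' L2] := locint_lim n0 (fun m => mfunM (mk m) mv) (mfunM mk0 mv) kv
  (fun m x x0 => b _ _ _ (kkb m x x0)) (fun x x0 => c _ _ _ (kk0 x x0)).
have [l3 l3' L3] := locint_lim n0 (fun m => mfunM (mdk m) mu_) (mfunM md0 mu_) du
  (fun m x x0 => b _ _ _ (ddb m x x0)) (fun x x0 => c _ _ _ (dd0 x x0)).
split => //; first exact: locintD.
move=> phi tp.
have E m : I (fun x => k m x * u x * partial j phi x) =
    - (I (fun x => k m x * v x * phi x) + I (fun x => partial j (k m) x * u x * phi x)).
  have B := uv _ (testMl (sk m) tp).
  have i1 := locint_test (l1 m) (test_partial j tp).
  have i3 := locint_test (l3 m) tp.
  have E1 : I (fun x => u x * partial j (fun x => k m x * phi x) x) =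
     I (fun x => partial j (k m) x * u x * phi x) + I (fun x => k m x * u x * partial j phi x).
    rewrite -(intD i3 i1); congr Rintegral; apply/funext => x.
    apply: etrans (congr1 (fun f : V -> R => u x * f x) (partialM j (sk m) (test_smooth tp))) _.
    by rewrite mulrDr mulrA [u x * _]mulrC; congr (_ + _); rewrite mulrA [u x * _]mulrC.
  have E2 : I (fun x => v x * (k m x * phi x)) = I (fun x => k m x * v x * phi x).
    by congr Rintegral; apply/funext => x; rewrite mulrA [v x * _]mulrC.
  exact: rearrange (etrans (esym E1) B) E2.
have M1 := L1 _ (test_partial j tp).
have M2 : (fun m => - (I (fun x => k m x * v x * phi x) + I (fun x => partial j (k m) x * u x * phi x)))
    @ \oo --> - (I (fun x => k0 x * v x * phi x) + I (fun x => d0 x * u x * phi x)).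
  by apply: cvgN; apply: cvgD; [exact: L2|exact: L3].
rewrite (_ : (fun m => _) = (fun m => - (I (fun x => k m x * v x * phi x) +
    I (fun x => partial j (k m) x * u x * phi x)))) in M1; last by apply/funext.
have -> := lim_unique M1 M2.
rewrite -(intD (locint_test l2' tp) (locint_test l3' tp)); congr (- _).
by congr Rintegral; apply/funext => x; rewrite mulrDl.
Qed.

Lemma cvg_rho (s : R) (x : V) : x != 0 -> (fun m => rho m.+1%:R^-1 s x) @ \oo --> sqn x `^ s.
Proof.
move=> x0; have q0 := sqn_gt0 x0.
have c : {for sqn x, continuous (@powR R ^~ s)}.
  by apply: differentiable_continuous; apply/derivable1_diffP; have [] := is_derive1_powR s q0.
apply: (continuous_cvg _ c).
by rewrite -[X in _ --> X]addr0; apply: cvgD; [exact: cvg_cst|exact: cvg_harmonic].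
Qed.

Lemma rho_ge0 (e s : R) (x : V) : 0 <= rho e s x. Proof. exact: powR_ge0. Qed.

Lemma rho_le_powR (e s : R) (x : V) : 0 <= e -> x != 0 -> s <= 0 -> rho e s x <= sqn x `^ s.
Proof.
move=> e0 x0 s0; have q0 := sqn_gt0 x0.
rewrite -[s]opprK /rho powRN [leRHS]powRN lef_pV2 ?posrE ?powR_gt0 ?ltr_wpDr//.
by apply: ge0_ler_powR; rewrite ?nnegrE ?oppr_ge0 ?addr_ge0 ?sqn_ge0 ?lerDl.
Qed.

Lemma le_rho (e s : R) (x : V) : 0 <= e <= 1 -> 0 <= s -> rho e s x <= rho 1 s x.
Proof.
move=> /andP[e0 e1] s0; apply: ge0_ler_powR; rewrite ?nnegrE ?addr_ge0 ?sqn_ge0 ?lerD2l//.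
Qed.

Let sqn_powR (x : V) (s : R) : sqn x `^ s = r x `^ (s * 2).
Proof. by rewrite enorm_powR mulfK. Qed.

Let en01 m : 0 <= (m.+1%:R^-1 : R) <= 1.
Proof. by rewrite invr_ge0 ler0n invf_le1 ?ler1n. Qed.

Let en0 m : 0 < m.+1%:R^-1 :> R. Proof. by rewrite invr_gt0. Qed.

(** The derivatives of [wdir a] are of order [1/|x|], whence the condition on [u / |x|]. *)
Lemma wd_wdir a j u v : (0 < n)%N -> wd j u v -> locint (fun x => u x / r x) ->
  wd j (fun x => w a x * u x)
    (fun x => w a x * v x + ((a == j)%:R - w a x * w j x) * (u x / r x)).
Proof.
move=> n0 uv ur; have [u_ v_ _] := uv.
pose k m (x : V) : R := x ord0 a * rho m.+1%:R^-1 (- 2^-1) x.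
have sk m : smooth (k m) by exact (smoothM (smooth_coord R a) (smooth_rho _ (en0 m))).
have mrV := @mfun_enormV R n.
have dk m : partial j (k m) = fun x => (a == j)%:R * rho m.+1%:R^-1 (- 2^-1) x
    - x ord0 a * x ord0 j * rho m.+1%:R^-1 (- 2^-1 - 1) x.
  rewrite /k (partialM _ (smooth_coord R a) (smooth_rho _ (en0 m))) partial_coord partial_rho//.
  by apply/funext => x; field.
have p1 (x : V) : x != 0 -> sqn x `^ (- 2^-1) = (r x)^-1.
  by move=> x0; rewrite sqn_powR mulNr mulVf// powR_inv1// enorm_ge0.
have p3 (x : V) : x != 0 -> sqn x `^ (- 2^-1 - 1) = (r x)^-1 ^+ 3.
  move=> x0; rewrite sqn_powR (_ : (- 2^-1 - 1) * 2 = - 3%:R); last by field.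
  by rewrite powRN powR_mulrn ?enorm_ge0// exprVn.
have E : wd j (fun x => w a x * u x)
    (fun x => w a x * v x + ((a == j)%:R - w a x * w j x) * (r x)^-1 * u x).
  apply: (@wdM j u v k (w a) _ (fun=> 1) (fun x => 2 / r x)) => //.
  - exact: mfun_wdir.
  - apply: measurable_funM => //; apply: measurable_funB; first exact: measurable_cst.
    by apply: measurable_funM; exact: mfun_wdir.
  - move=> m x x0; rewrite normr1 normrM (ger0_norm (rho_ge0 _ _ _)).
    apply: (@le_trans _ _ (r x * (r x)^-1)); last by rewrite mulfV// lt0r_neq0// enorm_gt0.
    apply: ler_pM => //; first exact: rho_ge0.
      exact: coord_le_enorm.
    by rewrite -p1// rho_le_powR// ?oppr_le0 ?invr_ge0// ltW.
  - move=> m x x0; have r0 := enorm_gt0 x0.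
    rewrite dk (ger0_norm (_ : 0 <= 2 / r x)); last by rewrite divr_ge0// enorm_ge0.
    apply: le_trans (ler_normB _ _) _; rewrite (_ : 2 / r x = (r x)^-1 + (r x)^-1); last by ring.
    apply: lerD.
      rewrite normrM (ger0_norm (rho_ge0 _ _ _)) -[leRHS]mul1r.
      apply: ler_pM => //; first exact: rho_ge0; first by case: (_ == _); rewrite ?normr1 ?normr0.
      by rewrite -p1// rho_le_powR// ?oppr_le0 ?invr_ge0// ltW.
    rewrite normrM normrM (ger0_norm (rho_ge0 _ _ _)).
    rewrite (_ : (r x)^-1 = r x * r x * (r x)^-1 ^+ 3); last by field; rewrite lt0r_neq0.
    apply: ler_pM => //; [exact: rho_ge0| |].
      by apply: ler_pM => //; exact: coord_le_enorm.
    by rewrite -p3// rho_le_powR.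
  - move=> x x0; rewrite /wdir -p1//; apply: cvgM; first exact: cvg_cst.
    exact: cvg_rho.
  - move=> x x0; have r0 := enorm_gt0 x0.
    have -> : ((a == j)%:R - w a x * w j x) * (r x)^-1 =
      (a == j)%:R * sqn x `^ (- 2^-1) - x ord0 a * x ord0 j * sqn x `^ (- 2^-1 - 1).
      by rewrite p1// p3// /wdir; field; rewrite lt0r_neq0.
    under eq_fun do rewrite dk.
    by apply: cvgB; apply: cvgM; [exact: cvg_cst|exact: cvg_rho|exact: cvg_cst|exact: cvg_rho].
  - by have := locintZ 1 u_.
  - by have := locintZ 1 v_.
  - have := locintZ 2 ur; congr locint; apply/funext => x; ring.
move: E; congr wd; apply/funext => x; ring.
Qed.

(** For [1 <= s] the weight and its first derivatives are locally bounded. *)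
Lemma wd_enorm_powR (s : R) j u v : (0 < n)%N -> 1 <= s -> wd j u v ->
  wd j (fun x => r x `^ s * u x)
    (fun x => r x `^ s * v x + s * r x `^ (s - 1) * w j x * u x).
Proof.
move=> n0 s1 uv; have [u_ v_ _] := uv; have s0 : 0 <= s := le_trans ler01 s1.
pose k m : V -> R := rho m.+1%:R^-1 (s / 2).
have sk m : smooth (k m) by exact: (smooth_rho _ (en0 m)).
have dk m : partial j (k m) = fun x => s * x ord0 j * rho m.+1%:R^-1 (s / 2 - 1) x.
  by rewrite /k (partial_rho _ _ (en0 m)); apply/funext => x; rewrite [2 * _]mulrC divfK.
have s1' : smooth (rho 1 (s / 2) : V -> R) := smooth_rho _ ltr01.
have s2' : smooth (rho 1 ((s - 1) / 2) : V -> R) := smooth_rho _ ltr01.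
apply: (@wdM j u v k _ _ (rho 1 (s / 2)) (fun x => s * rho 1 ((s - 1) / 2) x)) => //.
- exact: mfun_enorm_powR.
- apply: measurable_funM; last exact: mfun_wdir.
  by apply: measurable_funM; [exact: measurable_cst|exact: mfun_enorm_powR].
- move=> m x x0; rewrite !ger0_norm ?rho_ge0//; apply: le_rho => //.
  by rewrite divr_ge0.
- move=> m x x0; rewrite dk normrM (ger0_norm (rho_ge0 _ _ _)) normrM (ger0_norm s0).
  rewrite normrM (ger0_norm s0) (ger0_norm (rho_ge0 _ _ _)) -mulrA ler_wpM2l//.
  apply: (@le_trans _ _ (rho m.+1%:R^-1 2^-1 x * rho m.+1%:R^-1 (s / 2 - 1) x)).
    rewrite ler_wpM2r ?rho_ge0//; apply: le_trans (coord_le_enorm x j) _.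
    rewrite enormE -powR12_sqrt ?sqn_ge0//; apply: ge0_ler_powR;
      by rewrite ?nnegrE ?invr_ge0 ?addr_ge0 ?sqn_ge0 ?lerDl ?ltW.
  rewrite /rho -powRD; last by apply/implyP => _; rewrite lt0r_neq0// ltr_wpDl ?sqn_ge0.
  rewrite (_ : 2^-1 + (s / 2 - 1) = (s - 1) / 2); last by field.
  by apply: le_rho => //; rewrite divr_ge0// subr_ge0.
- move=> x x0; rewrite (_ : r x `^ s = sqn x `^ (s / 2)); first exact: cvg_rho.
  by rewrite sqn_powR divfK.
- move=> x x0; have r0 := enorm_gt0 x0.
  have -> : s * r x `^ (s - 1) * w j x = s * x ord0 j * sqn x `^ (s / 2 - 1).
    have -> : sqn x `^ (s / 2 - 1) = r x `^ (s - 1) * (r x)^-1.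
      rewrite -(powR_inv1 (enorm_ge0 x)) -powRD; last by apply/implyP => _; rewrite lt0r_neq0.
      by rewrite sqn_powR; congr powR; field.
    by rewrite /wdir; ring.
  under eq_fun do rewrite dk.
  by apply: cvgM; [exact: cvg_cst|exact: cvg_rho].
- exact: locint_smoothM.
- exact: locint_smoothM.
- have := locintZ s (locint_smoothM s2' u_); congr locint; apply/funext => x; exact: mulrA.
Qed.

End weak_derivatives.

(** * Weak derivatives of the radial and spherical parts *)

Section radial_derivatives.
Context (R : realType) (n : nat).
Implicit Types (f g : 'rV[R]_n -> R) (a b j k : 'I_n).
Local Notation mu := (lebesgue_rV R n).
Local Notation mfun f := (measurable_fun setT (f : 'rV[R]_n -> R)).
Local Notation V := 'rV[R]_n.
Local Notation w := (@wdir R n).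
Local Notation r := (@enorm R n).

Local Opaque partial.

(** Data attached to a function of class [H^2]: its first and second derivatives,
    simultaneously approximated by those of test functions. *)
Definition H2_data f (u : 'I_n -> V -> R) (H : 'I_n -> 'I_n -> V -> R) :=
  (forall a b, H a b = H b a) /\ exists phi : nat -> V -> R,
  [/\ forall m, test_function (phi m), cvg2 mu phi f,
      forall a, cvg2 mu (fun m => partial a (phi m)) (u a) &
      forall a b, cvg2 mu (fun m => partial b (partial a (phi m))) (H a b)].

Lemma weak_lap_H2_data f h : L2 mu f -> L2 mu h -> weak_lap f h ->
  exists u H, H2_data f u H.
Proof.
move=> f_ h_ fh; have [phi [u [H [tphi pf pu pH]]]] := lap_regularity f_ h_ fh.
pose H' a b := if (a <= b)%N then H a b else H b a.
exists u, H'; split.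
  by move=> a b; rewrite /H'; case: ltngtP => // /val_inj ->.
exists phi; split => // a b; rewrite /H'; case: ifP => _; first exact: pH.
rewrite (_ : (fun m => _) = fun m => partial a (partial b (phi m))); first exact: pH.
by apply/funext => m; rewrite (smooth_schwarz b a (test_smooth (tphi m))).
Qed.

Section data.
Context f (u : 'I_n -> V -> R) (H : 'I_n -> 'I_n -> V -> R).
Hypothesis n3 : (3 < n)%N.
Hypothesis data : H2_data f u H.
Local Notation Y := (over_r u).

Let n0 : (0 < n)%N. Proof. exact: ltn_trans n3. Qed.

Let Hsym a b x : H a b x = H b a x.
Proof. by have [-> _] := data. Qed.

Let Y_ a : L2 mu (Y a).
Proof. by have [_ [phi [tp pf pu pH]]] := data; exact: L2_over_r n3 tp pu pH a. Qed.

Lemma wd_H2 a : wd a f (u a).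
Proof. by have [_ [phi [tp pf pu pH]]] := data; exact: wd_cvg2 tp pf (pu a). Qed.

Lemma wd_H2_partial a b : wd b (u a) (H a b).
Proof.
have [_ [phi [tp pf pu pH]]] := data.
exact: wd_cvg2 (fun m => test_partial a (tp m)) (pu a) (pH a b).
Qed.

Lemma L2_H2_data : [/\ L2 mu (trace_hess H), L2 mu (rad_part u H),
  forall a, L2 mu (sph_over_r u a) & forall a, L2 mu (rad_sph H a)].
Proof.
have [_ [phi [tp pf pu pH]]] := data; split.
- exact: L2_trace_hess pH.
- exact: L2_rad_part n3 tp pu pH.
- exact: L2_sph_over_r n3 tp pu pH.
- exact: L2_rad_sph pH.
Qed.

Lemma real_identity_H2_data :
  \int[mu]_x (trace_hess H x ^+ 2) =
  \int[mu]_x (rad_part u H x ^+ 2) + \int[mu]_x ((trace_hess H x - rad_part u H x) ^+ 2)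
  + n%:R * (n%:R - 4) / 2 * \sum_(a < n) \int[mu]_x (sph_over_r u a x ^+ 2)
  + 2 * \sum_(a < n)
      \int[mu]_x ((rad_sph H a x + (n%:R - 2) / 2 * sph_over_r u a x) ^+ 2).
Proof. by have [Hs [phi [tp pf pu pH]]] := data; exact: real_identity n3 tp pu pH Hs. Qed.

Definition grad_rad (x : V) : R := \sum_(a < n) w a x * u a x.

Definition dgrad_rad k (x : V) : R :=
  \sum_(a < n) (w a x * H a k x + ((a == k)%:R - w a x * w k x) * Y a x).

Definition grad_sph j (x : V) : R := u j x - w j x * grad_rad x.

Definition dgrad_sph j k (x : V) : R :=
  H j k x - (w j x * dgrad_rad k x + ((j == k)%:R - w j x * w k x) * rad_over_r u x).

Lemma rad_div x : grad_rad x / r x = rad_over_r u x.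
Proof. by rewrite /grad_rad mulr_suml; apply: eq_bigr => a _; rewrite mulrA. Qed.

Lemma sph_div j x : grad_sph j x / r x = sph_over_r u j x.
Proof. by rewrite /grad_sph mulrBl -mulrA rad_div. Qed.

Lemma wd_rad k : wd k grad_rad (dgrad_rad k).
Proof.
apply: wd_sum => a; apply: (wd_wdir a n0 (wd_H2_partial a k)).
exact: L2_locint (Y_ a).
Qed.

Lemma locint_rad_over_r : locint (rad_over_r u).
Proof. by apply: locint_sum => a; apply: locint_wdir; exact: L2_locint. Qed.

Lemma wd_sph j k : wd k (grad_sph j) (dgrad_sph j k).
Proof.
apply: wdB; first exact: wd_H2_partial.
have E : (fun x => grad_rad x / r x) = rad_over_r u by apply/funext => x; exact: rad_div.
have := wd_wdir j n0 (wd_rad k); rewrite E => /(_ locint_rad_over_r).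
congr wd; apply/funext => x; by rewrite rad_div.
Qed.

Section pointwise.
Context (x : V) (x0 : x != 0).

Let w1 := sum_wdir_sq x0.

Let sum_proj a (c : R) : \sum_(k < n) w k x * (((a == k)%:R - w a x * w k x) * c) = 0.
Proof.
transitivity (c * (\sum_(k < n) (a == k)%:R * w k x - w a x * \sum_(k < n) w k x ^+ 2)).
  by rewrite mulrBr mulrA !mulr_sumr -sumrB; apply: eq_bigr => k _; ring.
by rewrite sum_delta w1 mulr1 subrr mulr0.
Qed.

Lemma rad_drad : \sum_(k < n) w k x * dgrad_rad k x = rad_rad H x.
Proof.
rewrite /dgrad_rad; under eq_bigr => k _ do rewrite mulr_sumr.
rewrite exchange_big /rad_rad; apply: eq_bigr => a _ /=.
under eq_bigr => k _ do rewrite mulrDr.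
rewrite big_split /= sum_proj addr0.
by rewrite /hess_rad mulr_sumr; apply: eq_bigr => k _; ring.
Qed.

Lemma rad_dsph j : \sum_(k < n) w k x * dgrad_sph j k x = rad_sph H j x.
Proof.
rewrite /dgrad_sph; under eq_bigr => k _ do rewrite mulrBr mulrDr.
rewrite sumrB big_split /= sum_proj addr0 /rad_sph /hess_rad -rad_drad mulr_sumr; congr (_ - _).
by apply: eq_bigr => k _; ring.
Qed.

Lemma sum_sph_dsph : \sum_(j < n) (dgrad_sph j j x - w j x * \sum_(k < n) w k x * dgrad_sph j k x) =
  trace_hess H x - rad_part u H x.
Proof.
have E1 : \sum_(j < n) w j x * rad_sph H j x = 0.
  rewrite /rad_sph; under eq_bigr => j _ do rewrite mulrBr.
  rewrite sumrB -/(rad_rad H x); apply/eqP; rewrite subr_eq0; apply/eqP.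
  by rewrite -[LHS]mul1r -w1 mulr_suml; apply: eq_bigr => j _; ring.
under eq_bigr => j _ do rewrite rad_dsph.
rewrite sumrB E1 subr0 /dgrad_sph sumrB big_split /= rad_drad -/(trace_hess H x).
rewrite -mulr_suml sumrB; under eq_bigr => j _ do rewrite eqxx.
by rewrite sumr_const card_ord (_ : \sum_(j < n) w j x * w j x = 1).
Qed.

Let r0 : 0 < r x. Proof. exact: enorm_gt0. Qed.

Let rDN (s t : R) : s + t = 0 -> r x `^ s * r x `^ t = 1.
Proof.
move=> st; rewrite -powRD ?st ?powRr0//; apply/implyP => _; exact: lt0r_neq0.
Qed.

Let rDN1 (s t : R) : s + t = 0 -> r x `^ s * r x `^ (t - 1) = (r x)^-1.
Proof.
move=> st; rewrite -powRD ?addrA ?st ?sub0r ?powR_inv1 ?enorm_ge0//.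
by apply/implyP => _; exact: lt0r_neq0.
Qed.

(** Undoing a power weight: [r^-s d_r (r^s g) = d_r g + s g / r]. *)
Lemma weighted_radial (s t : R) (g : R) (dg : 'I_n -> R) : s + t = 0 ->
  r x `^ s * \sum_(k < n) w k x * (r x `^ t * dg k + t * r x `^ (t - 1) * w k x * g) =
  \sum_(k < n) w k x * dg k + t * (g / r x).
Proof.
move=> st.
transitivity (\sum_(k < n) (r x `^ s * r x `^ t * (w k x * dg k) +
    r x `^ s * r x `^ (t - 1) * (w k x ^+ 2 * (t * g)))).
  by rewrite mulr_sumr; apply: eq_bigr => k _; ring.
rewrite big_split /= -!mulr_sumr (rDN st) (rDN1 st) -mulr_suml w1; ring.
Qed.

End pointwise.
End data.
End radial_derivatives.

(** * Complex functions *)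

Section complex_functions.
Context (R : realType) (n : nat).
Implicit Types (f g : 'rV[R]_n -> R[i]) (u v : 'rV[R]_n -> R) (j : 'I_n).
Local Notation mu := (lebesgue_rV R n).
Local Notation integ f := (mu.-integrable setT (EFin \o f)).
Local Notation mfun f := (measurable_fun setT (f : 'rV[R]_n -> R)).
Local Notation I f := (\int[mu]_x f x).
Local Notation V := 'rV[R]_n.
Local Notation w := (@wdir R n).
Local Notation normc := ComplexField.Normc.normc.
Local Notation Re := complex.Re.
Local Notation Im := complex.Im.

Local Opaque partial.

Lemma Re_realM (k : R) (z : R[i]) : Re (k%:C%C * z) = k * Re z.
Proof. by case: z => a b /=; rewrite mul0r subr0. Qed.

Lemma Im_realM (k : R) (z : R[i]) : Im (k%:C%C * z) = k * Im z.
Proof. by case: z => a b /=; rewrite mul0r addr0. Qed.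

Lemma Re_Mreal (k : R) (z : R[i]) : Re (z * k%:C%C) = Re z * k.
Proof. by rewrite mulrC Re_realM mulrC. Qed.

Lemma Im_Mreal (k : R) (z : R[i]) : Im (z * k%:C%C) = Im z * k.
Proof. by rewrite mulrC Im_realM mulrC. Qed.

Lemma normc_sq (z : R[i]) : normc z ^+ 2 = Re z ^+ 2 + Im z ^+ 2.
Proof. by case: z => a b; rewrite /= sqr_sqrtr// addr_ge0 ?sqr_ge0. Qed.

Lemma normc_ge0 (z : R[i]) : 0 <= normc z.
Proof. by case: z => a b; exact: sqrtr_ge0. Qed.

Lemma Re_le_normc (z : R[i]) : `|Re z| <= normc z.
Proof. by case: z => a b /=; rewrite -sqrtr_sqr ler_sqrt ?addr_ge0 ?sqr_ge0// lerDl sqr_ge0. Qed.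

Lemma Im_le_normc (z : R[i]) : `|Im z| <= normc z.
Proof. by case: z => a b /=; rewrite -sqrtr_sqr ler_sqrt ?addr_ge0 ?sqr_ge0// lerDr sqr_ge0. Qed.

Lemma normc_le (z : R[i]) : normc z <= `|Re z| + `|Im z|.
Proof.
rewrite -(@ler_pXn2r _ 2)// ?nnegrE ?normc_ge0 ?addr_ge0//.
rewrite normc_sq -(real_normK (num_real (Re z))) -(real_normK (num_real (Im z))).
have := normr_ge0 (Re z); have := normr_ge0 (Im z).
move: `|Re z| `|Im z| => a b b0 a0; have := mulr_ge0 a0 b0; nra.
Qed.

Lemma mfun_normc f : cmeasurable f -> mfun (fun x => normc (f x)).
Proof.
move=> [m1 m2].
rewrite (_ : (fun x => _) = fun x => (Re (f x) ^+ 2 + Im (f x) ^+ 2) `^ (2^-1)); last first.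
  apply/funext => x; rewrite powR12_sqrt ?addr_ge0 ?sqr_ge0//.
  by rewrite -normc_sq sqrtr_sqr ger0_norm// normc_ge0.
rewrite (_ : (fun x => _) = (@powR R ^~ 2^-1) \o (fun x => Re (f x) ^+ 2 + Im (f x) ^+ 2))//.
apply: measurableT_comp; first exact: measurable_powR.
by apply: measurable_funD; exact: measurable_funX.
Qed.

Lemma normL2_sq f : (normL2 f ^+ 2 = \int[mu]_x (Re (f x) ^+ 2 + Im (f x) ^+ 2)%:E)%E.
Proof.
have sq (y : \bar R) : (0 <= y)%E -> (y ^+ 2 = y `^ 2%:R)%E.
  case: y => [s|_|//]; last by rewrite poweRyr ?pnatr_eq0// expe2 mulyy.
  by rewrite lee_fin poweR_EFin => s0; rewrite powR_mulrn// EFin_expe.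
rewrite /normL2 sq ?Lnorm_ge0// poweR_Lnorm ?pnatr_eq0//.
apply: eq_integral => x _; rewrite abse_EFin poweR_EFin powR_mulrn// ger0_norm ?normc_ge0//.
by rewrite normc_sq.
Qed.

Lemma memL2_parts f : memL2 f -> L2 mu (fun x => Re (f x)) /\ L2 mu (fun x => Im (f x)).
Proof.
move=> [[m1 m2] foo].
have S : integ (fun x => Re (f x) ^+ 2 + Im (f x) ^+ 2).
  apply: integ_ge0P => [|x|]; [by apply: measurable_funD; exact: measurable_funX| |].
    by rewrite addr_ge0 ?sqr_ge0.
  rewrite -normL2_sq.
  have : (0 <= normL2 f)%E by exact: Lnorm_ge0.
  by move: foo; case: (normL2 f) => [s| |]// _ _; rewrite -EFin_expe ltry.
split; split => //; apply: integ_dom S; try exact: measurable_funX.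
  by move=> x; rewrite ger0_norm ?sqr_ge0// lerDl sqr_ge0.
by move=> x; rewrite ger0_norm ?sqr_ge0// lerDr sqr_ge0.
Qed.

Let compact_mes (K : set V) : compact K -> measurable K.
Proof.
move=> cK; rewrite -[K]setCK; apply: measurableC; apply: open_rV_measurable.
by apply: closed_openC; apply: compact_closed => //; exact: norm_hausdorff.
Qed.

Let ball_mes (M : R) : measurable [set x : V | `|x| <= M].
Proof. by apply: compact_mes; exact: ball_compact. Qed.

Lemma loc_integrableP f : loc_integrable f <->
  locint (fun x => Re (f x)) /\ locint (fun x => Im (f x)).
Proof.
split => [[mf fK]|[[m1 l1] [m2 l2]]].
  have [m1 m2] := mf; have mn := mfun_normc mf.
  have N M : integ (fun x => \1_(@cube R n M) x * normc (f x)).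
    have mQ : measurable (@cube R n M) by exact: in_box_measurable.
    apply: integ_ge0P => [|x|].
    - by apply: measurable_funM => //; exact: measurable_indic.
    - by rewrite mulr_ge0 ?normc_ge0// indicE.
    - apply: le_lt_trans (fK _ (@ball_compact R n `|M|)).
      rewrite [leRHS]integral_mkcond; apply: ge0_le_integral => //.
      + by move=> x _; rewrite lee_fin mulr_ge0 ?normc_ge0// indicE.
      + apply/measurable_EFinP; apply: measurable_funM => //; exact: measurable_indic.
      + apply/(measurable_restrictT _ (ball_mes _)).
        by apply/measurable_EFinP; apply: measurable_funTS.
      + move=> x _; rewrite patchE indicE; have [xM|xM] := boolP (x \in cube M); last first.
          by rewrite mul0r; case: ifP => // _; rewrite lee_fin normc_ge0.
        by rewrite mul1r mem_set//= cube_norm//; exact: set_mem xM.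
  split; split => // M; apply: integ_dom (N M).
  - by apply: measurable_funM; [apply: measurable_indic; exact: in_box_measurable|exact: measurableT_comp].
  - by move=> x; rewrite normrM normr_id indicE ger0_norm// ler_wpM2l// Re_le_normc.
  - by apply: measurable_funM; [apply: measurable_indic; exact: in_box_measurable|exact: measurableT_comp].
  - by move=> x; rewrite normrM normr_id indicE ger0_norm// ler_wpM2l// Im_le_normc.
have mf : cmeasurable f by split.
have mn := mfun_normc mf.
split => // K cK; have mK := compact_mes cK.
have [M [Mr KM]] := compact_bounded cK.
pose N := `|M| + 1.
have KN x : K x -> cube (N + 1) x.
  move=> Kx; apply: norm_cube; apply: (@le_lt_trans _ _ N); last by rewrite ltrDl.
  by apply: (KM N) => //; rewrite /N ltr_pwDr// ler_norm.
have /integrableP[_] := integD (l1 (N + 1)) (l2 (N + 1)).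
apply: le_lt_trans; rewrite [leLHS]integral_mkcond; apply: ge0_le_integral => //.
- by move=> x _; rewrite patchE; case: ifP => // _; rewrite lee_fin normc_ge0.
- by apply/(measurable_restrictT _ mK)/measurable_EFinP; apply: measurable_funTS.
- apply: measurableT_comp => //; apply/measurable_EFinP.
  exact: integ_mfun (integD (l1 (N + 1)) (l2 (N + 1))).
- move=> x _; rewrite patchE; case: ifPn => [xK|_]; last by rewrite lee_fin normr_ge0.
  rewrite /= lee_fin.
  rewrite indicE mem_set ?mul1r; last by apply: KN; exact: set_mem.
  by apply: le_trans (normc_le _) _; exact: ler_norm.
Qed.

Lemma is_weak_partialP j f g : is_weak_partial j f g <->
  wd j (fun x => Re (f x)) (fun x => Re (g x)) /\ wd j (fun x => Im (f x)) (fun x => Im (g x)).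
Proof.
have eqC (a b c d : R) : (a +i* b)%C = - (c +i* d)%C <-> a = - c /\ b = - d.
  by split => [[-> ->]|[-> ->]].
have E f' psi : cintegral (fun x => f' x * (psi x)%:C%C) =
    (I (fun x => Re (f' x) * psi x) +i* I (fun x => Im (f' x) * psi x))%C.
  rewrite /cintegral; congr (_ +i* _)%C; congr Rintegral; apply/funext => x.
    exact: Re_Mreal.
  exact: Im_Mreal.
split => [[/loc_integrableP[f1 f2] /loc_integrableP[g1 g2] fg]|[[f1 g1 H1] [f2 g2 H2]]].
  by split; split => // phi tp; have := fg _ tp; rewrite !E => /eqC[].
split; [exact/loc_integrableP|exact/loc_integrableP|move=> phi tp].
by rewrite !E; apply/eqC; split; [exact: H1|exact: H2].
Qed.

(** Equality almost everywhere, by components, with the measurability needed to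
    integrate. *)
Definition parts f u v := [/\ cmeasurable f, mfun u, mfun v,
  {ae mu, forall x, Re (f x) = u x} & {ae mu, forall x, Im (f x) = v x}].

Lemma parts_refl f : cmeasurable f -> parts f (fun x => Re (f x)) (fun x => Im (f x)).
Proof. by move=> mf; have [m1 m2] := mf; split => //; exact: aeW. Qed.

Lemma partsD f g u v u' v' : parts f u v -> parts g u' v' ->
  parts (fun x => f x + g x) (fun x => u x + u' x) (fun x => v x + v' x).
Proof.
move=> [[m1 m2] mu_ mv e1 e2] [[m1' m2'] mu' mv' e1' e2'].
have ER x : Re (f x + g x) = Re (f x) + Re (g x) by case: (f x) (g x) => a b [].
have EI x : Im (f x + g x) = Im (f x) + Im (g x) by case: (f x) (g x) => a b [].
split.
- split; [under eq_fun do rewrite ER|under eq_fun do rewrite EI]; exact: measurable_funD.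
- exact: measurable_funD.
- exact: measurable_funD.
- by move: e1 e1'; apply: filterS2 => x; rewrite ER => -> ->.
- by move: e2 e2'; apply: filterS2 => x; rewrite EI => -> ->.
Qed.

Lemma parts_realM (k : V -> R) f u v : mfun k -> parts f u v ->
  parts (fun x => (k x)%:C%C * f x) (fun x => k x * u x) (fun x => k x * v x).
Proof.
move=> mk [[m1 m2] mu_ mv e1 e2]; split.
- by split; [under eq_fun do rewrite Re_realM|under eq_fun do rewrite Im_realM]; exact: measurable_funM.
- exact: measurable_funM.
- exact: measurable_funM.
- by move: e1; apply: filterS => x; rewrite Re_realM => ->.
- by move: e2; apply: filterS => x; rewrite Im_realM => ->.
Qed.

Lemma partsB f g u v u' v' : parts f u v -> parts g u' v' ->
  parts (fun x => f x - g x) (fun x => u x - u' x) (fun x => v x - v' x).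
Proof.
move=> fP gP; have := partsD fP (parts_realM (measurable_cst (-1 : R)) gP).
congr parts; apply/funext => x; rewrite ?mulN1r//.
by case: (f x) (g x) => a b [c d]; congr (_ +i* _)%C; rewrite /=; ring.
Qed.

Lemma parts_sum (F : 'I_n -> V -> R[i]) (U W : 'I_n -> V -> R) :
  (forall a, parts (F a) (U a) (W a)) ->
  parts (fun x => \sum_(a < n) F a x) (fun x => \sum_(a < n) U a x) (fun x => \sum_(a < n) W a x).
Proof.
move=> FP; elim: (index_enum 'I_n) => [|a s IH].
  rewrite (_ : (fun x => _) = fun=> 0); last by apply/funext => x; rewrite big_nil.
  rewrite (_ : (fun x => _) = fun=> 0 : R); last by apply/funext => x; rewrite big_nil.
  rewrite (_ : (fun x => _) = fun=> 0 : R); last by apply/funext => x; rewrite big_nil.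
  by split; [split; exact: measurable_cst|exact: measurable_cst|exact: measurable_cst|exact: aeW|exact: aeW].
have := partsD (FP a) IH.
by congr parts; apply/funext => x; rewrite big_cons.
Qed.

Lemma parts_ae f u v u' v' : (0 < n)%N -> mfun u' -> mfun v' -> (forall x, x != 0 -> u x = u' x) ->
  (forall x, x != 0 -> v x = v' x) -> parts f u v -> parts f u' v'.
Proof.
move=> n0 mu' mv' uu vv [mf mu_ mv e1 e2]; split => //.
  by move: e1 (ae_n0 n0 uu); apply: filterS2 => x -> ->.
by move: e2 (ae_n0 n0 vv); apply: filterS2 => x -> ->.
Qed.

Lemma parts_normL2 f u v : parts f u v -> L2 mu u -> L2 mu v ->
  (normL2 f ^+ 2 = (I (fun x => u x ^+ 2) + I (fun x => v x ^+ 2))%:E)%E.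
Proof.
move=> [[m1 m2] mu_ mv e1 e2] u_ v_.
have iu := integ_sq u_; have iv := integ_sq v_.
rewrite normL2_sq -intD// -integE; last exact: integD.
apply: ae_eq_integral => //.
- by apply/measurable_EFinP; apply: measurable_funD; exact: measurable_funX.
- by apply/measurable_EFinP; apply: measurable_funD; exact: measurable_funX.
by move: e1 e2; apply: filterS2 => x -> -> _.
Qed.

(** The representative chosen by [weak_partial] is a weak derivative because one exists,
    and weak derivatives are unique almost everywhere. *)
Lemma parts_partial j f u v u' v' : parts f u v -> wd j u u' -> wd j v v' ->
  parts (weak_partial j f) u' v'.
Proof.
move=> [[m1 m2] mu_ mv e1 e2] du dv.
have mu' : mfun u' by have [_ []] := du.
have mv' : mfun v' by have [_ []] := dv.
have s (g h : V -> R) : {ae mu, forall x, g x = h x} -> {ae mu, forall x, h x = g x}.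
  by apply: filterS => x ->.
have d1 : wd j (fun x => Re (f x)) u' by apply: wd_ae du => //; [exact: s|exact: aeW].
have d2 : wd j (fun x => Im (f x)) v' by apply: wd_ae dv => //; [exact: s|exact: aeW].
have ex : is_weak_partial j f (fun x => (u' x +i* v' x)%C) by exact/is_weak_partialP.
have /is_weak_partialP[D1 D2] : is_weak_partial j f (weak_partial j f).
  exact: (@xgetPex _ (fun=> 0) [set g | is_weak_partial j f g] (ex_intro _ _ ex)).
split => //.
- by split; [have [_ []] := D1|have [_ []] := D2].
- exact: wd_unique D1 d1.
- exact: wd_unique D2 d2.
Qed.

Lemma parts_radial f u v (du dv : 'I_n -> V -> R) : parts f u v ->
  (forall j, wd j u (du j)) -> (forall j, wd j v (dv j)) ->
  parts (radial f) (fun x => \sum_(j < n) w j x * du j x) (fun x => \sum_(j < n) w j x * dv j x).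
Proof.
move=> fP ud vd; apply: (parts_sum (F := fun j x => (w j x)%:C%C * weak_partial j f x)) => j.
by apply: parts_realM; [exact: mfun_wdir|exact: parts_partial fP (ud j) (vd j)].
Qed.

Lemma parts_spherical j f u v (du dv : 'I_n -> V -> R) : parts f u v ->
  (forall j, wd j u (du j)) -> (forall j, wd j v (dv j)) ->
  parts (spherical j f) (fun x => du j x - w j x * \sum_(k < n) w k x * du k x)
    (fun x => dv j x - w j x * \sum_(k < n) w k x * dv k x).
Proof.
move=> fP ud vd; apply: partsB; first exact: parts_partial fP (ud j) (vd j).
by apply: parts_realM; [exact: mfun_wdir|exact: parts_radial fP ud vd].
Qed.

Let weak_resolvent u v : L2 mu u -> L2 mu v ->
  (forall phi, test_function phi ->
     I (fun x => u x * (phi x - lap phi x)) = I (fun x => v x * phi x)) ->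
  weak_lap u (fun x => u x - v x).
Proof.
move=> u_ v_ uv phi tp; have p_ := L2_test tp; have := uv _ tp.
have l_ : L2 mu (lap phi) by apply: L2_sum => j; apply: L2_test; do 2 apply: test_partial.
have -> : (fun x => u x * (phi x - lap phi x)) = fun x => u x * phi x - u x * lap phi x.
  by apply/funext => x; rewrite mulrBr.
have -> : (fun x => (u x - v x) * phi x) = fun x => u x * phi x - v x * phi x.
  by apply/funext => x; rewrite mulrBl.
rewrite (intB (integM u_ p_) (integM u_ l_)) (intB (integM u_ p_) (integM v_ p_)) => <-.
by rewrite subKr.
Qed.

Lemma memH2_weak_lap f : memH2 f -> exists h1 h2, [/\ L2 mu h1, L2 mu h2,
  weak_lap (fun x => Re (f x)) h1 & weak_lap (fun x => Im (f x)) h2].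
Proof.
move=> [fL [g gL fg]]; have [f1 f2] := memL2_parts fL; have [g1 g2] := memL2_parts gL.
exists (fun x => Re (f x) - Re (g x)), (fun x => Im (f x) - Im (g x)).
split; [exact: L2B|exact: L2B| |]; apply: weak_resolvent => // phi tp;
  have := fg _ tp; rewrite /cintegral => -[E1 E2].
- by apply: etrans (etrans _ E1) _; congr Rintegral; apply/funext => x; rewrite Re_Mreal.
- by apply: etrans (etrans _ E2) _; congr Rintegral; apply/funext => x; rewrite Im_Mreal.
Qed.

End complex_functions.

(** * The five terms of the identity *)

Section terms.
Context (R : realType) (n : nat).
Implicit Types (j k : 'I_n).
Local Notation mu := (lebesgue_rV R n).
Local Notation mfun f := (measurable_fun setT (f : 'rV[R]_n -> R)).
Local Notation V := 'rV[R]_n.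
Local Notation w := (@wdir R n).
Local Notation r := (@enorm R n).

Local Opaque partial.

Context (f : V -> R[i]) (f1 f2 : V -> R) (u1 u2 : 'I_n -> V -> R) (H1 H2 : 'I_n -> 'I_n -> V -> R).
Hypothesis n4 : (4 < n)%N.
Hypothesis fP : parts f f1 f2.
Hypothesis data1 : H2_data f1 u1 H1.
Hypothesis data2 : H2_data f2 u2 H2.

Let n3 : (3 < n)%N. Proof. exact: ltn_trans n4. Qed.
Let n0 : (0 < n)%N. Proof. exact: ltn_trans n4. Qed.

Let s1 : 1 <= n%:R - 1 :> R.
Proof.
have : 4 <= n%:R :> R by rewrite ler_nat ltnW.
lra.
Qed.

Let s2 : 1 <= n%:R / 2 - 1 :> R.
Proof.
have : 4 <= n%:R :> R by rewrite ler_nat ltnW.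
lra.
Qed.

Let mT1 : mfun (trace_hess H1). Proof. by have [[]] := L2_H2_data n3 data1. Qed.
Let mT2 : mfun (trace_hess H2). Proof. by have [[]] := L2_H2_data n3 data2. Qed.
Let mA1 : mfun (rad_part u1 H1). Proof. by have [_ []] := L2_H2_data n3 data1. Qed.
Let mA2 : mfun (rad_part u2 H2). Proof. by have [_ []] := L2_H2_data n3 data2. Qed.
Let mV1 j : mfun (sph_over_r u1 j). Proof. by have [_ _ /(_ j)[]] := L2_H2_data n3 data1. Qed.
Let mV2 j : mfun (sph_over_r u2 j). Proof. by have [_ _ /(_ j)[]] := L2_H2_data n3 data2. Qed.
Let mS1 j : mfun (rad_sph H1 j). Proof. by have [_ _ _ /(_ j)[]] := L2_H2_data n3 data1. Qed.
Let mS2 j : mfun (rad_sph H2 j). Proof. by have [_ _ _ /(_ j)[]] := L2_H2_data n3 data2. Qed.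

Lemma parts_laplacian : parts (laplacian f) (trace_hess H1) (trace_hess H2).
Proof.
apply: (parts_sum (F := fun j => weak_partial j (weak_partial j f))) => j.
apply: parts_partial (wd_H2_partial data1 j j) (wd_H2_partial data2 j j).
exact: parts_partial fP (wd_H2 data1 j) (wd_H2 data2 j).
Qed.

Let radP : parts (radial f) (grad_rad u1) (grad_rad u2).
Proof. exact: parts_radial fP (wd_H2 data1) (wd_H2 data2). Qed.

Let sphP j : parts (spherical j f) (grad_sph u1 j) (grad_sph u2 j).
Proof. exact: parts_spherical fP (wd_H2 data1) (wd_H2 data2). Qed.

Let mfun_div (c d : R) : mfun (fun x => c / (d * r x)).
Proof.
rewrite (_ : (fun x => _) = fun x => c / d * (r x)^-1).
  by apply: measurable_funM; [exact: measurable_cst|exact: mfun_enormV].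
by apply/funext => x; rewrite invfM mulrA.
Qed.

Let mfun_div1 (c : R) : mfun (fun x => c / r x).
Proof. by apply: measurable_funM; [exact: measurable_cst|exact: mfun_enormV]. Qed.

Lemma parts_radial2 :
  parts (fun x => radial (radial f) x + ((n%:R - 1) / r x)%:C%C * radial f x)
    (rad_part u1 H1) (rad_part u2 H2).
Proof.
have := partsD (parts_radial radP (wd_rad n3 data1) (wd_rad n3 data2))
  (parts_realM (mfun_div1 (n%:R - 1)) radP).
apply: parts_ae => // x x0; rewrite rad_drad// /rad_part -rad_div; congr (_ + _); ring.
Qed.

Lemma parts_weighted_radial2 :
  parts (fun x => (r x `^ (1 - n%:R))%:C%C *
      radial (fun y => (r y `^ (n%:R - 1))%:C%C * radial f y) x)
    (rad_part u1 H1) (rad_part u2 H2).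
Proof.
have wP := parts_realM (mfun_enorm_powR (n%:R - 1)) radP.
have := parts_realM (mfun_enorm_powR (1 - n%:R))
  (parts_radial wP (fun k => wd_enorm_powR n0 s1 (wd_rad n3 data1 k))
    (fun k => wd_enorm_powR n0 s1 (wd_rad n3 data2 k))).
have s0 : 1 - n%:R + (n%:R - 1) = 0 :> R by ring.
by apply: parts_ae => // x x0; rewrite (weighted_radial x0 _ _ s0) rad_drad// rad_div.
Qed.

Lemma parts_spherical2 :
  parts (fun x => \sum_(j < n) spherical j (spherical j f) x)
    (fun x => trace_hess H1 x - rad_part u1 H1 x) (fun x => trace_hess H2 x - rad_part u2 H2 x).
Proof.
have := parts_sum (fun j => parts_spherical j (sphP j) (wd_sph n3 data1 j) (wd_sph n3 data2 j)).
apply: parts_ae => //; [exact: measurable_funB|exact: measurable_funB| |];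
  by move=> x x0; exact: sum_sph_dsph.
Qed.

Lemma parts_spherical_div j :
  parts (fun x => (1 / r x)%:C%C * spherical j f x) (sph_over_r u1 j) (sph_over_r u2 j).
Proof.
have := parts_realM (mfun_div1 1) (sphP j).
by apply: parts_ae => // x x0; rewrite -sph_div; ring.
Qed.

Let mW1 j : mfun (fun x => rad_sph H1 j x + (n%:R - 2) / 2 * sph_over_r u1 j x).
Proof. by apply: measurable_funD => //; apply: measurable_funM. Qed.

Let mW2 j : mfun (fun x => rad_sph H2 j x + (n%:R - 2) / 2 * sph_over_r u2 j x).
Proof. by apply: measurable_funD => //; apply: measurable_funM. Qed.

Lemma parts_radial_spherical j :
  parts (fun x => radial (spherical j f) x + ((n%:R - 2) / (2 * r x))%:C%C * spherical j f x)
    (fun x => rad_sph H1 j x + (n%:R - 2) / 2 * sph_over_r u1 j x)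
    (fun x => rad_sph H2 j x + (n%:R - 2) / 2 * sph_over_r u2 j x).
Proof.
have := partsD (parts_radial (sphP j) (wd_sph n3 data1 j) (wd_sph n3 data2 j))
  (parts_realM (mfun_div (n%:R - 2) 2) (sphP j)).
apply: parts_ae => // x x0; rewrite rad_dsph// -sph_div invfM; congr (_ + _); ring.
Qed.

Lemma parts_weighted_spherical j :
  parts (fun x => (r x `^ (1 - n%:R / 2))%:C%C *
      radial (fun y => (r y `^ (n%:R / 2 - 1))%:C%C * spherical j f y) x)
    (fun x => rad_sph H1 j x + (n%:R - 2) / 2 * sph_over_r u1 j x)
    (fun x => rad_sph H2 j x + (n%:R - 2) / 2 * sph_over_r u2 j x).
Proof.
have wP := parts_realM (mfun_enorm_powR (n%:R / 2 - 1)) (sphP j).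
have := parts_realM (mfun_enorm_powR (1 - n%:R / 2))
  (parts_radial wP (fun k => wd_enorm_powR n0 s2 (wd_sph n3 data1 j k))
    (fun k => wd_enorm_powR n0 s2 (wd_sph n3 data2 j k))).
have s0 : 1 - n%:R / 2 + (n%:R / 2 - 1) = 0 :> R by ring.
apply: parts_ae => // x x0; rewrite (weighted_radial x0 _ _ s0) rad_dsph// sph_div.
  by congr (_ + _ * _); field.
by congr (_ + _ * _); field.
Qed.

(** The functions are known through their parts only, so that this gives both forms of
    the identity. *)
Lemma norm_identity (F A B : V -> R[i]) (C D : 'I_n -> V -> R[i]) :
  parts F (trace_hess H1) (trace_hess H2) ->
  parts A (rad_part u1 H1) (rad_part u2 H2) ->
  parts B (fun x => trace_hess H1 x - rad_part u1 H1 x) (fun x => trace_hess H2 x - rad_part u2 H2 x) ->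
  (forall j, parts (C j) (sph_over_r u1 j) (sph_over_r u2 j)) ->
  (forall j, parts (D j) (fun x => rad_sph H1 j x + (n%:R - 2) / 2 * sph_over_r u1 j x)
    (fun x => rad_sph H2 j x + (n%:R - 2) / 2 * sph_over_r u2 j x)) ->
  (normL2 F ^+ 2 = normL2 A ^+ 2 + normL2 B ^+ 2
    + (n%:R * (n%:R - 4) / 2)%:E * \sum_(j < n) normL2 (C j) ^+ 2
    + 2%:E * \sum_(j < n) normL2 (D j) ^+ 2)%E.
Proof.
move=> FP AP BP CP DP.
have [T1 A1 V1 S1] := L2_H2_data n3 data1; have [T2 A2 V2 S2] := L2_H2_data n3 data2.
rewrite (parts_normL2 FP)// (parts_normL2 AP)// (parts_normL2 BP); [|exact: L2B|exact: L2B].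
under eq_bigr => j _ do rewrite (parts_normL2 (CP j) (V1 j) (V2 j)).
under [X in (_ + 2%:E * X)%E]eq_bigr => j _ do rewrite (parts_normL2 (DP j)
  (L2D (S1 j) (L2Z _ (V1 j))) (L2D (S2 j) (L2Z _ (V2 j)))).
rewrite !sumEFin -!EFinM -!EFinD; congr EFin.
rewrite (real_identity_H2_data n3 data1) (real_identity_H2_data n3 data2) !big_split /=.
set t1 := \sum_(a < n) _; set t2 := \sum_(a < n) _; set t3 := \sum_(a < n) _; set t4 := \sum_(a < n) _.
ring.
Qed.

End terms.

Local Open Scope complex_scope.

Theorem theorem1p2 (R : realType) (n : nat) (hn : (5 <= n)%N)
    (f : 'rV[R]_n -> R[i]) (hf : memH2 f) :
  (normL2 (laplacian f) ^+ 2 =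
     normL2 (fun x => radial (radial f) x
                      + ((n%:R - 1) / enorm x)%:C * radial f x)%R ^+ 2
     + normL2 (fun x => \sum_(j < n) spherical j (spherical j f) x)%R ^+ 2
     + (n%:R * (n%:R - 4) / 2)%:E *
         \sum_(j < n)
           normL2 (fun x => (1 / enorm x)%:C * spherical j f x)%R ^+ 2
     + 2%:E *
         \sum_(j < n)
           normL2 (fun x => radial (spherical j f) x
                     + ((n%:R - 2) / (2 * enorm x))%:C * spherical j f x)%R ^+ 2)%E
  /\
  (normL2 (laplacian f) ^+ 2 =
     normL2 (fun x => (enorm x `^ (1 - n%:R))%:C *
               radial (fun y => (enorm y `^ (n%:R - 1))%:C * radial f y) x)%R ^+ 2
     + normL2 (fun x => \sum_(j < n) spherical j (spherical j f) x)%R ^+ 2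
     + (n%:R * (n%:R - 4) / 2)%:E *
         \sum_(j < n)
           normL2 (fun x => (1 / enorm x)%:C * spherical j f x)%R ^+ 2
     + 2%:E *
         \sum_(j < n)
           normL2 (fun x => (enorm x `^ (1 - n%:R / 2))%:C *
                     radial (fun y => (enorm y `^ (n%:R / 2 - 1))%:C
                                      * spherical j f y) x)%R ^+ 2)%E.
Proof.
have [h1 [h2 [h1_ h2_ fh1 fh2]]] := memH2_weak_lap hf.
have [fL _] := hf; have [f1 f2] := memL2_parts fL.
have [u1 [H1 data1]] := weak_lap_H2_data f1 h1_ fh1.
have [u2 [H2 data2]] := weak_lap_H2_data f2 h2_ fh2.
have fP : parts f (fun x => complex.Re (f x)) (fun x => complex.Im (f x)).
  by apply: parts_refl; have [] := fL.
have LP := parts_laplacian fP data1 data2.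
have BP := parts_spherical2 hn fP data1 data2.
have CP := parts_spherical_div hn fP data1 data2.
split.
- exact: (norm_identity hn data1 data2 LP (parts_radial2 hn fP data1 data2) BP CP
    (parts_radial_spherical hn fP data1 data2)).
- exact: (norm_identity hn data1 data2 LP (parts_weighted_radial2 hn fP data1 data2) BP CP
    (parts_weighted_spherical hn fP data1 data2)).
Qed.
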